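(* Let $s=s_{(\beta,\phi)}$ be a $\mathbb C^*$-fixed section of $\mathcal M_{\mathrm{DH}}\to\mathbb{CP}^1$ with lift over $\mathbb C$ $$\hat s(\lambda)=\big(\lambda,\ \bar\partial+\lambda\Psi+O(\lambda^2),\ \Phi+\lambda\partial+O(\lambda^2)\big),\qquad\Psi=\Phi^{*_h}+\beta_1,\quad\partial=\partial^h+\phi_0 .$$ Let $\dot s$ be a tangent vector at $s$ represented by the infinitesimal variation of lifts $\dot{\hat s}(\lambda)=(\lambda,\sum_{k\ge0}\psi_k\lambda^k,\sum_{k\ge0}\varphi_k\lambda^k)$, $\psi_k\in\Omega^{0,1}(\mathfrak{sl}(E))$, $\varphi_k\in\Omega^{1,0}(\mathfrak{sl}(E))$. Then the second variation of $\mathcal E$ at $s$ is $$d^2\mathcal E(\dot s)=\frac1{2\pi i}\int_\Sigma\mathrm{tr}\big(\psi_0\wedge[\varphi_1,\xi]+\varphi_1\wedge[\psi_0,\xi]+\psi_1\wedge[\varphi_0,\xi]+\varphi_0\wedge[\psi_1,\xi]+2\varphi_0\wedge\psi_1\big).$$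
   Context: Let $\Sigma$ be a compact Riemann surface of genus at least two and $E\to\Sigma$ a smooth rank $n$ vector bundle of degree $0$ with structure group $\mathrm{SU}(n)$. An $\mathrm{SL}(n,\mathbb C)$ $\lambda$-connection is a pair $(\bar\partial,D)$ of a holomorphic structure on $E$ and an operator $D\colon\Gamma(E)\to\Omega^{1,0}(E)$ with $D(fs)=\lambda\,\partial f\otimes s+fDs$, $\bar\partial D+D\bar\partial=0$, inducing the trivial structure and $\lambda\partial_\Sigma$ on $\Lambda^nE$; stable means every $D$-invariant proper holomorphic subbundle has negative degree, polystable means direct sum of stable ones of degree $0$; for $\lambda=0$ it is a Higgs bundle. $\mathcal M_{\mathrm{Hod}}(\Sigma)$ is the moduli space of $(\lambda,\bar\partial,D)$ with $(\bar\partial,D)$ polystable, modulo $\Gamma(\Sigma,\mathrm{SL}(E))$, with $\mathbb C^*$-action $\zeta\cdot[\lambda,\bar\partial,D]=[\zeta\lambda,\bar\partial,\zeta D]$. $\mathcal M_{\mathrm{DH}}$ is the gluing of $\mathcal M_{\mathrm{Hod}}(\Sigma)$ and $\mathcal M_{\mathrm{Hod}}(\overline\Sigma)$ over $\mathbb C^*$ via $[\lambda,\bar\partial,D]\sim[\lambda^{-1},\lambda^{-1}D,\lambda^{-1}\bar\partial]$, with projection $\varpi$ to $\mathbb{CP}^1$. Energy: for a section (germ at $\lambda=0$) with lift $(\lambda,\bar\partial+\lambda\Psi+O(\lambda^2),\Phi+\lambda\partial+O(\lambda^2))$ to holomorphic $\lambda$-connections, $\mathcal E(s)=\frac1{2\pi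 i}\int_\Sigma\mathrm{tr}(\Phi\wedge\Psi)$, independent of the lift. The second variation $d^2\mathcal E(\dot s)$ is $\frac{d^2}{dt^2}|_{t=0}\mathcal E(s_t)$ for a family of sections $s_t$, $s_0=s$, with lifts $\hat s_t$ satisfying $\hat s_0=\hat s$ and $\frac{d}{dt}|_{t=0}\hat s_t=\dot{\hat s}$. Let $(\bar\partial,\Phi)$ be a stable $\mathbb C^*$-fixed Higgs bundle. It has a holomorphic splitting $E=\bigoplus_{j=1}^lE_j$ with $\Phi=\sum_j\Phi^{(j)}$, $\Phi^{(j)}\in H^0(\Sigma,\mathrm{Hom}(E_j,E_{j+1})\otimes K_\Sigma)$. Put $\mathfrak{sl}(E)_k=\{\psi\in\mathfrak{sl}(E)\mid\psi(E_i)\subset E_{i-k}\ \forall i\}$, $N_+=\bigoplus_{k>0}\mathfrak{sl}(E)_k$, $\mathbb L=\mathfrak{sl}(E)_0$. Let $h$ be the harmonic metric, $\partial^h$ the $(1,0)$-part of the Chern connection, $\Phi^{*_h}$ the adjoint, and $$\mathcal B^+_{(\bar\partial,\Phi)}=\{(\beta,\phi)\in\Omega^{0,1}(N_+)\oplus\Omega^{1,0}(\mathbb L\oplus N_+)\mid\bar\partial\phi+[(\Phi+\phi)\wedge\beta]=0,\ \partial^h\beta+[\Phi^{*_h}\wedge\phi]=0\}.$$ Write $\beta=\sum_{j\ge1}\beta_j$, $\phi=\sum_{j\ge0}\phi_j$ with components in $\mathfrak{sl}(E)_j$. For $(\beta,\phi)\in\mathcal B^+_{(\bar\partial,\Phi)}$,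 $s_{(\beta,\phi)}$ is the $\mathbb C^*$-fixed section with value at $\lambda=1$ the irreducible flat connection $\bar\partial+\Phi^{*_h}+\beta+\partial^h+\Phi+\phi$; over $\mathbb C$ it has the lift $\hat s(\lambda)=(\lambda,\ \bar\partial+\lambda(\Phi^{*_h}+\beta_1)+\sum_{j\ge2}\lambda^j\beta_j,\ \Phi+\lambda\partial^h+\sum_{j\ge0}\lambda^{j+1}\phi_j)$. $\xi\in\Gamma(\Sigma,\mathfrak{sl}(E))$ is the trace-free endomorphism acting on $E_k$ as the scalar $l-k-m$, where $m=\frac1n\sum_{j=1}^l(l-j)\mathrm{rk}(E_j)$; thus $[\xi,\cdot]$ acts as multiplication by $k$ on $\mathfrak{sl}(E)_k$, and $[\Phi,\xi]=\Phi$, $[\Psi,\xi]=-\Psi$. *)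

(* Defs.v *)
From HB Require Import structures.
From mathcomp Require Import all_boot all_order all_algebra.
From mathcomp Require Import complex.
From mathcomp Require Import all_classical all_reals all_analysis.

Set Implicit Arguments.
Unset Strict Implicit.
Unset Printing Implicit Defensive.

Import Order.TTheory GRing.Theory Num.Theory.
Import numFieldNormedType.Exports.

#[global] Open Scope classical_set_scope.
#[global] Open Scope complex_scope.
#[global] Open Scope ring_scope.

Notation cRe := (@complex.Re _).
Notation cIm := (@complex.Im _).

(* ** Smooth functions and Wirtinger derivatives.
   The plane is R * R; R[i] carries only algebra, so analytic notions on
   R[i]-valued functions are imposed on real and imaginary parts. *)

Fixpoint iterated_derive {R : realType} {V : normedModType R}
    (vs : seq V) (f : V -> R) : V -> R :=
  if vs is v :: vs' then fun x => 'D_v (iterated_derive vs' f) x else f.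

Definition smooth_on {R : realType} {V : normedModType R}
    (U : set V) (f : V -> R) : Prop :=
  forall (vs : seq V) (x : V), U x ->
    {for x, continuous (iterated_derive vs f)} /\
    forall v : V, derivable (iterated_derive vs f) x v.

Definition csmooth_on {R : realType} {V : normedModType R}
    (U : set V) (f : V -> R[i]) : Prop :=
  smooth_on U (cRe \o f) /\ smooth_on U (cIm \o f).

Definition mxsmooth_on {R : realType} {V : normedModType R} {m k : nat}
    (U : set V) (f : V -> 'M[R[i]]_(m, k)) : Prop :=
  forall a b, csmooth_on U (fun x => f x a b).

Definition to_complex {R : realType} (p : R * R) : R[i] := p.1 +i* p.2.

Definition cderive {R : realType} {V : normedModType R}
    (v : V) (f : V -> R[i]) (x : V) : R[i] :=
  ('D_v (cRe \o f) x) +i* ('D_v (cIm \o f) x).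

Definition wirtinger {R : realType} (f : R * R -> R[i]) (p : R * R) : R[i] :=
  (cderive ((1, 0) : R * R) f p - 'i%C * cderive ((0, 1) : R * R) f p) / 2%:R.

Definition wirtinger_bar {R : realType} (f : R * R -> R[i]) (p : R * R) : R[i] :=
  (cderive ((1, 0) : R * R) f p + 'i%C * cderive ((0, 1) : R * R) f p) / 2%:R.

Definition is_cderive {R : realType} (f : R -> R[i]) (t : R) (v : R[i]) : Prop :=
  is_derive t 1 (cRe \o f) (cRe v) /\ is_derive t 1 (cIm \o f) (cIm v).

Definition second_derivative_at0 {R : realType} (f : R -> R[i]) (v : R[i]) : Prop :=
  exists f' : R -> R[i],
    (\forall t \near (0 : R), is_cderive f t (f' t)) /\ is_cderive f' 0 v.

Definition cseries_to {R : realType} (a : nat -> R[i]) (v : R[i]) : Prop :=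
  ((fun N : nat => cRe (\sum_(k < N) a k)) @ \oo --> cRe v) /\
  ((fun N : nat => cIm (\sum_(k < N) a k)) @ \oo --> cIm v).

Definition disc {R : realType} (r : R) : set (R * R) :=
  [set q | q.1 ^+ 2 + q.2 ^+ 2 < r ^+ 2].

(* ** Riemann surfaces *)

Record surface (R : realType) := Surface {
  points :> topologicalType;
  atlas : Type;
  chart_dom : atlas -> set points;
  chart : atlas -> points -> R * R;
  chart_inv : atlas -> R * R -> points
}.
Arguments chart_dom {R} s _.
Arguments chart {R} s _ _.
Arguments chart_inv {R} s _ _.

Definition chart_image {R : realType} (S : surface R) (i : atlas S) : set (R * R) :=
  chart S i @` chart_dom S i.

Definition dz {R : realType} (S : surface R) (i : atlas S) (f : S -> R[i]) (x : S) : R[i] :=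
  wirtinger (f \o chart_inv S i) (chart S i x).

Definition dzbar {R : realType} (S : surface R) (i : atlas S) (f : S -> R[i]) (x : S) : R[i] :=
  wirtinger_bar (f \o chart_inv S i) (chart S i x).

Definition mxdz {R : realType} (S : surface R) {n : nat} (i : atlas S)
    (u : S -> 'M[R[i]]_n) (x : S) : 'M[R[i]]_n :=
  \matrix_(a, b) dz i (fun y => u y a b) x.

Definition mxdzbar {R : realType} (S : surface R) {n : nat} (i : atlas S)
    (u : S -> 'M[R[i]]_n) (x : S) : 'M[R[i]]_n :=
  \matrix_(a, b) dzbar i (fun y => u y a b) x.

(* dz_j / dz_i *)
Definition jac {R : realType} (S : surface R) (i j : atlas S) (x : S) : R[i] :=
  dz i (to_complex \o chart S j) x.

Definition riemann_surface {R : realType} (S : surface R) : Prop :=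
  [/\ hausdorff_space S /\ (forall x : S, exists i, chart_dom S i x),
      forall i, open (chart_dom S i) /\ open (chart_image (S := S) i),
      forall i x, chart_dom S i x -> chart_inv S i (chart S i x) = x,
      forall i,
        (forall x, chart_dom S i x -> {for x, continuous (chart S i)}) /\
        (forall p, chart_image (S := S) i p -> {for p, continuous (chart_inv S i)}) &
      forall (i j : atlas S),
        csmooth_on (chart S i @` (chart_dom S i `&` chart_dom S j))
          (fun p => to_complex (chart S j (chart_inv S i p))) /\
        forall x, chart_dom S i x -> chart_dom S j x ->
          dzbar i (to_complex \o chart S j) x = 0].

Definition compact_riemann_surface {R : realType} (S : surface R) : Prop :=
  [/\ riemann_surface S, compact [set: S] & connected [set: S]].

Definition conj_surface {R : realType} (S : surface R) : surface R :=
  @Surface R (points S) (atlas S) (chart_dom S)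
    (fun i x => ((chart S i x).1, - (chart S i x).2))
    (fun i p => chart_inv S i (p.1, - p.2)).

(* A form of any type is the family of its coefficients in the charts. *)
Definition holomorphic_one_form {R : realType} (S : surface R)
    (w : atlas S -> S -> R[i]) : Prop :=
  [/\ forall i, csmooth_on (chart_image (S := S) i) (w i \o chart_inv S i),
      forall i x, chart_dom S i x -> dzbar i (w i) x = 0 &
      forall i j x, chart_dom S i x -> chart_dom S j x ->
        w i x = w j x * jac i j x].

(* genus = dim H^0(K) *)
Definition genus_at_least {R : realType} (S : surface R) (d : nat) : Prop :=
  exists w : 'I_d -> atlas S -> S -> R[i],
    (forall k, holomorphic_one_form (w k)) /\
    forall c : 'I_d -> R[i],
      (forall i x, chart_dom S i x -> \sum_k c k * w k i x = 0) ->
      forall k, c k = 0.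

(* ** Integration.  A two-form is given by its coefficients with respect to
   dz_i /\ dzbar_i = -2i dx_i /\ dy_i. *)

Definition two_form {R : realType} (S : surface R) (w : atlas S -> S -> R[i]) : Prop :=
  (forall i, csmooth_on (chart_image (S := S) i) (w i \o chart_inv S i)) /\
  forall i j x, chart_dom S i x -> chart_dom S j x ->
    w i x = w j x * (jac i j x * (jac i j x)^*%C).

Definition plane_int {R : realType} (U : set (R * R)) (f : R * R -> R[i]) : R[i] :=
  let mu := ((@lebesgue_measure R) \x (@lebesgue_measure R))%E in
  (\int[mu]_(p in U) cRe (f p)) +i* (\int[mu]_(p in U) cIm (f p)).

(* The linear functional on smooth two-forms which is the plane Lebesgue
   integral on forms compactly supported in a chart.  On a compact Riemann
   surface it exists, by the change of variables formula, and its values on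
   smooth two-forms are unique, by partitions of unity. *)
Definition is_integration {R : realType} (S : surface R)
    (I : (atlas S -> S -> R[i]) -> R[i]) : Prop :=
  [/\ forall w w' : atlas S -> S -> R[i],
        (forall i x, chart_dom S i x -> w i x = w' i x) -> I w = I w',
      forall (c : R[i]) w w', two_form w -> two_form w' ->
        I (fun i x => c * w i x + w' i x) = c * I w + I w' &
      forall (i : atlas S) (K : set S) w, two_form w ->
        compact K -> K `<=` chart_dom S i ->
        (forall j x, chart_dom S j x -> ~ K x -> w j x = 0) ->
        I w = (- 2%:R * 'i%C) * plane_int (chart_image (S := S) i) (w i \o chart_inv S i)].

Definition surface_int {R : realType} (S : surface R) :
    (atlas S -> S -> R[i]) -> R[i] :=
  match pselect (exists I, @is_integration R S I) with
  | left ex => projT1 (cid ex)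
  | right _ => fun=> 0
  end.
Arguments surface_int {R} S _.

(* ** The bundle E and its endomorphism-valued forms.
   E is given by a smooth SU(n)-valued cocycle: s_i = g_ij s_j. *)

Definition mxadj {R : realType} {m k : nat} (A : 'M[R[i]]_(m, k)) : 'M[R[i]]_(k, m) :=
  (map_mx conjc A)^T.

Definition mxbracket {R : realType} {n : nat} (A B : 'M[R[i]]_n) : 'M[R[i]]_n :=
  A *m B - B *m A.

Definition cocycle {R : realType} (S : surface R) (n : nat) : Type :=
  atlas S -> atlas S -> S -> 'M[R[i]]_n.

(* Coefficient families of End(E)-valued functions or of (1,0)- and
   (0,1)-forms (coefficients of dz_i, dzbar_i), and of connections. *)
Definition endo {R : realType} (S : surface R) (n : nat) : Type :=
  atlas S -> S -> 'M[R[i]]_n.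

Definition SU_cocycle {R : realType} (S : surface R) (n : nat) (g : cocycle S n) : Prop :=
  [/\ forall i j, mxsmooth_on (chart S i @` (chart_dom S i `&` chart_dom S j))
                    (g i j \o chart_inv S i),
      forall i x, chart_dom S i x -> g i i x = 1%:M,
      forall i j k x, chart_dom S i x -> chart_dom S j x -> chart_dom S k x ->
        g i j x *m g j k x = g i k x &
      forall i j x, chart_dom S i x -> chart_dom S j x ->
        mxadj (g i j x) *m g i j x = 1%:M /\ \det (g i j x) = 1].

Definition chart_smooth {R : realType} (S : surface R) (n : nat) (u : endo S n) : Prop :=
  forall i, mxsmooth_on (chart_image (S := S) i) (u i \o chart_inv S i).

Definition endomorphism {R : realType} (S : surface R) (n : nat) (g : cocycle S n)
    (u : endo S n) : Prop :=
  chart_smooth u /\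
  forall i j x, chart_dom S i x -> chart_dom S j x ->
    u i x = g i j x *m u j x *m g j i x.

Definition form10 {R : realType} (S : surface R) (n : nat) (g : cocycle S n)
    (u : endo S n) : Prop :=
  chart_smooth u /\
  forall i j x, chart_dom S i x -> chart_dom S j x ->
    u i x = jac i j x *: (g i j x *m u j x *m g j i x).

Definition form01 {R : realType} (S : surface R) (n : nat) (g : cocycle S n)
    (u : endo S n) : Prop :=
  chart_smooth u /\
  forall i j x, chart_dom S i x -> chart_dom S j x ->
    u i x = (jac i j x)^*%C *: (g i j x *m u j x *m g j i x).

Definition trace_free {R : realType} (S : surface R) (n : nat) (u : endo S n) : Prop :=
  forall i x, chart_dom S i x -> \tr (u i x) = 0.

(* a /\ b for a = a_i dz_i, b = b_i dzbar_i, and b /\ a; the sign is that of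
   dzbar /\ dz = - dz /\ dzbar.  In particular [a /\ b] has coefficient
   mxbracket (a_i) (b_i). *)
Definition wedge10_01 {R : realType} (S : surface R) (n : nat) (a b : endo S n) : endo S n :=
  fun i x => a i x *m b i x.
Definition wedge01_10 {R : realType} (S : surface R) (n : nat) (b a : endo S n) : endo S n :=
  fun i x => - (b i x *m a i x).

(* The operator dbar = d/dzbar + alpha on E. *)
Definition dbar_operator {R : realType} (S : surface R) (n : nat) (g : cocycle S n)
    (alpha : endo S n) : Prop :=
  chart_smooth alpha /\
  forall i j x, chart_dom S i x -> chart_dom S j x ->
    alpha i x = (jac i j x)^*%C *: (g i j x *m alpha j x *m g j i x)
                - mxdzbar i (g i j) x *m g j i x.

(* The operator D = lam d/dz + b on E. *)
Definition lam_operator {R : realType} (S : surface R) (n : nat) (g : cocycle S n)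
    (lam : R[i]) (b : endo S n) : Prop :=
  chart_smooth b /\
  forall i j x, chart_dom S i x -> chart_dom S j x ->
    b i x = jac i j x *: (g i j x *m b j x *m g j i x)
            - lam *: (mxdz i (g i j) x *m g j i x).

(* Induced operators on End(E). *)
Definition dbar_end {R : realType} (S : surface R) (n : nat) (alpha u : endo S n) : endo S n :=
  fun i x => mxdzbar i (u i) x + mxbracket (alpha i x) (u i x).
Definition lam_end {R : realType} (S : surface R) (n : nat) (lam : R[i])
    (b u : endo S n) : endo S n :=
  fun i x => lam *: mxdz i (u i) x + mxbracket (b i x) (u i x).

(* (dbar D + D dbar), with respect to dz /\ dzbar. *)
Definition curvature {R : realType} (S : surface R) (n : nat) (lam : R[i])
    (alpha b : endo S n) : endo S n :=
  fun i x => lam *: mxdz i (alpha i) x - mxdzbar i (b i) x + mxbracket (b i x) (alpha i x).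

(* ** lambda-connections *)

Record lconn (R : realType) (A X : Type) (n : nat) := LConn {
  lam : R[i];
  dbar : A -> X -> 'M[R[i]]_n;
  Dop : A -> X -> 'M[R[i]]_n
}.
Arguments LConn {R A X n} _ _ _.

Definition lconn_on {R : realType} (S : surface R) (n : nat) : Type :=
  lconn R (atlas S) S n.

(* The trace conditions say that the operators induced on the trivial bundle
   Lambda^n E (recall det g = 1) are dbar and lam d. *)
Definition lambda_connection {R : realType} (S : surface R) (n : nat) (g : cocycle S n)
    (c : lconn_on S n) : Prop :=
  [/\ dbar_operator g (dbar c), lam_operator g (lam c) (Dop c),
      @trace_free R S n (dbar c), @trace_free R S n (Dop c) &
      forall i x, chart_dom S i x -> @curvature R S n (lam c) (dbar c) (Dop c) i x = 0].

(* A subbundle is given by a smooth projection onto it. *)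
Definition subbundle {R : realType} (S : surface R) (n : nat) (g : cocycle S n)
    (p : endo S n) (r : nat) : Prop :=
  endomorphism g p /\
  forall i x, chart_dom S i x -> p i x *m p i x = p i x /\ \rank (p i x) = r.

(* im p is a holomorphic D-invariant subbundle. *)
Definition invariant {R : realType} (S : surface R) (n : nat) (c : lconn_on S n)
    (p : endo S n) : Prop :=
  forall i x, chart_dom S i x ->
    (1%:M - p i x) *m (mxdzbar i (p i) x + dbar c i x *m p i x) = 0 /\
    (1%:M - p i x) *m (lam c *: mxdz i (p i) x + Dop c i x *m p i x) = 0.

(* Chern-Weil: deg (im p) = i/2pi int tr F(p nabla p) for any connection nabla
   on E, where F(p nabla p) = p F p + p (nabla p /\ nabla p) p. *)
Definition has_degree {R : realType} (S : surface R) (n : nat) (g : cocycle S n)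
    (p : endo S n) (d : R[i]) : Prop :=
  exists alpha b : endo S n,
    [/\ dbar_operator g alpha, lam_operator g 1 b &
        d = ('i%C / (2%:R * pi%:C)) * surface_int S (fun i x =>
          \tr (p i x *m (curvature 1 alpha b i x
                 + mxbracket (lam_end 1 b p i x) (dbar_end alpha p i x))))].

(* im q (of rank k) is stable with respect to subbundles of im q; used for q
   invariant and of degree 0. *)
Definition stable_on {R : realType} (S : surface R) (n : nat) (g : cocycle S n)
    (c : lconn_on S n) (q : endo S n) (k : nat) : Prop :=
  forall (p : endo S n) (r : nat) (d : R[i]),
    subbundle g p r -> (0 < r < k)%N ->
    (forall i x, chart_dom S i x -> q i x *m p i x = p i x) ->
    invariant c p -> has_degree g p d -> d < 0.

Definition stable {R : realType} (S : surface R) (n : nat) (g : cocycle S n)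
    (c : lconn_on S n) : Prop :=
  lambda_connection g c /\ @stable_on R S n g c (fun _ _ => 1%:M) n.

Definition polystable {R : realType} (S : surface R) (n : nat) (g : cocycle S n)
    (c : lconn_on S n) : Prop :=
  lambda_connection g c /\
  exists (N : nat) (q : 'I_N -> endo S n) (rk : 'I_N -> nat),
    [/\ forall k, subbundle g (q k) (rk k) /\ (0 < rk k)%N,
        forall i x, chart_dom S i x ->
          \sum_k q k i x = 1%:M /\ (forall a b, a != b -> q a i x *m q b i x = 0),
        forall k i x, chart_dom S i x ->
          dbar_end (dbar c) (q k) i x = 0 /\ lam_end (lam c) (Dop c) (q k) i x = 0 &
        forall k, has_degree g (q k) 0 /\ stable_on g c (q k) (rk k)].

Definition irreducible_conn {R : realType} (S : surface R) (n : nat) (g : cocycle S n)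
    (c : lconn_on S n) : Prop :=
  forall (p : endo S n) (r : nat),
    subbundle g p r -> invariant c p -> r = 0%N \/ r = n.

Definition gauge {R : realType} (S : surface R) (n : nat) (g : cocycle S n)
    (u : endo S n) : Prop :=
  endomorphism g u /\ forall i x, chart_dom S i x -> \det (u i x) = 1.

Definition gauge_equiv {R : realType} (S : surface R) (n : nat) (g : cocycle S n)
    (c c' : lconn_on S n) : Prop :=
  lam c = lam c' /\
  exists u : endo S n, gauge g u /\
    forall i x, chart_dom S i x ->
      let v := invmx (u i x) in
      dbar c' i x = u i x *m dbar c i x *m v - mxdzbar i (u i) x *m v /\
      Dop c' i x = u i x *m Dop c i x *m v - lam c *: (mxdz i (u i) x *m v).

(* ** The Deligne-Hitchin moduli space.
   inl: lambda-connections over S; inr: over the conjugate surface, whose charts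
   are the conjugates of those of S.  Since dwbar = dz for w = zbar, the gluing
   is literally an exchange of coefficient families. *)

Definition dh_rep {R : realType} (S : surface R) (n : nat) : Type :=
  (lconn_on S n + lconn_on (conj_surface S) n)%type.

Definition dh_flip {R : realType} (S : surface R) (n : nat) (c : lconn_on S n) :
    lconn_on (conj_surface S) n :=
  @LConn R (atlas S) S n (lam c)^-1
    (fun i x => (lam c)^-1 *: Dop c i x) (fun i x => (lam c)^-1 *: dbar c i x).

Definition dh_valid {R : realType} (S : surface R) (n : nat) (g : cocycle S n)
    (a : dh_rep S n) : Prop :=
  match a with
  | inl c => @polystable R S n g c
  | inr c => @polystable R (conj_surface S) n g c
  end.

Definition dh_stable {R : realType} (S : surface R) (n : nat) (g : cocycle S n)
    (a : dh_rep S n) : Prop :=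
  match a with
  | inl c => @stable R S n g c
  | inr c => @stable R (conj_surface S) n g c
  end.

Definition dh_equiv {R : realType} (S : surface R) (n : nat) (g : cocycle S n)
    (a a' : dh_rep S n) : Prop :=
  match a, a' with
  | inl c, inl c' => @gauge_equiv R S n g c c'
  | inr c, inr c' => @gauge_equiv R (conj_surface S) n g c c'
  | inl c, inr c' => lam c != 0 /\ @gauge_equiv R (conj_surface S) n g (dh_flip c) c'
  | inr c', inl c => lam c != 0 /\ @gauge_equiv R (conj_surface S) n g c' (dh_flip c)
  end.

Definition dh_class {R : realType} (S : surface R) (n : nat) (g : cocycle S n)
    (a : dh_rep S n) : set (dh_rep S n) :=
  [set a' | dh_valid g a' /\ dh_equiv g a a'].

Definition M_DH {R : realType} (S : surface R) (n : nat) (g : cocycle S n) :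
    set (set (dh_rep S n)) :=
  [set P | exists a, dh_valid g a /\ P = dh_class g a].

(* CP^1 = option R[i], with None the point at infinity. *)
Definition dh_proj {R : realType} (S : surface R) (n : nat) (a : dh_rep S n) :
    option R[i] :=
  match a with
  | inl c => Some (lam c)
  | inr c => if lam c == 0 then None else Some (lam c)^-1
  end.

Definition CP1_at_infinity {R : realType} (mu : R[i]) : option R[i] :=
  if mu == 0 then None else Some mu^-1.

(* C^*-action; on the second chart it reads (mu, dbar', D') |->
   (zeta^-1 mu, dbar', zeta^-1 D'). *)
Definition dh_act {R : realType} (S : surface R) (n : nat) (zeta : R[i])
    (a : dh_rep S n) : dh_rep S n :=
  match a with
  | inl c => inl (LConn (zeta * lam c) (dbar c) (fun i x => zeta *: Dop c i x))
  | inr c => inr (LConn (zeta^-1 * lam c) (dbar c) (fun i x => zeta^-1 *: Dop c i x))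
  end.

(* Families l(lambda) of lambda-connections, lambda in U, smooth on U x S and
   holomorphic in lambda, with polystable members. *)
Definition holomorphic_family {R : realType} (S : surface R) (n : nat) (g : cocycle S n)
    (U : set (R * R)) (l : R[i] -> lconn_on S n) : Prop :=
  [/\ forall q, U q -> lam (l (to_complex q)) = to_complex q /\
                       polystable g (l (to_complex q)),
      forall i,
        mxsmooth_on (U `*` chart_image (S := S) i)
          (fun w : (R * R) * (R * R) => dbar (l (to_complex w.1)) i (chart_inv S i w.2)) /\
        mxsmooth_on (U `*` chart_image (S := S) i)
          (fun w : (R * R) * (R * R) => Dop (l (to_complex w.1)) i (chart_inv S i w.2)) &
      forall q i x a b, U q -> chart_dom S i x ->
        wirtinger_bar (fun q' => dbar (l (to_complex q')) i x a b) q = 0 /\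
        wirtinger_bar (fun q' => Dop (l (to_complex q')) i x a b) q = 0].

Definition dh_map {R : realType} (S : surface R) (n : nat) : Type :=
  option R[i] -> set (dh_rep S n).

Definition lift_on {R : realType} (S : surface R) (n : nat) (g : cocycle S n)
    (s : dh_map S n) (U : set (R * R)) (l : R[i] -> lconn_on S n) : Prop :=
  holomorphic_family g U l /\
  forall q, U q -> s (Some (to_complex q)) (inl (l (to_complex q))).

Definition lift_on_infinity {R : realType} (S : surface R) (n : nat) (g : cocycle S n)
    (s : dh_map S n) (U : set (R * R)) (l : R[i] -> lconn_on (conj_surface S) n) : Prop :=
  @holomorphic_family R (conj_surface S) n g U l /\
  forall q, U q -> s (CP1_at_infinity (to_complex q)) (inr (l (to_complex q))).

(* Sections of M_DH -> CP^1.  Holomorphy is expressed by local holomorphic lifts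
   wherever the value is stable, i.e. on the locus where M_DH is a manifold with
   local universal families; nothing is required at strictly polystable values. *)
Definition dh_section {R : realType} (S : surface R) (n : nat) (g : cocycle S n)
    (s : dh_map S n) : Prop :=
  [/\ forall z, M_DH g (s z) /\ (forall a, s z a -> dh_proj a = z),
      forall q0 c, s (Some (to_complex q0)) (inl c) -> stable g c ->
        exists U l, [/\ open U, U q0 & lift_on g s U l] &
      forall c, s None (inr c) -> @stable R (conj_surface S) n g c ->
        exists U l, [/\ open U, U (0, 0) & lift_on_infinity g s U l]].

Definition Cstar_fixed_section {R : realType} (S : surface R) (n : nat)
    (s : dh_map S n) : Prop :=
  forall (zeta : R[i]) (z : option R[i]), zeta != 0 ->
    s (omap (fun w => zeta * w) z) = @dh_act R S n zeta @` s z.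

(* ** Energy *)

(* The lambda-linear coefficient of the dbar-part of a lift. *)
Definition lift_Psi {R : realType} (S : surface R) (n : nat)
    (l : R[i] -> lconn_on S n) : endo S n :=
  fun i x => \matrix_(a, b)
    wirtinger (fun q => dbar (l (to_complex q)) i x a b) (0, 0).

Definition lift_energy {R : realType} (S : surface R) (n : nat)
    (l : R[i] -> lconn_on S n) : R[i] :=
  (2%:R * pi%:C * 'i%C)^-1 *
  surface_int S (fun i x => \tr (wedge10_01 (Dop (l 0)) (lift_Psi l) i x)).

(* E is the energy functional: its value at a section is given by any lift near
   lambda = 0 (the formula does not depend on the lift). *)
Definition is_energy {R : realType} (S : surface R) (n : nat) (g : cocycle S n)
    (E : dh_map S n -> R[i]) : Prop :=
  forall s r l, dh_section g s -> 0 < r -> lift_on g s (disc r) l ->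
    E s = lift_energy l.

(* ** Fixed Higgs bundles and their splitting *)

Definition Cstar_fixed_higgs {R : realType} (S : surface R) (n : nat) (g : cocycle S n)
    (alpha Phi : endo S n) : Prop :=
  forall zeta : R[i], zeta != 0 ->
    gauge_equiv g (LConn 0 alpha Phi) (LConn 0 alpha (fun i x => zeta *: Phi i x)).

(* E = E_1 + ... + E_l with E_(k+1) = im (p k) for k : 'I_l. *)
Definition higgs_splitting {R : realType} (S : surface R) (n : nat) (g : cocycle S n)
    (alpha Phi : endo S n) (l : nat) (p : 'I_l -> endo S n) (rk : 'I_l -> nat) : Prop :=
  [/\ forall k, subbundle g (p k) (rk k) /\ (0 < rk k)%N,
      forall i x, chart_dom S i x ->
        \sum_k p k i x = 1%:M /\ (forall a b, a != b -> p a i x *m p b i x = 0),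
      forall k i x, chart_dom S i x -> dbar_end alpha (p k) i x = 0 &
      forall (a b : 'I_l) i x, chart_dom S i x -> (b : nat) <> a.+1 ->
        p b i x *m Phi i x *m p a i x = 0].

(* The component of u in sl(E)_j: the part mapping E_a into E_(a-j). *)
Definition grade {R : realType} (S : surface R) (n l : nat) (p : 'I_l -> endo S n)
    (j : nat) (u : endo S n) : endo S n :=
  fun i x => \sum_(a < l) \sum_(b < l | (a : nat) == (b + j)%N)
    p b i x *m u i x *m p a i x.

(* u takes values in the sum of the sl(E)_k, k >= d. *)
Definition grade_ge {R : realType} (S : surface R) (n l : nat) (p : 'I_l -> endo S n)
    (d : nat) (u : endo S n) : Prop :=
  trace_free u /\
  forall (a b : 'I_l) i x, chart_dom S i x -> (a < b + d)%N ->
    p b i x *m u i x *m p a i x = 0.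

(* k : 'I_l stands for the summand E_(k+1), whence l - k.+1. *)
Definition xi_mean {R : realType} (n l : nat) (rk : 'I_l -> nat) : R[i] :=
  n%:R^-1 * \sum_(k < l) ((l - k.+1) * rk k)%N%:R.

Definition xi {R : realType} (S : surface R) (n l : nat) (p : 'I_l -> endo S n)
    (rk : 'I_l -> nat) : endo S n :=
  fun i x => \sum_(k < l) ((l - k.+1)%N%:R - @xi_mean R n l rk) *: p k i x.

(* ** Harmonic metric *)

Definition hermitian_metric {R : realType} (S : surface R) (n : nat) (g : cocycle S n)
    (h : endo S n) : Prop :=
  [/\ chart_smooth h,
      forall i j x, chart_dom S i x -> chart_dom S j x ->
        h j x = mxadj (g i j x) *m h i x *m g i j x &
      forall i x, chart_dom S i x -> mxadj (h i x) = h i x /\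
        forall v : 'cV[R[i]]_n, v != 0 -> 0 < (mxadj v *m h i x *m v) 0 0].

(* With h(s, t) = t^* h s, the (1,0)-part d/dz + chern of the Chern connection is
   determined by d_z (h(s, t)) = h(partial^h s, t) + h(s, dbar t). *)
Definition chern {R : realType} (S : surface R) (n : nat) (h alpha : endo S n) : endo S n :=
  fun i x => invmx (h i x) *m (mxdz i (h i) x - mxadj (alpha i x) *m h i x).

Definition adj_h {R : realType} (S : surface R) (n : nat) (h u : endo S n) : endo S n :=
  fun i x => invmx (h i x) *m mxadj (u i x) *m h i x.

Definition harmonic_metric {R : realType} (S : surface R) (n : nat) (g : cocycle S n)
    (alpha Phi h : endo S n) : Prop :=
  hermitian_metric g h /\
  forall i x, chart_dom S i x ->
    curvature 1 alpha (chern h alpha) i x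
    + mxbracket (Phi i x) (adj_h h Phi i x) = 0.

(* The slice B^+; dbar phi has coefficient - dbar_end alpha phi, because phi is a
   (1,0)-form and dzbar /\ dz = - dz /\ dzbar. *)
Definition Bplus {R : realType} (S : surface R) (n : nat) (g : cocycle S n) (l : nat)
    (p : 'I_l -> endo S n) (alpha Phi h beta phi : endo S n) : Prop :=
  [/\ form01 g beta /\ grade_ge p 1 beta,
      form10 g phi /\ grade_ge p 0 phi,
      forall i x, chart_dom S i x ->
        - dbar_end alpha phi i x + mxbracket (Phi i x + phi i x) (beta i x) = 0 &
      forall i x, chart_dom S i x ->
        lam_end 1 (chern h alpha) beta i x + mxbracket (phi i x) (adj_h h Phi i x) = 0].

Definition flat_of_pair {R : realType} (S : surface R) (n : nat)
    (alpha Phi h beta phi : endo S n) : lconn_on S n :=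
  LConn 1 (fun i x => alpha i x + adj_h h Phi i x + beta i x)
          (fun i x => chern h alpha i x + Phi i x + phi i x).

(* s = s_(beta, phi) *)
Definition section_of_pair {R : realType} (S : surface R) (n : nat) (g : cocycle S n)
    (alpha Phi h beta phi : endo S n) (s : dh_map S n) : Prop :=
  [/\ dh_section g s, Cstar_fixed_section s,
      s (Some 1) = dh_class g (inl (flat_of_pair alpha Phi h beta phi)) &
      irreducible_conn g (flat_of_pair alpha Phi h beta phi)].

Definition lift_of_pair {R : realType} (S : surface R) (n l : nat)
    (p : 'I_l -> endo S n) (alpha Phi h beta phi : endo S n) (z : R[i]) : lconn_on S n :=
  LConn z
    (fun i x => alpha i x + z *: (adj_h h Phi i x + grade p 1 beta i x)
                + \sum_(2 <= j < l) z ^+ j *: grade p j beta i x)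
    (fun i x => Phi i x + z *: chern h alpha i x
                + \sum_(0 <= j < l) z ^+ j.+1 *: grade p j phi i x).

(* ** Variations *)

(* The family of sections st t, |t| < eps, with st 0 = s, and lifts lt t over
   |lambda| < r, smooth in (t, lambda, x), with lt 0 = l0 and
   d/dt lt = (lambda, sum_k psi_k lambda^k, sum_k varphi_k lambda^k) at t = 0. *)
Definition variation {R : realType} (S : surface R) (n : nat) (g : cocycle S n)
    (s : dh_map S n) (l0 : R[i] -> lconn_on S n) (psi varphi : nat -> endo S n)
    (eps r : R) (st : R -> dh_map S n) (lt : R -> R[i] -> lconn_on S n) : Prop :=
  [/\ [/\ 0 < eps, 0 < r & st 0 = s],
      forall t, `|t| < eps -> dh_section g (st t) /\ lift_on g (st t) (disc r) (lt t),
      forall i,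
        let U := [set t : R | `|t| < eps] `*` (disc r `*` chart_image (S := S) i) in
        mxsmooth_on U (fun w : R * ((R * R) * (R * R)) =>
          dbar (lt w.1 (to_complex w.2.1)) i (chart_inv S i w.2.2)) /\
        mxsmooth_on U (fun w : R * ((R * R) * (R * R)) =>
          Dop (lt w.1 (to_complex w.2.1)) i (chart_inv S i w.2.2)),
      forall q i x, disc r q -> chart_dom S i x ->
        dbar (lt 0 (to_complex q)) i x = dbar (l0 (to_complex q)) i x /\
        Dop (lt 0 (to_complex q)) i x = Dop (l0 (to_complex q)) i x &
      forall q i x a b, disc r q -> chart_dom S i x ->
        (exists v, is_cderive (fun t => dbar (lt t (to_complex q)) i x a b) 0 v /\
           cseries_to (fun k => to_complex q ^+ k * psi k i x a b) v) /\
        (exists v, is_cderive (fun t => Dop (lt t (to_complex q)) i x a b) 0 v /\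
           cseries_to (fun k => to_complex q ^+ k * varphi k i x a b) v)].

(* v is the second variation of E at s in the direction represented by
   (psi, varphi), relative to the lift l0 of s: along every variation as above,
   t |-> E(s_t) is twice differentiable at 0 with second derivative v. *)
Definition second_variation {R : realType} (S : surface R) (n : nat) (g : cocycle S n)
    (E : dh_map S n -> R[i]) (s : dh_map S n) (l0 : R[i] -> lconn_on S n)
    (psi varphi : nat -> endo S n) (v : R[i]) : Prop :=
  forall eps r st lt, variation g s l0 psi varphi eps r st lt ->
    second_derivative_at0 (fun t => E (st t)) v.

Definition endo_bracket {R : realType} (S : surface R) (n : nat) (u v : endo S n) : endo S n :=
  fun i x => mxbracket (u i x) (v i x).

(* Main.v *)
(* Along the family the energy is c * int tr(Phi_t Psi_t), hence its second
   derivative is c * int tr(Phi'' Psi + 2 Phi' Psi' + Phi Psi'').  Since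
   [Phi, xi] = Phi and [Psi, xi] = - Psi, the terms with a second derivative are
   - tr(xi ([Phi'', Psi] + [Phi, Psi''])).  The lambda-linear coefficient of the
   flatness equation, differentiated twice in t and paired with xi, trades them for
   the asserted integrand plus dz tr(xi a'') - dzbar tr(xi b''), where a and b are the
   constant coefficient of the dbar-part and the linear coefficient of the D-part;
   this is exact because xi is holomorphic and parallel for the Chern connection.

   The identities d^h xi = 0 and [Phi^*, xi] = - Phi^* come from a Bochner argument:
   with eta = xi - xi^*, u = d^h xi and Z = [Phi^*, eta], Hitchin's equation and
   dbar xi = 0 give dzbar tr(eta u) = - (|u|^2 + |Z|^2), so u = Z = 0 by Stokes.

   Integration is only known through the functional I of is_integration; Stokes,
   positivity and differentiation under I are reduced to the plane by partitions of
   unity.  If no such functional exists, surface_int is 0 and so are both sides. *)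

Require Import Defs.
From mathcomp Require Import all_boot all_order all_algebra.
From mathcomp Require Import complex.
From mathcomp Require Import all_classical all_reals all_analysis.
From mathcomp Require Import measurable_realfun.
From mathcomp Require Import zify ring lra.
Import Order.TTheory GRing.Theory Num.Theory.
Import numFieldNormedType.Exports.
Local Open Scope classical_set_scope.
Local Open Scope complex_scope.
Local Open Scope ring_scope.
Set Implicit Arguments.
Unset Strict Implicit.
Unset Printing Implicit Defensive.

(** * Calculus of smooth functions *)

(** Stokes applies to forms only, but neither part of a lift is a form: both transform like
    connections. The inhomogeneous term is constant in the parameters for the dbar-part and
    proportional to lambda for the D-part. So every parameter derivative of the dbar-part is a
    (0,1)-form, every t-derivative of the D-part is a (1,0)-form, and the lambda-derivative of the
    D-part at lambda = 0 is a (1,0)-connection, namely the Chern connection plus phi_0. The Bochner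
    argument is run with this connection; as phi_0 has degree 0, it acts on xi as the Chern
    connection does. The component beta_1 has degree 1, so Psi obeys the same relation as Phi^*.

    In lambda dz A - dzbar B + [B, A] = 0, one lambda-derivative and two t-derivatives at lambda = 0
    leave dz of the second variation of the constant coefficient of A and dzbar of that of the
    linear coefficient of B. This is why these two coefficients enter the exact term.

    Smoothness is given by iterated directional derivatives only, so the chain rule and the symmetry
    of mixed derivatives are derived from the mean value theorem. *)

Section directional.
Context {R : realType}.

Lemma near0_norm_lt (e : R) : 0 < e -> \forall h \near (0 : R), `|h| < e.
Proof. by move=> e0; exists e => //= y; rewrite /ball_ /= sub0r normrN. Qed.

Lemma dist_half_le (a b c e : R) :
  `|a - c| < e / 2 -> `|b - c| < e / 2 -> `|a - b| <= e.
Proof.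
move=> ac bc; rewrite -(subrKA c) (splitr e) ltW //.
by apply: le_lt_trans (ler_normD _ _) _; rewrite ltrD // distrC.
Qed.

(** The two difference quotients are literally equal, so neither differentiability of [e] nor a
    chain rule enters. Restrictions to lines and to slices of products rest on this. *)
Lemma derive_affine {V W : normedModType R} (e L : V -> W) (f : W -> R) (x v : V) :
  (forall h u y, e (h *: u + y) = h *: L u + e y) ->
  'D_v (f \o e) x = 'D_(L v) f (e x) /\
  (derivable (f \o e) x v <-> derivable f (e x) (L v)).
Proof.
move=> eL; rewrite /derive /derivable.
suff -> : (fun h : R => h^-1 *: (((f \o e) \o shift x) (h *: v) - (f \o e) x)) =
          (fun h : R => h^-1 *: ((f \o shift (e x)) (h *: L v) - f (e x))) by [].
by apply/funext => h /=; rewrite eL.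
Qed.

Lemma derive_line {V : normedModType R} (f : V -> R) (x v : V) (t : R) :
  'D_1 (fun s : R => f (s *: v + x)) t = 'D_v f (t *: v + x) /\
  (derivable (fun s : R => f (s *: v + x)) t 1 <-> derivable f (t *: v + x) v).
Proof.
have := @derive_affine (R : normedModType R) V (fun s : R => s *: v + x) (fun s : R => s *: v) f t 1.
rewrite /comp [1 *: v]scale1r; apply => h u y.
by rewrite scalerDl addrA scalerA.
Qed.

(** On the line through [x], passing to the direction [h *: v] is the reparametrisation
    [s |-> h * s]; the one-variable chain rule covers [h = 0] as well. *)
Lemma is_derive_scale_direction {V : normedModType R} (f : V -> R) (x v : V) (h : R) :
  derivable f x v -> is_derive x (h *: v) f (h * 'D_v f x).
Proof.
move=> dv.
have [e1 e2] := derive_line f x v 0.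
have [e3 e4] := derive_line f x (h *: v) 0.
rewrite !scale0r !add0r in e1 e2 e3 e4.
have d1 : is_derive (0 : R) 1 (fun s : R => f (s *: v + x)) ('D_v f x).
  by split; [apply/e2|].
have d0 : is_derive (0 : R) 1 (fun s : R => h * s) h.
  by apply: is_derive_eq; rewrite /GRing.scale /= mulr1.
have d2 : is_derive (0 : R) 1 ((fun s : R => f (s *: v + x)) \o (fun s : R => h * s))
    ('D_v f x * h).
  by apply: is_derive1_comp; rewrite mulr0.
have e5 : (fun s : R => f (s *: (h *: v) + x)) =
          (fun s : R => f (s *: v + x)) \o (fun s : R => h * s).
  by apply/funext => s /=; rewrite scalerA mulrC.
rewrite e5 in e3 e4.
case: (d2) => dd2 _; split; first exact: (e4.1 dd2).
by rewrite -e3 derive_val mulrC.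
Qed.

Lemma MVT_direction {V : normedModType R} (f : V -> R) (x v : V) (h : R) :
  (forall s : R, 0 <= s <= 1 -> derivable f ((s * h) *: v + x) v) ->
  exists2 s : R, 0 <= s <= 1 & f (h *: v + x) - f x = h * 'D_v f ((s * h) *: v + x).
Proof.
move=> df.
pose phi (s : R) := f (s *: (h *: v) + x).
have pd (s : R) : 0 <= s <= 1 -> is_derive s (1 : R) phi (h * 'D_v f ((s * h) *: v + x)).
  move=> s01; have /is_derive_scale_direction := df s s01.
  move=> /(_ h) [dh eh].
  have [e1 e2] := derive_line f x (h *: v) s.
  rewrite scalerA in e1 e2.
  by split; [apply/e2|rewrite e1].
have [|||s] := @MVT_segment R phi (fun s => h * 'D_v f ((s * h) *: v + x)) 0 1.
- exact: ler01.
- by move=> s; rewrite in_itv /= => /andP[s0 s1]; apply: pd; rewrite !ltW.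
- apply: derivable_within_continuous => s; rewrite in_itv /= => s01.
  by have [] := pd s s01.
rewrite in_itv /= => s01; rewrite /phi scale1r scale0r add0r subr0 mulr1 => e.
by exists s.
Qed.
End directional.

Section smooth.
Context {R : realType} {V : normedModType R}.
Implicit Types (U W : set V) (f : V -> R).

Lemma smooth_on_derive U f v : smooth_on U f -> smooth_on U ('D_v f).
Proof.
move=> sf vs x Ux.
suff -> : iterated_derive vs ('D_v f) = iterated_derive (rcons vs v) f.
  exact: sf.
by elim: vs => //= u vs ->.
Qed.

Lemma smooth_on_subset U W f : W `<=` U -> smooth_on U f -> smooth_on W f.
Proof. by move=> WU sf vs x /WU; exact: sf. Qed.

Lemma smooth_on_continuous U f x : smooth_on U f -> U x -> {for x, continuous f}.
Proof. by move=> sf /(sf [::])[]. Qed.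

Lemma smooth_on_derivable U f x v : smooth_on U f -> U x -> derivable f x v.
Proof. by move=> sf /(sf [::])[]. Qed.

Lemma open_near_eq U f g x : open U -> {in U, f =1 g} -> U x -> \near x, f x = g x.
Proof.
move=> oU fg Ux; have := open_nbhs_nbhs (conj oU Ux).
by apply: filterS => y /mem_set; exact: fg.
Qed.

Lemma derive_eq_on U f g v : open U -> {in U, f =1 g} -> {in U, 'D_v f =1 'D_v g}.
Proof.
move=> oU fg x /set_mem Ux; apply: near_eq_derive.
exact: open_near_eq Ux.
Qed.

(** By induction on the list of directions, every iterated derivative of a member of [P] agrees on
    [U] with a member of [P]. Agreement on the open set [U] suffices, since continuity and
    derivability at its points are local. *)
Lemma smooth_coind U (P : (V -> R) -> Prop) : open U ->
  (forall f, P f -> forall x, U x ->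
     {for x, continuous f} /\ forall v, derivable f x v) ->
  (forall f v, P f -> exists2 f', P f' & {in U, 'D_v f =1 f'}) ->
  forall f, P f -> smooth_on U f.
Proof.
move=> oU P1 P2 f Pf vs.
have [f' Pf' e] : exists2 f', P f' & {in U, iterated_derive vs f =1 f'}.
  elim: vs => [|v vs [f1 Pf1 e1]] /=; first by exists f.
  have [f2 Pf2 e2] := P2 f1 v Pf1.
  exists f2 => // x Ux; rewrite -e2 //.
  exact: (derive_eq_on v oU e1).
move=> x Ux; have [cf df] := P1 f' Pf' x Ux.
have ne := open_near_eq oU e Ux.
split=> [|v].
  have ne' : \near x, f' x = iterated_derive vs f x by apply: filterS ne.
  rewrite /prop_for /continuous_at e ?inE //.
  exact: cvg_trans (near_eq_cvg ne') cf.
apply: (near_eq_derivable _ (df v)).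
by apply: filterS ne.
Qed.

Lemma smooth_on_local U f :
  (forall x, U x -> exists W, exists g, [/\ open W, W x, smooth_on W g & {in W, f =1 g}]) ->
  smooth_on U f.
Proof.
move=> H vs x Ux; have [W [g [oW Wx sg fg]]] := H x Ux.
have sf : smooth_on W f.
  apply: (@smooth_coind W (fun f => exists2 g, smooth_on W g & {in W, f =1 g})) => //.
  - move=> f1 [g1 sg1 e] y Wy; have ne := open_near_eq oW e Wy.
    split=> [|v].
      have ne' : \near y, g1 y = f1 y by apply: filterS ne.
      rewrite /prop_for /continuous_at e ?inE //.
      apply: cvg_trans (near_eq_cvg ne') _.
      exact: smooth_on_continuous sg1 Wy.
    apply: (@near_eq_derivable _ _ _ g1); last exact: smooth_on_derivable sg1 Wy.
    by apply: filterS ne.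
  - move=> f1 v [g1 sg1 e]; exists ('D_v f1) => //; exists ('D_v g1).
      exact: smooth_on_derive.
    exact: derive_eq_on.
  - by exists g.
exact: sf.
Qed.

Lemma smooth_on_eq U f g : open U -> {in U, f =1 g} -> smooth_on U g -> smooth_on U f.
Proof.
by move=> oU fg sg; apply: smooth_on_local => x Ux; exists U, g.
Qed.

Lemma smooth_on_cst U (c : R) : smooth_on U (cst c).
Proof.
apply: (@smooth_on_subset setT); first exact: subsetT.
apply: (@smooth_coind setT (fun f => exists c, f = cst c)); last by exists c.
- exact: openT.
- by move=> f [{}c ->] x _; split; [exact: cst_continuous|move=> v; exact: derivable_cst].
- move=> f v [{}c ->]; exists (cst 0); first by exists 0.
  by move=> x _; rewrite derive_cst.
Qed.

(* MVT in the two variables of the square spanned by u and v. *)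
Lemma second_difference U f (u v x : V) (h : R) :
  smooth_on U f ->
  (forall s t : R, 0 <= s <= 1 -> 0 <= t <= 1 -> U ((t * h) *: v + ((s * h) *: u + x))) ->
  exists s t : R, [/\ 0 <= s <= 1, 0 <= t <= 1 &
    f (h *: v + (h *: u + x)) - f (h *: u + x) - (f (h *: v + x) - f x) =
    h * (h * 'D_v ('D_u f) ((t * h) *: v + ((s * h) *: u + x)))].
Proof.
move=> sf Uh.
have U0 (s : R) : 0 <= s <= 1 -> U ((s * h) *: u + x).
  move=> s01; have := Uh s 0 s01; rewrite mul0r scale0r add0r; apply.
  by rewrite lexx ler01.
have U1 (s : R) : 0 <= s <= 1 -> U (h *: v + ((s * h) *: u + x)).
  move=> s01; have := Uh s 1 s01; rewrite mul1r; apply.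
  by rewrite lexx ler01.
pose k y := f (h *: v + y) - f y.
have e1 y w : U y -> U (h *: v + y) ->
    derivable k y w /\ 'D_w k y = 'D_w f (h *: v + y) - 'D_w f y.
  move=> Uy Uvy.
  have eL (h' : R) u' y' : h *: v + (h' *: u' + y') = h' *: u' + (h *: v + y').
    by rewrite addrCA.
  have [e2 e3] := @derive_affine R V V (fun y => h *: v + y) id f y w eL.
  have d1 : derivable (f \o (fun y => h *: v + y)) y w.
    by apply/e3; exact: smooth_on_derivable sf Uvy.
  have d2 : derivable f y w by exact: smooth_on_derivable sf Uy.
  rewrite -e2; split; first exact: (derivableB d1 d2).
  exact: (deriveB d1 d2).
have [s s01 es] : exists2 s : R, 0 <= s <= 1 &
    k (h *: u + x) - k x = h * 'D_u k ((s * h) *: u + x).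
  apply: (@MVT_direction R V k x u h) => s s01.
  by have [] := e1 ((s * h) *: u + x) u (U0 s s01) (U1 s s01).
have [t t01 et] : exists2 t : R, 0 <= t <= 1 &
    'D_u f (h *: v + ((s * h) *: u + x)) - 'D_u f ((s * h) *: u + x) =
    h * 'D_v ('D_u f) ((t * h) *: v + ((s * h) *: u + x)).
  apply: (@MVT_direction R V ('D_u f) ((s * h) *: u + x) v h) => t t01.
  exact: (@smooth_on_derivable U _ _ v (smooth_on_derive u sf) (Uh s t s01 t01)).
exists s, t; split=> //.
rewrite -et -(e1 _ _ (U0 s s01) (U1 s s01)).2 -es /k.
by [].
Qed.

(** Exchanging [u] and [v] leaves the double difference over the parallelogram unchanged, so by
    [second_difference] the two mixed derivatives take equal values at two points arbitrarily close
    to [x]. Their continuity at [x] concludes. *)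
Lemma smooth_on_schwarz U f (u v x : V) : open U -> smooth_on U f -> U x ->
  'D_u ('D_v f) x = 'D_v ('D_u f) x.
Proof.
move=> oU sf Ux.
have cont w w' : {for x, continuous ('D_w ('D_w' f))}.
  exact: smooth_on_continuous (smooth_on_derive w (smooth_on_derive w' sf)) Ux.
have small (P : V -> Prop) : (\near x, P x) -> \forall h \near (0 : R),
    forall w w' (s t : R), (w, w') = (u, v) \/ (w, w') = (v, u) ->
    0 <= s <= 1 -> 0 <= t <= 1 -> P ((t * h) *: w' + ((s * h) *: w + x)).
  move=> /nbhs_ballP[e /= e0 Pe].
  have M0 : 0 < `|u| + `|v| + 1 by rewrite ltr_wpDl // addr_ge0.
  near=> h => w w' s t ww' s01 t01; apply: Pe; rewrite -ball_normE /=.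
  rewrite distrC addrA addrK.
  have hs (r : R) (y : V) : 0 <= r <= 1 -> `|(r * h) *: y| <= `|h| * `|y|.
    move=> /andP[r0 r1]; rewrite normrZ normrM (ger0_norm r0).
    by rewrite ler_wpM2r // ler_piMl.
  apply: le_lt_trans (ler_normD _ _) _.
  apply: le_lt_trans (lerD (hs _ _ t01) (hs _ _ s01)) _.
  rewrite -mulrDr.
  have -> : `|w'| + `|w| = `|u| + `|v| by case: ww' => -[-> ->] //; rewrite addrC.
  apply: (@le_lt_trans _ _ (`|h| * (`|u| + `|v| + 1))).
    by rewrite ler_wpM2l // lerDl.
  rewrite -ltr_pdivlMr //.
  by near: h; apply: near0_norm_lt; rewrite divr_gt0.
apply/eqP; rewrite -subr_eq0 -normr_le0; apply/ler_addgt0Pl => e e0; rewrite addr0.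
have e20 : 0 < e / 2 by rewrite divr_gt0.
have nU : \near x, U x by exact: open_nbhs_nbhs.
have /cvgrPdist_lt/(_ _ e20) c1 := cont u v.
have /cvgrPdist_lt/(_ _ e20) c2 := cont v u.
have n1 := small _ nU; have n2 := small _ c1; have n3 := small _ c2.
have n4 : \forall h \near (0 : R)^', h != 0 by exact: nbhs_dnbhs_neq.
have [h [h0 [H1 [H2 H3]]]] := filter_ex (filterI n4
  (filterI (nbhs_dnbhs n1) (filterI (nbhs_dnbhs n2) (nbhs_dnbhs n3)))).
have [s1 [t1 [s101 t101 es1]]] := second_difference sf
  (fun s t s01 t01 => H1 u v s t (or_introl erefl) s01 t01).
have [s2 [t2 [s201 t201 es2]]] := second_difference sf
  (fun s t s01 t01 => H1 v u s t (or_intror erefl) s01 t01).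
have H2' := H2 _ _ _ _ (or_intror erefl) s201 t201.
have H3' := H3 _ _ _ _ (or_introl erefl) s101 t101.
have eq : 'D_u ('D_v f) ((t2 * h) *: u + ((s2 * h) *: v + x)) =
          'D_v ('D_u f) ((t1 * h) *: v + ((s1 * h) *: u + x)).
  apply: (mulfI h0); apply: (mulfI h0).
  apply: (etrans (esym es2)); apply: (etrans _ es1).
  rewrite (addrCA (h *: v) (h *: u) x).
  move: (f _) (f _) (f _) (f _) => a b c d.
  ring.
rewrite -eq in H3'.
exact: (dist_half_le H2' H3').
Unshelve. all: by end_near.
Qed.

End smooth.

Section chain_rule.
Context {R : realType}.

Local Notation eX := ((1, 0) : R * R).
Local Notation eY := ((0, 1) : R * R).

Lemma shift_eX (h a b : R) : h *: eX + (a, b) = (h + a, b).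
Proof. by apply: injective_projections; rewrite /= /GRing.scale /= ?mulr1 ?mulr0 ?add0r. Qed.

Lemma shift_eY (h a b : R) : h *: eY + (a, b) = (a, h + b).
Proof. by apply: injective_projections; rewrite /= /GRing.scale /= ?mulr1 ?mulr0 ?add0r. Qed.

Lemma between_ball (a b e s : R) : 0 <= s <= 1 -> `|a - b| < e -> `|a - (s * (b - a) + a)| < e.
Proof.
move=> /andP[s0 s1] abe.
have -> : a - (s * (b - a) + a) = s * (a - b) by ring.
by rewrite normrM ger0_norm //; apply: le_lt_trans abe; rewrite ler_piMl.
Qed.

Lemma linear_combination_bound (a b c d x y e : R) : `|b - a| <= e -> `|d - c| <= e ->
  `|x * a + y * c - (b * x + d * y)| <= e * (`|x| + `|y|).
Proof.
move=> ba dc.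
have -> : x * a + y * c - (b * x + d * y) = (a - b) * x + (c - d) * y by ring.
apply: le_trans (ler_normD _ _) _; rewrite !normrM mulrDr.
by apply: lerD; apply: ler_wpM2r => //; rewrite distrC.
Qed.

(** Differentiability from continuous partial derivatives: a horizontal and a vertical segment join
    [q] to [p], and the mean value theorem is applied on each. Balls of the product norm are
    squares, so both segments stay inside. *)
Lemma increment_bound (W : set (R * R)) (f : R * R -> R) (p : R * R) (eps : R) :
  open W -> smooth_on W f -> W p -> 0 < eps ->
  \forall q \near p, `|f q - f p - ('D_eX f p * (q.1 - p.1) + 'D_eY f p * (q.2 - p.2))|
                     <= eps * (`|q.1 - p.1| + `|q.2 - p.2|).
Proof.
move=> oW sf Wp eps0.
have cX := @smooth_on_continuous _ _ _ _ _ (smooth_on_derive eX sf) Wp.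
have cY := @smooth_on_continuous _ _ _ _ _ (smooth_on_derive eY sf) Wp.
have /cvgrPdist_le/(_ _ eps0) nX := cX.
have /cvgrPdist_le/(_ _ eps0) nY := cY.
have nW : \near p, W p by exact: open_nbhs_nbhs.
have [d /= d0 dP] := (iffLR (nbhs_ballP p _)) (filterI nW (filterI nX nY)).
exists (ball p.1 d, ball p.2 d) => /=.
  by split; apply: nbhsx_ballx.
move=> [q1 q2] [] /= b1 b2; case: p Wp cX cY nX nY nW dP b1 b2 => p1 p2 /= Wp _ _ _ _ _ dP b1 b2.
have Q s : 0 <= s <= 1 -> ball (p1, p2) d (s * (q1 - p1) + p1, q2).
  by move=> s01; split => //=; apply: between_ball.
have Q' s : 0 <= s <= 1 -> ball (p1, p2) d (p1, s * (q2 - p2) + p2).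
  by move=> s01; split => //=; [exact: ballxx|exact: between_ball].
have [|s s01 es] := @MVT_direction R _ f (p1, q2) eX (q1 - p1).
  move=> s s01; rewrite shift_eX.
  by apply: (smooth_on_derivable sf); have [] := dP _ (Q s s01).
have [|t t01 et] := @MVT_direction R _ f (p1, p2) eY (q2 - p2).
  move=> t t01; rewrite shift_eY.
  by apply: (smooth_on_derivable sf); have [] := dP _ (Q' t t01).
rewrite !shift_eX subrK in es; rewrite !shift_eY subrK in et.
have [_ [bX _]] := dP _ (Q s s01).
have [_ [_ bY]] := dP _ (Q' t t01).
have -> : f (q1, q2) - f (p1, p2) = (f (q1, q2) - f (p1, q2)) + (f (p1, q2) - f (p1, p2)).
  by rewrite addrA subrK.
rewrite es et.
exact: (linear_combination_bound _ _ bX bY).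
Qed.

Context {V : normedModType R}.

(** The inner functions are only differentiated along [v]; it is the outer one that needs a
    first-order expansion in all directions, which [increment_bound] supplies. *)
Lemma derive_comp2 (W : set (R * R)) (f : R * R -> R) (g1 g2 : V -> R) (x v : V) :
  open W -> smooth_on W f -> W (g1 x, g2 x) ->
  {for x, continuous g1} -> {for x, continuous g2} ->
  derivable g1 x v -> derivable g2 x v ->
  is_derive x v (fun y => f (g1 y, g2 y))
    ('D_eX f (g1 x, g2 x) * 'D_v g1 x + 'D_eY f (g1 x, g2 x) * 'D_v g2 x).
Proof.
move=> oW sf Wp c1 c2 d1 d2.
set A := 'D_eX f _; set B := 'D_eY f _.
pose q1 (h : R) := h^-1 *: ((g1 \o shift x) (h *: v) - g1 x).
pose q2 (h : R) := h^-1 *: ((g2 \o shift x) (h *: v) - g2 x).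
have l1 : q1 h @[h --> 0^'] --> 'D_v g1 x := d1.
have l2 : q2 h @[h --> 0^'] --> 'D_v g2 x := d2.
pose q (h : R) := h^-1 *: (((fun y => f (g1 y, g2 y)) \o shift x) (h *: v) - f (g1 x, g2 x)).
suff lq : q h @[h --> 0^'] --> A * 'D_v g1 x + B * 'D_v g2 x.
  by split; [apply/cvg_ex; exists (A * 'D_v g1 x + B * 'D_v g2 x)|apply: (cvg_lim _ lq)].
have lin : (A * q1 h + B * q2 h) @[h --> 0^'] --> A * 'D_v g1 x + B * 'D_v g2 x.
  exact: (cvgD (cvgM (cvg_cst A) l1) (cvgM (cvg_cst B) l2)).
suff dif : (q h - (A * q1 h + B * q2 h)) @[h --> 0^'] --> (0 : R).
  have -> : q = (fun h => (q h - (A * q1 h + B * q2 h)) + (A * q1 h + B * q2 h)).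
    by apply/funext => h; rewrite subrK.
  by rewrite -[X in _ --> X]add0r; exact: (cvgD dif lin).
have lM : (`|q1 h| + `|q2 h|) @[h --> 0^'] --> `|'D_v g1 x| + `|'D_v g2 x|.
  exact: (cvgD (cvg_norm l1) (cvg_norm l2)).
set M := `|'D_v g1 x| + `|'D_v g2 x| in lM.
have M1 : 0 < M + 1 by rewrite ltr_wpDl // addr_ge0.
(* Converging difference quotients are eventually bounded by their limit plus 1, and the error of
   the outer expansion is then taken with constant [e / (M + 1)]. *)
have nM : \forall h \near 0^', `|q1 h| + `|q2 h| <= M + 1.
  move/cvgrPdist_le : lM => /(_ 1 ltr01); apply: filterS => h.
  by rewrite distrC ler_distl => /andP[].
apply/cvgrPdist_le => e e0.
have eM : 0 < e / (M + 1) by rewrite divr_gt0.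
have := increment_bound oW sf Wp eM.
have cg : (g1 y, g2 y) @[y --> x] --> (g1 x, g2 x) by exact: (cvg_pair c1 c2).
have cx : (h *: v + x) @[h --> 0^'] --> x.
  rewrite -[X in _ --> X]add0r -[X in X + _](scale0r v).
  have h0 : (h : R) @[h --> 0^'] --> (0 : R) by move=> Q /nbhs_dnbhs.
  exact: (cvgD (cvgZr_tmp h0) (cvg_cst x)).
have cc : (g1 (h *: v + x), g2 (h *: v + x)) @[h --> 0^'] --> (g1 x, g2 x).
  by apply: cvg_comp cg.
move=> ib; have ib' := cc _ ib.
near=> h.
have h0 : h != 0 by near: h; exact: nbhs_dnbhs_neq.
have : `|f (g1 (h *: v + x), g2 (h *: v + x)) - f (g1 x, g2 x) -
   (A * (g1 (h *: v + x) - g1 x) + B * (g2 (h *: v + x) - g2 x))| <=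
    e / (M + 1) * (`|g1 (h *: v + x) - g1 x| + `|g2 (h *: v + x) - g2 x|).
  by near: h; exact: ib'.
have : `|q1 h| + `|q2 h| <= M + 1 by near: h.
rewrite /q /q1 /q2 /= /GRing.scale /= !normrM -mulrDr => m1 m2.
rewrite sub0r normrN.
set F := f _ - f _ in m2 *; set G1 := g1 _ - g1 x in m1 m2 *; set G2 := g2 _ - g2 x in m1 m2 *.
have -> : h^-1 * F - (A * (h^-1 * G1) + B * (h^-1 * G2)) = h^-1 * (F - (A * G1 + B * G2)) by ring.
rewrite normrM.
apply: (le_trans (ler_wpM2l (normr_ge0 _) m2)).
rewrite mulrCA.
apply: (le_trans (ler_wpM2l (ltW eM) m1)).
by rewrite divfK // gt_eqF.
Unshelve. all: by end_near.
Qed.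

End chain_rule.

Section smooth_closure.
Context {R : realType} {V : normedModType R}.
Implicit Types (U : set V) (f g : V -> R).

(* Closed under directional derivatives by the Leibniz and chain rules, so that
   [smooth_coind] gives all closure properties of smoothness at once. *)
Inductive smooth_expr U : (V -> R) -> Prop :=
| smooth_base f of smooth_on U f : smooth_expr U f
| smooth_add f g of smooth_expr U f & smooth_expr U g : smooth_expr U (fun x => f x + g x)
| smooth_mul f g of smooth_expr U f & smooth_expr U g : smooth_expr U (fun x => f x * g x)
| smooth_inv f of smooth_expr U f & (forall x, U x -> f x != 0) :
    smooth_expr U (fun x => (f x)^-1)
| smooth_comp (W : set (R * R)) (F : R * R -> R) f g of open W & smooth_on W F &
    smooth_expr U f & smooth_expr U g & (forall x, U x -> W (f x, g x)) :
    smooth_expr U (fun x => F (f x, g x)).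

Lemma smooth_expr_smooth U f : open U -> smooth_expr U f -> smooth_on U f.
Proof.
move=> oU.
have P1 : forall f, smooth_expr U f -> forall x, U x ->
     {for x, continuous f} /\ forall v, derivable f x v.
  move=> {}f; elim=> {f}.
  - move=> f sf x Ux; split; first exact: smooth_on_continuous sf Ux.
    by move=> v; exact: smooth_on_derivable sf Ux.
  - move=> f g _ IHf _ IHg x Ux; have [cf df] := IHf x Ux; have [cg dg] := IHg x Ux.
    by split; [exact: cvgD|move=> v; exact: derivableD].
  - move=> f g _ IHf _ IHg x Ux; have [cf df] := IHf x Ux; have [cg dg] := IHg x Ux.
    by split; [exact: cvgM|move=> v; exact: derivableM].
  - move=> f _ IHf f0 x Ux; have [cf df] := IHf x Ux.
    by split; [apply: cvgV => //; exact: f0|move=> v; apply: derivableV => //; exact: f0].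
  - move=> W F f g oW sF _ IHf _ IHg fgW x Ux.
    have [cf df] := IHf x Ux; have [cg dg] := IHg x Ux.
    split; last by move=> v; have [] := derive_comp2 oW sF (fgW x Ux) cf cg (df v) (dg v).
    have cF := smooth_on_continuous sF (fgW x Ux).
    have cfg : {for x, continuous (fun y => (f y, g y))} by exact: (cvg_pair cf cg).
    exact: (@continuous_comp V (R * R)%type R (fun y => (f y, g y)) F x cfg cF).
apply: (smooth_coind oU P1) => {}f v; elim=> {f}.
- move=> f sf; exists ('D_v f) => //; apply: smooth_base; exact: smooth_on_derive.
- move=> f g Ef [f' Ef' ef] Eg [g' Eg' eg]; exists (fun x => f' x + g' x).
    exact: smooth_add.
  move=> x xU; have Ux := set_mem xU; rewrite -ef // -eg //.
  by apply: deriveD; [exact: (P1 f Ef x Ux).2|exact: (P1 g Eg x Ux).2].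
- move=> f g Ef [f' Ef' ef] Eg [g' Eg' eg].
  exists (fun x => f x * g' x + g x * f' x).
    by apply: smooth_add; apply: smooth_mul.
  move=> x xU; have Ux := set_mem xU; rewrite -ef // -eg //.
  by apply: deriveM; [exact: (P1 f Ef x Ux).2|exact: (P1 g Eg x Ux).2].
- move=> f Ef [f' Ef' ef] f0.
  exists (fun x => (-1) * (((f x)^-1 * (f x)^-1) * f' x)).
    apply: smooth_mul; first exact/smooth_base/smooth_on_cst.
    by apply: smooth_mul => //; apply: smooth_mul; exact: smooth_inv.
  move=> x xU; have Ux := set_mem xU; rewrite -ef //.
  rewrite (deriveV (f0 x Ux)); last exact: (P1 f Ef x Ux).2.
  by rewrite /GRing.scale /= expr2 invfM mulN1r mulNr.
- move=> W F f g oW sF Ef [f' Ef' ef] Eg [g' Eg' eg] fgW.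
  exists (fun x => 'D_((1, 0) : R * R) F (f x, g x) * f' x
                 + 'D_((0, 1) : R * R) F (f x, g x) * g' x).
    have sD w : smooth_expr U (fun x => 'D_w F (f x, g x)).
      exact: (smooth_comp oW (smooth_on_derive w sF) Ef Eg fgW).
    exact: (smooth_add (smooth_mul (sD _) Ef') (smooth_mul (sD _) Eg')).
  move=> x xU; have Ux := set_mem xU; rewrite -ef // -eg //.
  have [cf df] := P1 f Ef x Ux; have [cg dg] := P1 g Eg x Ux.
  by have [] := derive_comp2 oW sF (fgW x Ux) cf cg (df v) (dg v).
Qed.

Lemma smooth_on_add U f g : open U -> smooth_on U f -> smooth_on U g ->
  smooth_on U (fun x => f x + g x).
Proof.
by move=> oU sf sg; apply: smooth_expr_smooth => //; apply: smooth_add; exact: smooth_base.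
Qed.

Lemma smooth_on_mul U f g : open U -> smooth_on U f -> smooth_on U g ->
  smooth_on U (fun x => f x * g x).
Proof.
by move=> oU sf sg; apply: smooth_expr_smooth => //; apply: smooth_mul; exact: smooth_base.
Qed.

Lemma smooth_on_opp U f : open U -> smooth_on U f -> smooth_on U (fun x => - f x).
Proof.
move=> oU sf; have := smooth_on_mul oU (@smooth_on_cst _ _ U (-1)) sf.
by congr (smooth_on U _); apply/funext => x /=; rewrite mulN1r.
Qed.

Lemma smooth_on_inv U f : open U -> smooth_on U f -> (forall x, U x -> f x != 0) ->
  smooth_on U (fun x => (f x)^-1).
Proof.
by move=> oU sf f0; apply: smooth_expr_smooth => //; apply: smooth_inv => //; exact: smooth_base.
Qed.

Lemma smooth_on_comp2 U (W : set (R * R)) (F : R * R -> R) f g :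
  open U -> open W -> smooth_on W F -> smooth_on U f -> smooth_on U g ->
  (forall x, U x -> W (f x, g x)) -> smooth_on U (fun x => F (f x, g x)).
Proof.
move=> oU oW sF sf sg fgW; apply: smooth_expr_smooth => //.
by apply: (smooth_comp oW sF) fgW; exact: smooth_base.
Qed.

(** Iterated derivatives of [F \o e] along [vs] are those of [F] along [map L vs], evaluated at
    [e x]. *)
Lemma smooth_on_affine {V' : normedModType R} (e L : V -> V') (W : set V') (F : V' -> R) U :
  (forall h u y, e (h *: u + y) = h *: L u + e y) -> continuous e ->
  smooth_on W F -> (forall x, U x -> W (e x)) -> smooth_on U (F \o e).
Proof.
move=> eL ce sF UW vs.
have -> : iterated_derive vs (F \o e) = iterated_derive (map L vs) F \o e.
  elim: vs => //= v vs ->; apply/funext => x.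
  by have [] := derive_affine (iterated_derive (map L vs) F) x v eL.
move=> x Ux; have [cF dF] := sF (map L vs) (e x) (UW x Ux).
split; first exact: (@continuous_comp V V' R e _ x (ce x) cF).
by move=> v; exact: (iffRL (derive_affine (iterated_derive (map L vs) F) x v eL).2 (dF _)).
Qed.

End smooth_closure.

Section complex_calculus.
Context {R : realType} {V : normedModType R}.
Implicit Types (U : set V) (x v : V).

Lemma smooth_deriveD U (f g : V -> R) x v : smooth_on U f -> smooth_on U g -> U x ->
  'D_v (fun y => f y + g y) x = 'D_v f x + 'D_v g x.
Proof.
move=> sf sg Ux.
by apply: deriveD; [exact: (@smooth_on_derivable _ _ U)|exact: (@smooth_on_derivable _ _ U)].
Qed.

Lemma smooth_deriveN U (f : V -> R) x v : smooth_on U f -> U x ->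
  'D_v (fun y => - f y) x = - 'D_v f x.
Proof. by move=> sf Ux; apply: deriveN; exact: (@smooth_on_derivable _ _ U). Qed.

Lemma smooth_deriveM U (f g : V -> R) x v : smooth_on U f -> smooth_on U g -> U x ->
  'D_v (fun y => f y * g y) x = f x * 'D_v g x + g x * 'D_v f x.
Proof.
move=> sf sg Ux.
by apply: deriveM; [exact: (@smooth_on_derivable _ _ U)|exact: (@smooth_on_derivable _ _ U)].
Qed.

Lemma csmooth_on_eq U (f g : V -> R[i]) : open U -> {in U, f =1 g} ->
  csmooth_on U g -> csmooth_on U f.
Proof.
move=> oU fg [sr si]; split.
  by apply: (smooth_on_eq oU) sr => x xU /=; rewrite fg.
by apply: (smooth_on_eq oU) si => x xU /=; rewrite fg.
Qed.

Lemma csmooth_on_cst U (c : R[i]) : csmooth_on U (fun=> c).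
Proof. by split; apply: smooth_on_cst. Qed.

Lemma csmooth_on_add U (f g : V -> R[i]) : open U -> csmooth_on U f -> csmooth_on U g ->
  csmooth_on U (fun x => f x + g x).
Proof.
move=> oU [fr fi] [gr gi]; split.
  have := smooth_on_add oU fr gr; congr (smooth_on U _); apply/funext => x /=.
  by case: (f x) => a b; case: (g x).
have := smooth_on_add oU fi gi; congr (smooth_on U _); apply/funext => x /=.
by case: (f x) => a b; case: (g x).
Qed.

Lemma csmooth_on_opp U (f : V -> R[i]) : open U -> csmooth_on U f ->
  csmooth_on U (fun x => - f x).
Proof.
move=> oU [fr fi]; split.
  have := smooth_on_opp oU fr; congr (smooth_on U _); apply/funext => x /=.
  by case: (f x).
have := smooth_on_opp oU fi; congr (smooth_on U _); apply/funext => x /=.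
by case: (f x).
Qed.

Lemma csmooth_on_mul U (f g : V -> R[i]) : open U -> csmooth_on U f -> csmooth_on U g ->
  csmooth_on U (fun x => f x * g x).
Proof.
move=> oU [fr fi] [gr gi]; split.
  have := smooth_on_add oU (smooth_on_mul oU fr gr) (smooth_on_opp oU (smooth_on_mul oU fi gi)).
  congr (smooth_on U _); apply/funext => x /=.
  by case: (f x) => a b; case: (g x).
have := smooth_on_add oU (smooth_on_mul oU fr gi) (smooth_on_mul oU fi gr).
congr (smooth_on U _); apply/funext => x /=.
by case: (f x) => a b; case: (g x).
Qed.

Lemma csmooth_on_conj U (f : V -> R[i]) : open U -> csmooth_on U f ->
  csmooth_on U (fun x => (f x)^*%C).
Proof.
move=> oU [fr fi]; split.
  by have := fr; congr (smooth_on U _); apply/funext => x /=; case: (f x).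
have := smooth_on_opp oU fi; congr (smooth_on U _); apply/funext => x /=.
by case: (f x).
Qed.

Lemma csmooth_on_real U (f : V -> R) : smooth_on U f -> csmooth_on U (fun x => (f x)%:C).
Proof. by move=> sf; split; [exact: sf|exact: smooth_on_cst]. Qed.

(** The inverse is the conjugate divided by the squared modulus [N], which reduces the claim to the
    inverse of a real function. *)
Lemma csmooth_on_inv U (f : V -> R[i]) : open U -> csmooth_on U f ->
  (forall x, U x -> f x != 0) -> csmooth_on U (fun x => (f x)^-1).
Proof.
move=> oU sf f0; have [fr fi] := sf.
pose N x := cRe (f x) * cRe (f x) + cIm (f x) * cIm (f x).
have N0 x : U x -> N x != 0.
  move=> /f0; rewrite /N; case: (f x) => a b /= ab.
  rewrite -!expr2 paddr_eq0 ?sqr_ge0 // !sqrf_eq0.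
  by apply: contra ab => /andP[/eqP -> /eqP ->].
have sN : smooth_on U (fun x => (N x)^-1).
  apply: (smooth_on_inv oU) N0.
  exact: (smooth_on_add oU (smooth_on_mul oU fr fr) (smooth_on_mul oU fi fi)).
apply: (csmooth_on_eq oU) (csmooth_on_mul oU (csmooth_on_real sN) (csmooth_on_conj oU sf)).
move=> x /set_mem Ux; apply: (mulfI (f0 x Ux)); rewrite divff ?f0 //.
have := N0 x Ux; rewrite /N; case: (f x) => a b /= Nx.
apply/eqP; rewrite eq_complex /= !mul0r subr0 addr0.
by apply/andP; split; apply/eqP; field.
Qed.

Lemma csmooth_on_sum U (I : Type) (r : seq I) (P : pred I) (f : I -> V -> R[i]) :
  open U -> (forall i, csmooth_on U (f i)) ->
  csmooth_on U (fun x => \sum_(i <- r | P i) f i x).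
Proof.
move=> oU sf; elim: r => [|i r IHr].
  have := csmooth_on_cst U 0; congr (csmooth_on U _); apply/funext => x.
  by rewrite big_nil.
case Pi : (P i); last first.
  by have := IHr; congr (csmooth_on U _); apply/funext => x; rewrite big_cons Pi.
have := csmooth_on_add oU (sf i) IHr; congr (csmooth_on U _); apply/funext => x.
by rewrite big_cons Pi.
Qed.

Lemma csmooth_on_prod U (I : Type) (r : seq I) (P : pred I) (f : I -> V -> R[i]) :
  open U -> (forall i, csmooth_on U (f i)) ->
  csmooth_on U (fun x => \prod_(i <- r | P i) f i x).
Proof.
move=> oU sf; elim: r => [|i r IHr].
  have := csmooth_on_cst U 1; congr (csmooth_on U _); apply/funext => x.
  by rewrite big_nil.
case Pi : (P i); last first.
  by have := IHr; congr (csmooth_on U _); apply/funext => x; rewrite big_cons Pi.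
have := csmooth_on_mul oU (sf i) IHr; congr (csmooth_on U _); apply/funext => x.
by rewrite big_cons Pi.
Qed.

(* A complex tangent vector [c1 * v1 + c2 * v2], stored as ((c1, v1), (c2, v2));
   it covers the real directions and both Wirtinger directions. *)
Definition cdirection : Type := (R[i] * V) * (R[i] * V).

Definition pd (d : cdirection) (f : V -> R[i]) (x : V) : R[i] :=
  d.1.1 * cderive d.1.2 f x + d.2.1 * cderive d.2.2 f x.

Definition conj_direction (d : cdirection) : cdirection :=
  ((d.1.1^*%C, d.1.2), (d.2.1^*%C, d.2.2)).

Definition real_direction (v : V) : cdirection := ((1, v), (0, v)).

Lemma pd_real v f x : pd (real_direction v) f x = cderive v f x.
Proof. by rewrite /pd /= mul1r mul0r addr0. Qed.

Lemma csmooth_on_cderive U f v : csmooth_on U f -> csmooth_on U (cderive v f).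
Proof. by move=> [fr fi]; split; apply: smooth_on_derive. Qed.

Lemma csmooth_on_pd U f d : open U -> csmooth_on U f -> csmooth_on U (pd d f).
Proof.
by move=> oU sf; apply: (csmooth_on_add oU); apply: (csmooth_on_mul oU);
  solve [exact: csmooth_on_cst | exact: csmooth_on_cderive].
Qed.

Lemma pd_eq_on U f g d : open U -> {in U, f =1 g} -> {in U, pd d f =1 pd d g}.
Proof.
move=> oU fg x xU; rewrite /pd /cderive.
have er : {in U, cRe \o f =1 cRe \o g} by move=> y yU /=; rewrite fg.
have ei : {in U, cIm \o f =1 cIm \o g} by move=> y yU /=; rewrite fg.
by rewrite !(derive_eq_on _ oU er xU) !(derive_eq_on _ oU ei xU).
Qed.

Lemma pd_cst (c : R[i]) d x : pd d (fun=> c) x = 0.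
Proof.
rewrite /pd /cderive.
have e v (r : R) : 'D_v (fun=> r) x = 0 by exact: derive_cst.
by rewrite !(e _ (cRe c)) !(e _ (cIm c)) !mulr0 addr0.
Qed.

Lemma cderiveD U f g v x : csmooth_on U f -> csmooth_on U g -> U x ->
  cderive v (fun y => f y + g y) x = cderive v f x + cderive v g x.
Proof.
move=> [fr fi] [gr gi] Ux; rewrite /cderive.
have -> : cRe \o (fun y => f y + g y) = (fun y => (cRe \o f) y + (cRe \o g) y).
  by apply/funext => y /=; case: (f y) => a b; case: (g y).
have -> : cIm \o (fun y => f y + g y) = (fun y => (cIm \o f) y + (cIm \o g) y).
  by apply/funext => y /=; case: (f y) => a b; case: (g y).
by rewrite (smooth_deriveD _ fr gr Ux) (smooth_deriveD _ fi gi Ux).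
Qed.

Lemma cderiveM U f g v x : csmooth_on U f -> csmooth_on U g -> U x ->
  cderive v (fun y => f y * g y) x = cderive v f x * g x + f x * cderive v g x.
Proof.
move=> [fr fi] [gr gi] Ux; rewrite /cderive.
have d h : smooth_on U h -> derivable h x v by move=> sh; exact: (smooth_on_derivable sh).
have -> : cRe \o (fun y => f y * g y) =
    (fun y => ((cRe \o f) y * (cRe \o g) y) - ((cIm \o f) y * (cIm \o g) y)).
  by apply/funext => y /=; case: (f y) => a b; case: (g y).
have -> : cIm \o (fun y => f y * g y) =
    (fun y => ((cRe \o f) y * (cIm \o g) y) + ((cIm \o f) y * (cRe \o g) y)).
  by apply/funext => y /=; case: (f y) => a b; case: (g y).
have dM h k : smooth_on U h -> smooth_on U k -> derivable (fun y => h y * k y) x v.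
  by move=> sh sk; apply: derivableM; exact: d.
have e1 : 'D_v (fun y => ((cRe \o f) y * (cRe \o g) y) - ((cIm \o f) y * (cIm \o g) y)) x =
    'D_v (fun y => (cRe \o f) y * (cRe \o g) y) x -
    'D_v (fun y => (cIm \o f) y * (cIm \o g) y) x.
  exact: (deriveB (dM _ _ fr gr) (dM _ _ fi gi)).
have e2 : 'D_v (fun y => ((cRe \o f) y * (cIm \o g) y) + ((cIm \o f) y * (cRe \o g) y)) x =
    'D_v (fun y => (cRe \o f) y * (cIm \o g) y) x +
    'D_v (fun y => (cIm \o f) y * (cRe \o g) y) x.
  exact: (deriveD (dM _ _ fr gi) (dM _ _ fi gr)).
rewrite e1 e2 (smooth_deriveM _ fr gr Ux) (smooth_deriveM _ fi gi Ux).
rewrite (smooth_deriveM _ fr gi Ux) (smooth_deriveM _ fi gr Ux) /=.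
case: (f x) => a b; case: (g x) => c e /=.
move: ('D_v _ x) ('D_v _ x) ('D_v _ x) ('D_v _ x) => p q r s.
by apply/eqP; rewrite eq_complex /=; apply/andP; split; apply/eqP; ring.
Qed.

Lemma pdD U f g d x : csmooth_on U f -> csmooth_on U g -> U x ->
  pd d (fun y => f y + g y) x = pd d f x + pd d g x.
Proof. by move=> sf sg Ux; rewrite /pd !(cderiveD _ sf sg Ux); ring. Qed.

Lemma pdM U f g d x : csmooth_on U f -> csmooth_on U g -> U x ->
  pd d (fun y => f y * g y) x = pd d f x * g x + f x * pd d g x.
Proof. by move=> sf sg Ux; rewrite /pd !(cderiveM _ sf sg Ux); ring. Qed.

Lemma pdZ U f (c : R[i]) d x : csmooth_on U f -> U x ->
  pd d (fun y => c * f y) x = c * pd d f x.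
Proof.
by move=> sf Ux; rewrite (pdM _ (csmooth_on_cst U c) sf Ux) pd_cst mul0r add0r.
Qed.

Lemma pdN U f d x : csmooth_on U f -> U x -> pd d (fun y => - f y) x = - pd d f x.
Proof.
move=> sf Ux; rewrite -mulN1r -(pdZ _ _ sf Ux).
by congr (pd d _ x); apply/funext => y; rewrite mulN1r.
Qed.

Lemma pd_sum U (I : Type) (r : seq I) (P : pred I) (f : I -> V -> R[i]) d x :
  open U -> (forall i, csmooth_on U (f i)) -> U x ->
  pd d (fun y => \sum_(i <- r | P i) f i y) x = \sum_(i <- r | P i) pd d (f i) x.
Proof.
move=> oU sf Ux; elim: r => [|i r IHr].
  rewrite big_nil -[RHS](pd_cst 0 d x); congr (pd d _ x); apply/funext => y.
  by rewrite big_nil.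
rewrite big_cons -IHr; case Pi : (P i); last first.
  by congr (pd d _ x); apply/funext => y; rewrite big_cons Pi.
rewrite -(pdD _ (sf i) (csmooth_on_sum r P oU sf) Ux).
by congr (pd d _ x); apply/funext => y; rewrite big_cons Pi.
Qed.

Lemma pd_conj U f d x : csmooth_on U f -> U x ->
  pd d (fun y => (f y)^*%C) x = (pd (conj_direction d) f x)^*%C.
Proof.
move=> [fr fi] Ux.
have e v : cderive v (fun y => (f y)^*%C) x = (cderive v f x)^*%C.
  rewrite /cderive /=.
  have -> : cRe \o (fun y => (f y)^*%C) = cRe \o f.
    by apply/funext => y /=; case: (f y).
  have -> : cIm \o (fun y => (f y)^*%C) = (fun y => - (cIm \o f) y).
    by apply/funext => y /=; case: (f y).
  by rewrite (smooth_deriveN _ fi Ux).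
rewrite /pd !e /= rmorphD /= !rmorphM /=.
by rewrite !conjcK.
Qed.

Lemma cderive_comm U f v w x : open U -> csmooth_on U f -> U x ->
  cderive v (cderive w f) x = cderive w (cderive v f) x.
Proof.
move=> oU [fr fi] Ux.
rewrite {1 3}/cderive.
have er u : cRe \o cderive u f = 'D_u (cRe \o f) by [].
have ei u : cIm \o cderive u f = 'D_u (cIm \o f) by [].
by rewrite !er !ei (smooth_on_schwarz v w oU fr Ux) (smooth_on_schwarz v w oU fi Ux).
Qed.

Lemma pd_comm U f d e x : open U -> csmooth_on U f -> U x ->
  pd d (pd e f) x = pd e (pd d f) x.
Proof.
move=> oU sf Ux.
have ex (d' e' : cdirection) : pd d' (pd e' f) x =
    d'.1.1 * (e'.1.1 * cderive d'.1.2 (cderive e'.1.2 f) x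
              + e'.2.1 * cderive d'.1.2 (cderive e'.2.2 f) x)
  + d'.2.1 * (e'.1.1 * cderive d'.2.2 (cderive e'.1.2 f) x
              + e'.2.1 * cderive d'.2.2 (cderive e'.2.2 f) x).
  have s w := csmooth_on_cderive w sf.
  have sc c := @csmooth_on_cst U c.
  have sm c w := csmooth_on_mul oU (sc c) (s w).
  rewrite {1}/pd.
  have ed w : cderive w (pd e' f) x = e'.1.1 * cderive w (cderive e'.1.2 f) x
              + e'.2.1 * cderive w (cderive e'.2.2 f) x.
    rewrite (cderiveD _ (sm _ _) (sm _ _) Ux) -!pd_real.
    by rewrite !(pdZ _ _ (s _) Ux).
  by rewrite (ed d'.1.2) (ed d'.2.2).
rewrite !ex.
have key (a b c k p q r s p' q' r' s' : R[i]) : p = p' -> q = q' -> r = r' -> s = s' ->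
    a * (b * p + c * q) + k * (b * r + c * s) = b * (a * p' + k * r') + c * (a * q' + k * s').
  by move=> -> -> -> ->; ring.
by apply: key; exact: (cderive_comm _ _ oU sf Ux).
Qed.

End complex_calculus.

Section complex_affine.
Context {R : realType} {V V' : normedModType R}.

Lemma csmooth_on_affine (e L : V -> V') (W : set V') (F : V' -> R[i]) (U : set V) :
  (forall h u y, e (h *: u + y) = h *: L u + e y) -> continuous e ->
  csmooth_on W F -> (forall x, U x -> W (e x)) -> csmooth_on U (F \o e).
Proof.
move=> eL ce [sr si] UW; split.
  exact: (smooth_on_affine eL ce sr UW).
exact: (smooth_on_affine eL ce si UW).
Qed.

Definition map_direction (L : V -> V') (d : cdirection (V := V)) : cdirection (V := V') :=
  ((d.1.1, L d.1.2), (d.2.1, L d.2.2)).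

Lemma pd_affine (e L : V -> V') (F : V' -> R[i]) d x :
  (forall h u y, e (h *: u + y) = h *: L u + e y) ->
  pd d (F \o e) x = pd (map_direction L d) F (e x).
Proof.
move=> eL; rewrite /pd /cderive /=.
have er v := (derive_affine (cRe \o F) x v eL).1.
have ei v := (derive_affine (cIm \o F) x v eL).1.
by rewrite -!er -!ei.
Qed.

End complex_affine.

#[local] Opaque pd.

Section matrix_calculus.
Context {R : realType} {V : normedModType R}.
Implicit Types (U : set V).

Definition mxpd {m k} (d : cdirection (V := V)) (F : V -> 'M[R[i]]_(m, k)) (x : V) :
    'M[R[i]]_(m, k) :=
  \matrix_(a, b) pd d (fun y => F y a b) x.

Section shapes.
Context {m k : nat}.
Implicit Types (F G : V -> 'M[R[i]]_(m, k)).

Lemma mxsmooth_on_eq U F G : open U -> {in U, F =1 G} -> mxsmooth_on U G -> mxsmooth_on U F.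
Proof. by move=> oU FG sG a b; apply: (csmooth_on_eq oU) (sG a b) => x xU; rewrite FG. Qed.

Lemma mxsmooth_on_cst U (A : 'M[R[i]]_(m, k)) : mxsmooth_on U (fun=> A).
Proof. by move=> a b; exact: csmooth_on_cst. Qed.

Lemma mxsmooth_on_add U F G : open U -> mxsmooth_on U F -> mxsmooth_on U G ->
  mxsmooth_on U (fun x => F x + G x).
Proof.
move=> oU sF sG a b; have := csmooth_on_add oU (sF a b) (sG a b).
by congr (csmooth_on U _); apply/funext => x; rewrite mxE.
Qed.

Lemma mxsmooth_on_opp U F : open U -> mxsmooth_on U F -> mxsmooth_on U (fun x => - F x).
Proof.
move=> oU sF a b; have := csmooth_on_opp oU (sF a b).
by congr (csmooth_on U _); apply/funext => x; rewrite mxE.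
Qed.

Lemma mxsmooth_on_scale U (c : V -> R[i]) F : open U -> csmooth_on U c -> mxsmooth_on U F ->
  mxsmooth_on U (fun x => c x *: F x).
Proof.
move=> oU sc sF a b; have := csmooth_on_mul oU sc (sF a b).
by congr (csmooth_on U _); apply/funext => x; rewrite mxE.
Qed.

Lemma mxsmooth_on_sum U (I : Type) (r : seq I) (P : pred I) (F : I -> V -> 'M[R[i]]_(m, k)) :
  open U -> (forall i, mxsmooth_on U (F i)) ->
  mxsmooth_on U (fun x => \sum_(i <- r | P i) F i x).
Proof.
move=> oU sF a b; have := csmooth_on_sum r P oU (fun i => sF i a b).
by congr (csmooth_on U _); apply/funext => x; rewrite summxE.
Qed.

Lemma mxsmooth_on_pd U d F : open U -> mxsmooth_on U F -> mxsmooth_on U (mxpd d F).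
Proof.
move=> oU sF a b; have := csmooth_on_pd d oU (sF a b).
by congr (csmooth_on U _); apply/funext => x; rewrite mxE.
Qed.

Lemma mxpd_eq_on U d F G : open U -> {in U, F =1 G} -> {in U, mxpd d F =1 mxpd d G}.
Proof.
move=> oU FG x xU; apply/matrixP => a b; rewrite !mxE.
by apply: (pd_eq_on _ oU) xU => y yU; rewrite FG.
Qed.

Lemma mxpd_cst d (A : 'M[R[i]]_(m, k)) x : mxpd d (fun=> A) x = 0.
Proof. by apply/matrixP => a b; rewrite !mxE pd_cst. Qed.

Lemma mxpdD U d F G x : mxsmooth_on U F -> mxsmooth_on U G -> U x ->
  mxpd d (fun y => F y + G y) x = mxpd d F x + mxpd d G x.
Proof.
move=> sF sG Ux; apply/matrixP => a b; rewrite !mxE -(pdD _ (sF a b) (sG a b) Ux).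
by congr (pd d _ x); apply/funext => y; rewrite mxE.
Qed.

Lemma mxpdN U d F x : mxsmooth_on U F -> U x ->
  mxpd d (fun y => - F y) x = - mxpd d F x.
Proof.
move=> sF Ux; apply/matrixP => a b; rewrite !mxE -(pdN _ (sF a b) Ux).
by congr (pd d _ x); apply/funext => y; rewrite mxE.
Qed.

Lemma mxpdB U d F G x : open U -> mxsmooth_on U F -> mxsmooth_on U G -> U x ->
  mxpd d (fun y => F y - G y) x = mxpd d F x - mxpd d G x.
Proof.
move=> oU sF sG Ux; rewrite (mxpdD _ sF (mxsmooth_on_opp oU sG) Ux).
by rewrite (mxpdN _ sG Ux).
Qed.

Lemma mxpdZ U d (c : V -> R[i]) F x : csmooth_on U c -> mxsmooth_on U F -> U x ->
  mxpd d (fun y => c y *: F y) x = pd d c x *: F x + c x *: mxpd d F x.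
Proof.
move=> sc sF Ux; apply/matrixP => a b; rewrite !mxE -(pdM _ sc (sF a b) Ux).
by congr (pd d _ x); apply/funext => y; rewrite mxE.
Qed.

Lemma mxpd_sum U d (I : Type) (r : seq I) (P : pred I) (F : I -> V -> 'M[R[i]]_(m, k)) x :
  open U -> (forall i, mxsmooth_on U (F i)) -> U x ->
  mxpd d (fun y => \sum_(i <- r | P i) F i y) x = \sum_(i <- r | P i) mxpd d (F i) x.
Proof.
move=> oU sF Ux; apply/matrixP => a b; rewrite !mxE summxE.
transitivity (\sum_(i <- r | P i) pd d (fun y => F i y a b) x); last first.
  by apply: eq_bigr => i _; rewrite mxE.
rewrite -(pd_sum r P d oU (fun i => sF i a b) Ux).
by congr (pd d _ x); apply/funext => y; rewrite summxE.
Qed.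

Lemma mxpd_comm U d e F x : open U -> mxsmooth_on U F -> U x ->
  mxpd d (mxpd e F) x = mxpd e (mxpd d F) x.
Proof.
move=> oU sF Ux; apply/matrixP => a b; rewrite !mxE.
have ex f : (fun y => mxpd f F y a b) = pd f (fun y => F y a b).
  by apply/funext => y; rewrite mxE.
by rewrite !ex; exact: (pd_comm _ _ oU (sF a b) Ux).
Qed.

Lemma mxsmooth_on_adj U F : open U -> mxsmooth_on U F -> mxsmooth_on U (fun x => mxadj (F x)).
Proof.
move=> oU sF a b; have := csmooth_on_conj oU (sF b a).
by congr (csmooth_on U _); apply/funext => x; rewrite !mxE.
Qed.

Lemma mxpd_adj U d F x : mxsmooth_on U F -> U x ->
  mxpd d (fun y => mxadj (F y)) x = mxadj (mxpd (conj_direction d) F x).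
Proof.
move=> sF Ux; apply/matrixP => a b; rewrite !mxE -(pd_conj _ (sF b a) Ux).
by congr (pd d _ x); apply/funext => y; rewrite !mxE.
Qed.

End shapes.

Lemma mxsmooth_on_mul U {m k l} (F : V -> 'M[R[i]]_(m, k)) (G : V -> 'M[R[i]]_(k, l)) :
  open U -> mxsmooth_on U F -> mxsmooth_on U G -> mxsmooth_on U (fun x => F x *m G x).
Proof.
move=> oU sF sG a b.
have := csmooth_on_sum (index_enum 'I_k) xpredT oU
  (fun j => csmooth_on_mul oU (sF a j) (sG j b)).
by congr (csmooth_on U _); apply/funext => x; rewrite mxE.
Qed.

Lemma mxpdM U {m k l} d (F : V -> 'M[R[i]]_(m, k)) (G : V -> 'M[R[i]]_(k, l)) x :
  open U -> mxsmooth_on U F -> mxsmooth_on U G -> U x ->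
  mxpd d (fun y => F y *m G y) x = mxpd d F x *m G x + F x *m mxpd d G x.
Proof.
move=> oU sF sG Ux; apply/matrixP => a b; rewrite !mxE -big_split /=.
transitivity (\sum_j pd d (fun y => F y a j * G y j b) x).
  rewrite -(pd_sum (index_enum 'I_k) xpredT d oU
    (fun j => csmooth_on_mul oU (sF a j) (sG j b)) Ux).
  by congr (pd d _ x); apply/funext => y; rewrite mxE.
by apply: eq_bigr => j _; rewrite (pdM _ (sF a j) (sG j b) Ux) !mxE.
Qed.

Section square.
Context {n : nat}.
Implicit Types (F G : V -> 'M[R[i]]_n).

Lemma csmooth_on_trace U F : open U -> mxsmooth_on U F -> csmooth_on U (fun x => \tr (F x)).
Proof. by move=> oU sF; apply: csmooth_on_sum => // i; exact: sF. Qed.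

Lemma pd_trace U d F x : open U -> mxsmooth_on U F -> U x ->
  pd d (fun y => \tr (F y)) x = \tr (mxpd d F x).
Proof.
move=> oU sF Ux; rewrite /mxtrace (pd_sum (index_enum 'I_n) xpredT d oU (fun i => sF i i) Ux).
by apply: eq_bigr => i _; rewrite mxE.
Qed.

Lemma mxsmooth_on_bracket U F G : open U -> mxsmooth_on U F -> mxsmooth_on U G ->
  mxsmooth_on U (fun x => mxbracket (F x) (G x)).
Proof.
move=> oU sF sG; apply: (mxsmooth_on_add oU (mxsmooth_on_mul oU sF sG)).
exact: (mxsmooth_on_opp oU (mxsmooth_on_mul oU sG sF)).
Qed.

Lemma mxpd_bracket U d F G x : open U -> mxsmooth_on U F -> mxsmooth_on U G -> U x ->
  mxpd d (fun y => mxbracket (F y) (G y)) x =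
  mxbracket (mxpd d F x) (G x) + mxbracket (F x) (mxpd d G x).
Proof.
move=> oU sF sG Ux.
rewrite (mxpdB _ oU (mxsmooth_on_mul oU sF sG) (mxsmooth_on_mul oU sG sF) Ux).
rewrite (mxpdM _ oU sF sG Ux) (mxpdM _ oU sG sF Ux) /mxbracket opprD.
by rewrite [X in _ + X = _]addrC addrACA.
Qed.

Lemma csmooth_on_det U F : open U -> mxsmooth_on U F -> csmooth_on U (fun x => \det (F x)).
Proof.
move=> oU sF; apply: (csmooth_on_sum _ _ oU) => s.
apply: (csmooth_on_mul oU); first exact: csmooth_on_cst.
by apply: (csmooth_on_prod _ _ oU) => i; exact: sF.
Qed.

End square.

(** Cramer's rule: on units the inverse is the adjugate over the determinant, and the entries of the
    adjugate are signed minors. *)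
Lemma mxsmooth_on_inv U {n} (F : V -> 'M[R[i]]_n) :
  open U -> mxsmooth_on U F -> (forall x, U x -> F x \in unitmx) ->
  mxsmooth_on U (fun x => invmx (F x)).
Proof.
move=> oU sF uF.
apply: (mxsmooth_on_eq (G := fun x => (\det (F x))^-1 *: \adj (F x)) oU).
  by move=> x /set_mem Ux; rewrite /invmx uF.
apply: (mxsmooth_on_scale oU).
  apply: (csmooth_on_inv oU); first exact: csmooth_on_det.
  by move=> x /uF; rewrite unitmxE unitfE.
move=> a b.
have := csmooth_on_mul oU (@csmooth_on_cst R V U ((-1) ^+ (b + a)))
  (@csmooth_on_det _ U (fun x => row' b (col' a (F x))) oU _).
suff sm : mxsmooth_on U (fun x => row' b (col' a (F x))).
  by move=> /(_ sm); congr (csmooth_on U _); apply/funext => x; rewrite !mxE.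
move=> c e; have := sF (lift b c) (lift a e).
by congr (csmooth_on U _); apply/funext => x; rewrite !mxE.
Qed.

End matrix_calculus.

Section matrix_affine.
Context {R : realType} {V V' : normedModType R} {m k : nat}.

Lemma mxsmooth_on_affine (e L : V -> V') (W : set V') (F : V' -> 'M[R[i]]_(m, k)) (U : set V) :
  (forall h u y, e (h *: u + y) = h *: L u + e y) -> continuous e ->
  mxsmooth_on W F -> (forall x, U x -> W (e x)) -> mxsmooth_on U (F \o e).
Proof.
by move=> eL ce sF UW a b; exact: (csmooth_on_affine eL ce (sF a b) UW).
Qed.

Lemma mxpd_affine (e L : V -> V') (F : V' -> 'M[R[i]]_(m, k)) d x :
  (forall h u y, e (h *: u + y) = h *: L u + e y) ->
  mxpd d (F \o e) x = mxpd (map_direction L d) F (e x).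
Proof.
move=> eL; apply/matrixP => a b; rewrite !mxE.
exact: (pd_affine (fun y => F y a b) d x eL).
Qed.

End matrix_affine.

(** * Charts and partitions of unity *)

#[local] Opaque mxpd.

(** * Flat functions and planar bumps *)

Section flat_function.
Context {R : realType}.

(** The functions p(1/x) exp(-1/x), extended by zero. Carrying all polynomials [p] makes the family
    stable under differentiation, as [smooth_coind] requires; [p = 1] is the usual cutoff. *)
Definition flat_poly (p : {poly R}) (x : R) : R :=
  if 0 < x then p.[x^-1] * expR (- x^-1) else 0.

(** With [N = size p], p(1/x) is at most a constant times x^-N, while the term of degree N + 2 of
    the exponential series gives exp(-1/x) <= (N + 2)! x^(N + 2). The two powers left over yield the
    derivative 0 at the origin. *)
Lemma flat_poly_bound (p : {poly R}) :
  exists2 C : R, 0 <= C & forall x, `|x| <= 1 -> `|flat_poly p x| <= C * `|x| ^+ 2.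
Proof.
pose N := size p.
pose C := (\sum_(i < N) `|p`_i|) * (N.+2)`!%:R.
have C0 : 0 <= C by apply: mulr_ge0 => //; apply: sumr_ge0.
exists C => // x x1; rewrite /flat_poly; case: ifPn => [x0|_]; last first.
  by rewrite normr0 mulr_ge0 // exprn_ge0.
rewrite (gtr0_norm x0) in x1 *.
have y1 : 1 <= x^-1 by rewrite invf_ge1.
have y0 : 0 <= x^-1 by rewrite invr_ge0 ltW.
have px : `|p.[x^-1]| <= (\sum_(i < N) `|p`_i|) * x^-1 ^+ N.
  rewrite horner_coef mulr_suml; apply: le_trans (ler_norm_sum _ _ _) _.
  apply: ler_sum => i _; rewrite normrM normrX (ger0_norm y0).
  by apply: ler_wpM2l => //; apply: ler_weXn2l => //; exact: ltnW.
have ex : expR (- x^-1) <= (N.+2)`!%:R * x ^+ N.+2.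
  rewrite expRN -[leRHS]invrK lef_pV2 ?posrE ?expR_gt0 //; last first.
    by rewrite invr_gt0 mulr_gt0 ?exprn_gt0 // ltr0n fact_gt0.
  rewrite invfM -exprVn mulrC.
  by apply: le_trans (expR_ge1Dxn N.+1 y0); rewrite lerDr.
rewrite normrM (ger0_norm (expR_ge0 _)).
apply: le_trans (ler_pM _ _ px ex) _; rewrite ?expR_ge0 //.
rewrite /C -[N.+2]addn2 exprD.
have -> : (\sum_(i < N) `|p`_i|) * x^-1 ^+ N * ((N + 2)`!%:R * (x ^+ N * x ^+ 2)) =
  (\sum_(i < N) `|p`_i|) * (N + 2)`!%:R * x ^+ 2 * (x^-1 ^+ N * x ^+ N) by ring.
by rewrite -exprMn mulVf ?gt_eqF // expr1n mulr1.
Qed.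

(** The variable X stands for 1/x, whose derivative is - X^2, and exp(-X) has derivative X^2
    exp(-X); this is the resulting polynomial factor. *)
Definition flat_deriv (p : {poly R}) : {poly R} := 'X^2 * (p - p^`()).

Lemma flat_poly_derive (p : {poly R}) (x : R) :
  is_derive x (1 : R) (flat_poly p) (flat_poly (flat_deriv p) x).
Proof.
have [x0|x0|<-] := ltgtP 0 x.
- have ne : \near x, (fun y : R => p.[y^-1] * expR (- y^-1)) x = flat_poly p x.
    have : \near x, 0 < x by exact: lt_nbhsr.
    by apply: filterS => y y0; rewrite /flat_poly y0.
  apply: (near_eq_is_derive ne).
  have xn0 : x != 0 by rewrite gt_eqF.
  have dV : is_derive x (1 : R) (fun y : R => y^-1) (- x ^- 2).
    split; first exact: derivableV.
    by rewrite (@deriveV _ _ id) // derive_id /GRing.scale /= mulr1.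
  have dp : is_derive x (1 : R) ((horner p) \o (fun y : R => y^-1)) (p^`().[x^-1] * - x ^- 2).
    exact: is_derive1_comp.
  have dN : is_derive x (1 : R) (fun y : R => - y^-1) (x ^- 2).
    by apply: (is_derive_eq (is_deriveN dV)); rewrite opprK.
  have dE : is_derive x (1 : R) (expR \o (fun y : R => - y^-1)) (expR (- x^-1) * x ^- 2).
    exact: is_derive1_comp.
  have dM := is_deriveM dp dE.
  apply: (is_derive_eq dM).
  rewrite /flat_poly x0 /flat_deriv !hornerE /GRing.scale /= exprVn.
  by ring.
- have ne : \near x, (cst 0 : R -> R) x = flat_poly p x.
    have : \near x, x < 0 by exact: lt_nbhsl.
    by apply: filterS => y y0; rewrite /flat_poly ltNge ltW.
  apply: (near_eq_is_derive ne).
  by rewrite /flat_poly ltNge ltW //=; exact: is_derive_cst.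
(* At the origin the quadratic bound makes the difference quotient at most C |h|. *)
- have -> : flat_poly (flat_deriv p) 0 = 0 by rewrite /flat_poly ltxx.
  have [C C0 bC] := flat_poly_bound p.
  suff l : h^-1 *: ((flat_poly p \o shift 0) (h *: (1 : R)) - flat_poly p 0) @[h --> 0^'] --> (0 : R).
    by split; [apply/cvg_ex; exists (0 : R)|exact: cvg_lim l].
  apply/cvgrPdist_le => e e0.
  have C1 : 0 < C + 1 by rewrite ltr_wpDl.
  have n1 := near0_norm_lt (divr_gt0 e0 C1).
  have n2 := near0_norm_lt (@ltr01 R).
  have n3 : \forall h \near (0 : R)^', h != 0 by exact: nbhs_dnbhs_neq.
  near=> h.
  have h0 : h != 0 by near: h.
  have h1 : `|h| < e / (C + 1) by near: h; exact: nbhs_dnbhs n1.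
  have h2 : `|h| < 1 by near: h; exact: nbhs_dnbhs n2.
  have -> : flat_poly p 0 = 0 by rewrite /flat_poly ltxx.
  rewrite /= subr0 addr0 /GRing.scale /= mulr1 sub0r normrN normrM normfV.
  have nh0 : 0 < `|h| by rewrite normr_gt0.
  rewrite mulrC ler_pdivrMr //; apply: le_trans (bC h (ltW h2)) _.
  rewrite expr2 mulrA; apply: ler_wpM2r => //.
  apply: (@le_trans _ _ ((C + 1) * `|h|)); first by apply: ler_wpM2r => //; rewrite lerDl.
  by rewrite mulrC -ler_pdivlMr // ltW.
Unshelve. all: by end_near.
Qed.

Lemma flat_poly_smooth (p : {poly R}) : smooth_on [set: R] (flat_poly p).
Proof.
apply: (@smooth_coind _ _ _ (fun f => exists p, f = flat_poly p)); last by exists p.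
- exact: openT.
- move=> f [{}p ->] x _; have [dx ex] := flat_poly_derive p x.
  split; first by apply/differentiable_continuous/derivable1_diffP.
  move=> v; have := is_derive_scale_direction v dx; rewrite [v *: (1 : R)]mulr1.
  by case.
- move=> f v [{}p ->]; exists (flat_poly (v *: flat_deriv p)); first by exists (v *: flat_deriv p).
  move=> x _; have [dx ex] := flat_poly_derive p x.
  have := is_derive_scale_direction v dx; rewrite [v *: (1 : R)]mulr1 => -[_ ->].
  rewrite ex /flat_poly; case: ifP => _; last by rewrite mulr0.
  by rewrite hornerZ mulrA.
Qed.

Definition bump (c : R * R) (r : R) (q : R * R) : R :=
  flat_poly 1 (r ^+ 2 - ((q.1 - c.1) ^+ 2 + (q.2 - c.2) ^+ 2)).

Lemma bump_ge0 c r q : 0 <= bump c r q.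
Proof.
by rewrite /bump /flat_poly; case: ifP => // _; rewrite hornerC mul1r expR_ge0.
Qed.

Lemma bump_gt0 c r : 0 < r -> 0 < bump c r c.
Proof.
move=> r0; rewrite /bump /flat_poly !subrr expr0n /= addr0 subr0 exprn_gt0 //.
by rewrite hornerC mul1r expR_gt0.
Qed.

Lemma bump_eq0 c r q : r ^+ 2 <= (q.1 - c.1) ^+ 2 + (q.2 - c.2) ^+ 2 -> bump c r q = 0.
Proof. by move=> h; rewrite /bump /flat_poly subr_gt0 ltNge h. Qed.

Lemma smooth_on_fst (U : set (R * R)) : smooth_on U (fun q : R * R => q.1).
Proof.
have id_smooth : smooth_on [set: R] (fun x : R => x).
  apply: (@smooth_coind _ _ _ (fun f => (exists c : R, f = cst c) \/ f = id)); last by right.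
  - exact: openT.
  - move=> f [[c ->]|->] x _; split.
    + exact: cst_continuous.
    + by move=> v; exact: derivable_cst.
    + by [].
    + by move=> v; exact: derivable_id.
  - move=> f v [[c ->]|->].
    + by exists (cst 0); [left; exists 0|move=> x _; rewrite derive_cst].
    + by exists (cst v); [left; exists v|move=> x _; rewrite derive_id].
apply: (@smooth_on_affine _ _ R (fun q : R * R => q.1) (fun q : R * R => q.1) setT id U) => //.
by move=> x; exact: cvg_fst.
Qed.

Lemma smooth_on_snd (U : set (R * R)) : smooth_on U (fun q : R * R => q.2).
Proof.
apply: (@smooth_on_affine _ _ (R * R)%type (fun q : R * R => (q.2, q.1))
  (fun q : R * R => (q.2, q.1)) setT (fun q : R * R => q.1) U) => //; last exact: smooth_on_fst.
move=> x.
have c2 : (fun q : R * R => q.2) y @[y --> x] --> x.2 by exact: cvg_snd.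
have c1 : (fun q : R * R => q.1) y @[y --> x] --> x.1 by exact: cvg_fst.
exact: (cvg_pair c2 c1).
Qed.

Lemma bump_smooth c r (U : set (R * R)) : smooth_on U (bump c r).
Proof.
apply: (smooth_on_subset (subsetT U)).
have o := @openT (R * R)%type.
have s1 := smooth_on_add o (@smooth_on_fst setT) (@smooth_on_cst _ _ setT (- c.1)).
have s2 := smooth_on_add o (@smooth_on_snd setT) (@smooth_on_cst _ _ setT (- c.2)).
have s3 := smooth_on_opp o (smooth_on_add o (smooth_on_mul o s1 s1) (smooth_on_mul o s2 s2)).
have s4 := smooth_on_add o (@smooth_on_cst _ _ setT (r ^+ 2)) s3.
have sF : smooth_on [set: R * R] (flat_poly 1 \o (fun q : R * R => q.1)).
  apply: (@smooth_on_affine _ _ R (fun q : R * R => q.1) (fun q : R * R => q.1) setT) => //.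
    by move=> x; exact: cvg_fst.
  exact: flat_poly_smooth.
have := smooth_on_comp2 o o sF s4 s4 (fun _ _ => I).
by congr (smooth_on _ _); apply/funext => q; rewrite /= /bump !expr2.
Qed.

End flat_function.

Section wirtinger_directions.
Context {R : realType}.

Definition dir_z : cdirection (V := (R * R)%type) :=
  ((2%:R^-1, (1, 0)), (- 'i%C / 2%:R, (0, 1))).

Definition dir_zbar : cdirection (V := (R * R)%type) :=
  ((2%:R^-1, (1, 0)), ('i%C / 2%:R, (0, 1))).

Lemma wirtinger_pd (f : R * R -> R[i]) p : wirtinger f p = pd dir_z f p.
Proof. by rewrite /wirtinger /dir_z; with_strategy transparent [pd] rewrite /pd /=; ring. Qed.

Lemma wirtinger_bar_pd (f : R * R -> R[i]) p : wirtinger_bar f p = pd dir_zbar f p.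
Proof.
by rewrite /wirtinger_bar /dir_zbar; with_strategy transparent [pd] rewrite /pd /=; ring.
Qed.

Lemma conjc_half : ((2%:R^-1 : R[i])^*)%C = 2%:R^-1.
Proof. by rewrite fmorphV rmorph_nat. Qed.

Lemma conjc_half_i : (('i%C / 2%:R : R[i])^*)%C = - 'i%C / 2%:R.
Proof.
rewrite rmorphM; congr (_ * _); last exact: conjc_half.
by apply/eqP; rewrite eq_complex /= oppr0 !eqxx.
Qed.

Lemma conj_dir_zbar : conj_direction dir_zbar = dir_z.
Proof. by congr ((_, _), (_, _)); [exact: conjc_half|exact: conjc_half_i]. Qed.

Lemma complex_real_combination (x1 y1 x2 y2 a b : R) :
  (x1 * a + x2 * b) +i* (y1 * a + y2 * b) = (x1 +i* y1) * a%:C + (x2 +i* y2) * b%:C.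
Proof. by apply/eqP; rewrite eq_complex /= !mulr0 !subr0 !add0r !eqxx. Qed.

Lemma cderive_comp2 (W : set (R * R)) (F : R * R -> R[i]) (t1 t2 : R * R -> R)
    (O : set (R * R)) (p v : R * R) :
  open W -> csmooth_on W F -> W (t1 p, t2 p) -> smooth_on O t1 -> smooth_on O t2 -> O p ->
  cderive v (fun q => F (t1 q, t2 q)) p =
    cderive ((1, 0) : R * R) F (t1 p, t2 p) * ('D_v t1 p)%:C
    + cderive ((0, 1) : R * R) F (t1 p, t2 p) * ('D_v t2 p)%:C.
Proof.
move=> oW [sr si] Wp s1 s2 Op.
have c1 := @smooth_on_continuous _ _ _ _ _ s1 Op.
have c2 := @smooth_on_continuous _ _ _ _ _ s2 Op.
have d1 := @smooth_on_derivable _ _ _ _ _ v s1 Op.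
have d2 := @smooth_on_derivable _ _ _ _ _ v s2 Op.
have [_ er] := derive_comp2 oW sr Wp c1 c2 d1 d2.
have [_ ei] := derive_comp2 oW si Wp c1 c2 d1 d2.
rewrite /cderive /=.
have -> : cRe \o (fun q => F (t1 q, t2 q)) = (fun q => (cRe \o F) (t1 q, t2 q)) by [].
have -> : cIm \o (fun q => F (t1 q, t2 q)) = (fun q => (cIm \o F) (t1 q, t2 q)) by [].
apply: (etrans (congr2 (fun a b => a +i* b) er ei)).
exact: complex_real_combination.
Qed.

(** [FX] and [FY] are the partial derivatives of the outer function, [a] and [b] the x- and
    y-derivatives of a coordinate change. The hypothesis is its Cauchy-Riemann equation: it forces
    [b2 = a1] and [b1 = - a2], so that the real Jacobian is multiplication by the complex number
    [J]. *)
Lemma chain_rule_algebra (FX FY : R[i]) (a1 a2 b1 b2 : R) :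
  (a1 +i* a2 + 'i%C * (b1 +i* b2)) / 2%:R = 0 ->
  let J := (a1 +i* a2 - 'i%C * (b1 +i* b2)) / 2%:R in
  (FX * a1%:C + FY * a2%:C - 'i%C * (FX * b1%:C + FY * b2%:C)) / 2%:R =
    (FX - 'i%C * FY) / 2%:R * J /\
  (FX * a1%:C + FY * a2%:C + 'i%C * (FX * b1%:C + FY * b2%:C)) / 2%:R =
    (FX + 'i%C * FY) / 2%:R * J^*%C.
Proof.
move=> h.
have [-> ->] : b2 = a1 /\ b1 = - a2.
  move/eqP: h; rewrite mulf_eq0 invr_eq0 pnatr_eq0 orbF eq_complex /=.
  by move=> /andP[/eqP h1 /eqP h2]; split; lra.
move=> J; have -> : J = a1 +i* a2.
  rewrite /J; clear J.
  have -> : a1 +i* a2 - 'i%C * (- a2 +i* a1) = 2%:R * (a1 +i* a2).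
    apply/eqP; rewrite mulr_natl mulr2n eq_complex /=; apply/andP.
    by split; apply/eqP; ring.
  by rewrite mulrAC mulfV ?pnatr_eq0 // mul1r.
split; rewrite [RHS]mulrAC; congr (_ / _).
  case: FX => x y; case: FY => z w.
  by apply/eqP; rewrite eq_complex /=; apply/andP; split; apply/eqP; ring.
case: FX => x y; case: FY => z w.
by apply/eqP; rewrite eq_complex /=; apply/andP; split; apply/eqP; ring.
Qed.

End wirtinger_directions.

Section charts.
Context {R : realType} {S : surface R}.
Hypothesis hS : riemann_surface S.

Definition overlap (i j : atlas S) : set (R * R) :=
  chart S i @` (chart_dom S i `&` chart_dom S j).

Lemma chart_image_open i : open (chart_image (S := S) i).
Proof. by case: hS => _ h _ _ _; have [] := h i. Qed.

Lemma chart_dom_open i : open (chart_dom S i).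
Proof. by case: hS => _ h _ _ _; have [] := h i. Qed.

Lemma chartK i x : chart_dom S i x -> chart_inv S i (chart S i x) = x.
Proof. by case: hS => _ _ h _ _; exact: h. Qed.

Lemma chart_in_image i x : chart_dom S i x -> chart_image (S := S) i (chart S i x).
Proof. by move=> ix; exists x. Qed.

Lemma chart_inv_dom i p : chart_image (S := S) i p -> chart_dom S i (chart_inv S i p).
Proof. by move=> [x ix <-]; rewrite chartK. Qed.

Lemma chart_invK i p : chart_image (S := S) i p -> chart S i (chart_inv S i p) = p.
Proof. by move=> [x ix <-]; rewrite chartK. Qed.

Lemma chart_inv_continuous i p : chart_image (S := S) i p -> {for p, continuous (chart_inv S i)}.
Proof. by case: hS => _ _ _ h _; have [_] := h i; exact. Qed.

Lemma chart_continuous i x : chart_dom S i x -> {for x, continuous (chart S i)}.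
Proof. by case: hS => _ _ _ h _; have [h' _] := h i; exact: h'. Qed.

Lemma overlap_inv i j p : overlap i j p ->
  [/\ chart_dom S i (chart_inv S i p), chart_dom S j (chart_inv S i p) &
      chart S i (chart_inv S i p) = p].
Proof. by move=> [x [ix jx] <-]; rewrite chartK. Qed.

Lemma overlap_image i j : overlap i j `<=` chart_image (S := S) i.
Proof. by move=> _ [x [ix _] <-]; exists x. Qed.

Lemma overlap_open i j : open (overlap i j).
Proof.
rewrite openE => p Op; have [ix jx ep] := overlap_inv Op.
have n1 : \near p, chart_image (S := S) i p.
  by apply: open_nbhs_nbhs; split; [exact: chart_image_open|exact: overlap_image Op].
have n2 : \near p, chart_dom S j (chart_inv S i p).
  apply: (chart_inv_continuous (overlap_image Op)).
  by apply: open_nbhs_nbhs; split; [exact: chart_dom_open|].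
rewrite /interior; apply: filterS (filterI n1 n2) => q [q1 q2].
by exists (chart_inv S i q); [split; [exact: chart_inv_dom|]|exact: chart_invK].
Qed.

Definition transition i j (p : R * R) : R * R := chart S j (chart_inv S i p).

Lemma transition_smooth i j :
  smooth_on (overlap i j) (fun p => (transition i j p).1) /\
  smooth_on (overlap i j) (fun p => (transition i j p).2).
Proof. by case: hS => _ _ _ _ h; exact: (h i j).1. Qed.

Lemma csmooth_on_transition i j (F : R * R -> R[i]) (W : set (R * R)) (O : set (R * R)) :
  open O -> O `<=` overlap i j -> open W -> csmooth_on W F ->
  (forall p, O p -> W (transition i j p)) ->
  csmooth_on O (F \o transition i j).
Proof.
move=> oO OO oW [sr si] OW; have [t1 t2] := transition_smooth i j.
have s1 := smooth_on_subset OO t1; have s2 := smooth_on_subset OO t2.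
have e (G : R * R -> R) : G \o transition i j =
    (fun p => G ((transition i j p).1, (transition i j p).2)).
  by apply/funext => p /=; rewrite -surjective_pairing.
split.
  have := smooth_on_comp2 oO oW sr s1 s2.
  rewrite -(e (cRe \o F)); apply=> p /OW.
  by rewrite -surjective_pairing.
have := smooth_on_comp2 oO oW si s1 s2.
rewrite -(e (cIm \o F)); apply=> p /OW.
by rewrite -surjective_pairing.
Qed.

Lemma csmooth_on_overlap i j (f : S -> R[i]) :
  csmooth_on (chart_image (S := S) j) (f \o chart_inv S j) ->
  csmooth_on (overlap i j) (f \o chart_inv S i).
Proof.
move=> sf.
have W p : overlap i j p -> chart_image (S := S) j (transition i j p).
  by move=> /overlap_inv[_ jx _]; exact: chart_in_image.
have := csmooth_on_transition (@overlap_open i j) (@subset_refl _ _) (@chart_image_open j) sf W.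
apply: (csmooth_on_eq (@overlap_open i j)) => p /set_mem /overlap_inv[_ jx _].
by rewrite /= /transition chartK.
Qed.

Lemma mxsmooth_on_overlap i j {m k} (u : S -> 'M[R[i]]_(m, k)) :
  mxsmooth_on (chart_image (S := S) j) (u \o chart_inv S j) ->
  mxsmooth_on (overlap i j) (u \o chart_inv S i).
Proof. by move=> su a b; exact: (@csmooth_on_overlap i j (fun x => u x a b) (su a b)). Qed.

Lemma dz_change i j (f : S -> R[i]) x :
  csmooth_on (chart_image (S := S) j) (f \o chart_inv S j) ->
  chart_dom S i x -> chart_dom S j x ->
  dz i f x = dz j f x * jac i j x /\ dzbar i f x = dzbar j f x * (jac i j x)^*%C.
Proof.
move=> sf ix jx.
have Op : overlap i j (chart S i x) by exists x.
have [s1 s2] := transition_smooth i j.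
have et : transition i j (chart S i x) = chart S j x by rewrite /transition chartK.
have Wp : chart_image (S := S) j ((transition i j (chart S i x)).1, (transition i j (chart S i x)).2).
  by rewrite -surjective_pairing et; exact: chart_in_image.
have CR : dzbar i (to_complex \o chart S j) x = 0.
  by case: hS => _ _ _ _ h; have [_] := h i j; apply.
have loc : {in overlap i j, f \o chart_inv S i =1
    (fun q => (f \o chart_inv S j) ((transition i j q).1, (transition i j q).2))}.
  move=> p /set_mem /overlap_inv[_ jp _].
  by rewrite /= -surjective_pairing /transition chartK.
have der v := @cderive_comp2 R _ (f \o chart_inv S j) (fun p => (transition i j p).1)
  (fun p => (transition i j p).2) _ _ v (@chart_image_open j) sf Wp s1 s2 Op.
have e (w : R * R) : cderive w (f \o chart_inv S i) (chart S i x) =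
   cderive w (fun q => (f \o chart_inv S j) ((transition i j q).1, (transition i j q).2))
     (chart S i x).
  by have := pd_eq_on (real_direction w) (@overlap_open i j) loc (mem_set Op); rewrite !pd_real.
rewrite /jac /dz /dzbar /wirtinger /wirtinger_bar !e !der -!surjective_pairing et.
rewrite /dzbar /wirtinger_bar in CR.
exact: (chain_rule_algebra _ _ CR).
Qed.

Lemma mxdz_change i j {n} (u : S -> 'M[R[i]]_n) x :
  mxsmooth_on (chart_image (S := S) j) (u \o chart_inv S j) ->
  chart_dom S i x -> chart_dom S j x ->
  mxdz i u x = jac i j x *: mxdz j u x /\ mxdzbar i u x = (jac i j x)^*%C *: mxdzbar j u x.
Proof.
move=> su ix jx; split; apply/matrixP => a b; rewrite !mxE mulrC.
  by have [] := @dz_change i j (fun y => u y a b) x (su a b) ix jx.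
by have [] := @dz_change i j (fun y => u y a b) x (su a b) ix jx.
Qed.

Lemma mxdzE {n} i (u : S -> 'M[R[i]]_n) x :
  mxdz i u x = mxpd dir_z (u \o chart_inv S i) (chart S i x).
Proof.
by with_strategy transparent [mxpd] (apply/matrixP => a b; rewrite !mxE /dz wirtinger_pd).
Qed.

Lemma mxdzbarE {n} i (u : S -> 'M[R[i]]_n) x :
  mxdzbar i u x = mxpd dir_zbar (u \o chart_inv S i) (chart S i x).
Proof.
by with_strategy transparent [mxpd] (apply/matrixP => a b; rewrite !mxE /dzbar wirtinger_bar_pd).
Qed.

Lemma dzE i (f : S -> R[i]) x : dz i f x = pd dir_z (f \o chart_inv S i) (chart S i x).
Proof. exact: wirtinger_pd. Qed.

Lemma dzbarE i (f : S -> R[i]) x : dzbar i f x = pd dir_zbar (f \o chart_inv S i) (chart S i x).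
Proof. exact: wirtinger_bar_pd. Qed.

End charts.

Section partition.
Context {R : realType} {S : surface R}.
Hypothesis hS : riemann_surface S.

(** Closed squares stand in for discs: their compactness and measure come directly from segments. *)
Definition box (c : R * R) (r : R) : set (R * R) :=
  `[c.1 - r, c.1 + r]%classic `*` `[c.2 - r, c.2 + r]%classic.

Lemma box_compact c r : compact (box c r).
Proof. by apply: compact_setX; exact: segment_compact. Qed.

Lemma sqr_ge_of_outside (a c r : R) : 0 < r -> ~ `[c - r, c + r]%classic a -> r ^+ 2 <= (a - c) ^+ 2.
Proof.
move=> r0; rewrite /= in_itv /= => /negP; rewrite negb_and -!ltNge => h.
rewrite -(real_normK (num_real (a - c))); apply: lerXn2r; rewrite ?nnegrE ?(ltW r0) //.
case/orP: h => h; last by rewrite ler_normr; apply/orP; left; lra.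
by rewrite ler_normr; apply/orP; right; lra.
Qed.

Lemma bump_outside_box c r q : 0 < r -> ~ box c r q -> bump c r q = 0.
Proof.
move=> r0 h; apply: bump_eq0.
have [q1|q1] := pselect (`[c.1 - r, c.1 + r]%classic q.1); last first.
  by apply: le_trans (sqr_ge_of_outside r0 q1) _; rewrite lerDl sqr_ge0.
have [q2|q2] := pselect (`[c.2 - r, c.2 + r]%classic q.2); first by case: h.
by apply: le_trans (sqr_ge_of_outside r0 q2) _; rewrite lerDr sqr_ge0.
Qed.

Lemma exists_box (U : set (R * R)) (c : R * R) : open U -> U c ->
  exists2 r : R, 0 < r & box c r `<=` U.
Proof.
move=> oU Uc; have nU : nbhs c U by exact: open_nbhs_nbhs.
have [e /= e0 he] := (iffLR (nbhs_ballP c _)) nU.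
exists (e / 2); first exact: divr_gt0.
have ineq (a b : R) : `[a - e / 2, a + e / 2]%classic b -> ball a e b.
  rewrite /= in_itv /= => /andP[h1 h2]; rewrite /ball /= ltr_distlC.
  by apply/andP; split; lra.
by move=> q [q1 q2]; apply: he; split; exact: ineq.
Qed.

Definition surface_bump (i : atlas S) (c : R * R) (r : R) (y : S) : R :=
  if pselect (chart_dom S i y) then bump c r (chart S i y) else 0.

Definition bump_support (i : atlas S) (c : R * R) (r : R) : set S := chart_inv S i @` box c r.

Section one_bump.
Variables (i : atlas S) (c : R * R) (r : R).
Hypotheses (r0 : 0 < r) (boxU : box c r `<=` chart_image (S := S) i).

Lemma bump_support_compact : compact (bump_support i c r).
Proof.
apply: continuous_compact; last exact: box_compact.
apply: continuous_in_subspaceT => p /set_mem pb.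
exact: (chart_inv_continuous hS (boxU pb)).
Qed.

Lemma bump_support_dom : bump_support i c r `<=` chart_dom S i.
Proof. by move=> _ [p /boxU pi <-]; exact: chart_inv_dom. Qed.

Lemma surface_bump_outside y : ~ bump_support i c r y -> surface_bump i c r y = 0.
Proof.
move=> h; rewrite /surface_bump; case: pselect => // iy.
apply: bump_outside_box => // b; apply: h.
by exists (chart S i y) => //; rewrite chartK.
Qed.

(** Near a point of the chart [i] this is a planar bump composed with a coordinate change. Any other
    point lies off the support, which is compact, hence closed in the Hausdorff surface, so the
    function vanishes nearby. *)
Lemma surface_bump_smooth j :
  smooth_on (chart_image (S := S) j) (surface_bump i c r \o chart_inv S j).
Proof.
apply: smooth_on_local => p pj.
have [iy|niy] := pselect (chart_dom S i (chart_inv S j p)).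
  exists (overlap j i), (bump c r \o transition j i); split.
  - exact: overlap_open.
  - by exists (chart_inv S j p); [split => //; exact: chart_inv_dom|exact: chart_invK].
  - have [s1 s2] := transition_smooth hS j i.
    have := @smooth_on_comp2 R _ (overlap j i) setT (bump c r) (fun q => (transition j i q).1)
      (fun q => (transition j i q).2) (@overlap_open _ _ hS j i) (@openT _)
      (@bump_smooth R c r setT) s1 s2 (fun _ _ => I).
    by congr (smooth_on _ _); apply/funext => q /=; rewrite -surjective_pairing.
  - move=> q /set_mem /(overlap_inv hS)[_ iq _].
    by rewrite /= /surface_bump; case: pselect.
pose W := chart_image (S := S) j `&` chart_inv S j @^-1` (~` bump_support i c r).
exists W, (cst 0); split.
- rewrite openE => q [qj qK]; rewrite /interior.
  have n1 : \near q, chart_image (S := S) j q.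
    by apply: open_nbhs_nbhs; split => //; exact: chart_image_open.
  have n2 : \near q, (~` bump_support i c r) (chart_inv S j q).
    apply: (chart_inv_continuous hS qj); apply: open_nbhs_nbhs; split => //.
    apply: closed_openC; apply: compact_closed; last exact: bump_support_compact.
    by case: hS => -[].
  exact: filterI n1 n2.
- by split => // /bump_support_dom.
- exact: smooth_on_cst.
- by move=> q /set_mem[qj qK]; rewrite /= surface_bump_outside.
Qed.

Lemma surface_bump_ge0 y : 0 <= surface_bump i c r y.
Proof. by rewrite /surface_bump; case: pselect => [iy|niy] //=; exact: bump_ge0. Qed.

End one_bump.

Lemma partition_of_unity : compact [set: S] ->
  exists (s : seq S) (rho : S -> S -> R) (ii : S -> atlas S) (K : S -> set S),
    (forall k, [/\ compact (K k), K k `<=` chart_dom S (ii k),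
       forall y, ~ K k y -> rho k y = 0, forall y, 0 <= rho k y &
       forall j, smooth_on (chart_image (S := S) j) (rho k \o chart_inv S j)]) /\
    forall y, \sum_(k <- s) rho k y = 1.
Proof.
move=> cS.
have /choice[f hf] : forall x : S, exists ir : atlas S * R,
    [/\ chart_dom S ir.1 x, 0 < ir.2 & box (chart S ir.1 x) ir.2 `<=` chart_image (S := S) ir.1].
  move=> x; have [i ix] : exists i, chart_dom S i x by case: hS => -[_ h] _ _ _ _; exact: h.
  have [r r0 rU] := exists_box (@chart_image_open _ _ hS i) (chart_in_image ix).
  by exists (i, r).
pose b x := surface_bump (f x).1 (chart S (f x).1 x) (f x).2.
have b_cont x : continuous (b x).
  move=> y; have [j jy] : exists j, chart_dom S j y by case: hS => -[_ h] _ _ _ _; exact: h.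
  have [_ r0 rU] := hf x.
  have sb : smooth_on (chart_image (S := S) j) (b x \o chart_inv S j).
    exact: surface_bump_smooth.
  have cb := smooth_on_continuous sb (chart_in_image jy).
  have cc := @continuous_comp _ _ _ (chart S j) (b x \o chart_inv S j) y (chart_continuous hS jy) cb.
  have ne : \near y, ((b x \o chart_inv S j) \o chart S j) y = b x y.
    have : \near y, chart_dom S j y.
      by apply: open_nbhs_nbhs; split => //; exact: chart_dom_open.
    by apply: filterS => z jz; rewrite /= chartK.
  rewrite /continuous_at.
  have -> : b x y = ((b x \o chart_inv S j) \o chart S j) y by rewrite /= chartK.
  exact: cvg_trans (near_eq_cvg ne) cc.
(* A finite subcover is produced as a limit along finite lists: a set belongs to [F] when it
   contains all lists that include some fixed list. [compact_near_coveringP] then gives one list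
   that serves every point. *)
pose F : set_system (seq S) := filter_from setT (fun s0 : seq S => [set s : seq S | {subset s0 <= s}]).
have FF : Filter F.
  apply: filter_from_filter; first by exists [::].
  move=> s1 s2 _ _; exists (s1 ++ s2) => // s h; split=> k ks; apply: h;
  by rewrite mem_cat ks ?orbT.
have b_self x : 0 < b x x.
  have [ix r0 rU] := hf x.
  by rewrite /b /surface_bump; case: pselect => [ix'|//] /=; exact: bump_gt0.
have [s0 _ hs0] : F [set s : seq S | [set: S] `<=` [set y | exists2 k, k \in s & 0 < b k y]].
  have := (iffLR (compact_near_coveringP _)) cS (seq S) F
    (fun s y => exists2 k, k \in s & 0 < b k y) FF; apply=> x _.
  exists ([set y | 0 < b x y], [set s : seq S | x \in s]) => /=.
    split; last by exists [:: x] => // s h; apply: h; rewrite inE.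
    apply: open_nbhs_nbhs; split; last exact: b_self.
    have -> : [set y | 0 < b x y] = b x @^-1` [set t | 0 < t] by [].
    by apply: open_comp; [move=> y _; exact: b_cont|exact: open_gt].
  by move=> [y s] [/= bxy xs]; exists x.
have cov y : exists2 k, k \in s0 & 0 < b k y by exact: (hs0 s0 (fun _ => id) y I).
pose s : seq S := s0.
pose T y := \sum_(k <- s) b k y.
have b0 k y : 0 <= b k y by exact: surface_bump_ge0.
have T0 y : 0 < T y.
  have [k kD bk] := cov y.
  apply: lt_le_trans bk _; rewrite /T (big_rem k) //= lerDl.
  by apply: sumr_ge0 => *; exact: b0.
(* Dividing by the positive sum [T] normalises the bumps and keeps their supports. *)
exists s, (fun k y => b k y / T y), (fun k => (f k).1),
  (fun k => bump_support (f k).1 (chart S (f k).1 k) (f k).2).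
split=> [k|y]; last by rewrite -mulr_suml -/(T y) divff // lt0r_neq0.
have [ix r0 rU] := hf k; split.
- exact: bump_support_compact.
- exact: bump_support_dom.
- by move=> y ny; rewrite /b surface_bump_outside // mul0r.
- by move=> y; rewrite divr_ge0 // ltW.
- move=> j; have oU := @chart_image_open _ _ hS j.
  have sb x : smooth_on (chart_image (S := S) j) (b x \o chart_inv S j).
    by have [_ rx xU] := hf x; exact: surface_bump_smooth.
  have sT : smooth_on (chart_image (S := S) j) (T \o chart_inv S j).
    suff sums s' : smooth_on (chart_image (S := S) j)
        (fun p => \sum_(k <- s') (b k \o chart_inv S j) p) by exact: (sums s).
    elim: s' => [|x s' IH].
      have -> : (fun p => \sum_(k0 <- [::]) (b k0 \o chart_inv S j) p) = cst 0.
        by apply/funext => p; rewrite big_nil.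
      exact: smooth_on_cst.
    have -> : (fun p => \sum_(k0 <- x :: s') (b k0 \o chart_inv S j) p) =
        (fun p => (b x \o chart_inv S j) p + \sum_(k0 <- s') (b k0 \o chart_inv S j) p).
      by apply/funext => p; rewrite big_cons.
    exact: (smooth_on_add oU (sb x) IH).
  apply: (smooth_on_mul oU (sb k)); apply: (smooth_on_inv oU sT).
  by move=> p _; exact: (lt0r_neq0 (T0 _)).
Qed.

End partition.

(** * Integration in the plane *)

Section plane_measurability.
Context {R : realType}.

(** Every open set is a countable union of rectangles with rational corners, and these belong to the
    product sigma-algebra. *)
Lemma open_plane_measurable (U : set (measurableTypeR R * measurableTypeR R)) :
  open (U : set (R * R)) -> measurable U.
Proof.
move=> oU.
pose I := (rat * rat * (rat * rat))%type.
pose B (k : I) : set (measurableTypeR R * measurableTypeR R) :=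
  `]ratr k.1.1, ratr k.1.2[%classic `*` `]ratr k.2.1, ratr k.2.2[%classic.
have mB k : measurable (B k) by apply: measurableX; exact: measurable_itv.
have -> : U = \bigcup_(k in [set k | B k `<=` U]) B k.
  apply/seteqP; split=> [q Uq|q [k kU kq]]; last exact: kU.
  have nU : nbhs (q : R * R) U by exact: open_nbhs_nbhs.
  have [e /= e0 he] := (iffLR (nbhs_ballP (q : R * R) _)) nU.
  have rat_near (x : R) : exists ab : rat * rat,
      ratr ab.1 < x < ratr ab.2 /\ forall y : R, ratr ab.1 < y < ratr ab.2 -> ball x e y.
    have [a] := @rat_in_itvoo R (x - e) x (ltac:(lra)).
    have [b] := @rat_in_itvoo R x (x + e) (ltac:(lra)).
    rewrite !in_itv /= => /andP[b1 b2] /andP[a1 a2].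
    exists (a, b); split=> /=; first by rewrite a2.
    by move=> y /andP[y1 y2]; rewrite /ball /= ltr_distlC; apply/andP; split; lra.
  have [ab [ab1 ab2]] := rat_near q.1; have [cd [cd1 cd2]] := rat_near q.2.
  exists (ab, cd); last by split; rewrite /= in_itv.
  by move=> y [y1 y2]; rewrite /= !in_itv /= in y1 y2; apply: he; split; [exact: ab2|exact: cd2].
rewrite bigcup_mkcond; apply: (@countable_bigcupT_measurable _ _ I); first exact: countableP.
by move=> k; case: ifP.
Qed.

Lemma compact_plane_measurable (B : set (measurableTypeR R * measurableTypeR R)) :
  compact (B : set (R * R)) -> measurable B.
Proof.
move=> cB; rewrite -(setCK B); apply: measurableC; apply: open_plane_measurable.
apply: closed_openC; apply: compact_closed cB.
exact: norm_hausdorff.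
Qed.

Lemma continuous_plane_measurable (f : R * R -> R) : continuous f ->
  measurable_fun [set: measurableTypeR R * measurableTypeR R] f.
Proof.
move=> /continuousP cf; apply: (measurability _ (measurable_realfun.RGenOpens.measurableE R)).
move=> _ [_ [a [b ->] <-]]; rewrite setTI; apply: open_plane_measurable.
exact/cf/interval_open.
Qed.

End plane_measurability.

Section plane_integral.
Context {R : realType}.

Local Notation mu2 := ((@lebesgue_measure R) \x (@lebesgue_measure R))%E.
Local Notation eX := ((1, 0) : R * R).
Local Notation eY := ((0, 1) : R * R).

Definition planar_int (U : set (R * R)) (f : R * R -> R) : R :=
  \int[mu2]_(p in U) f p.

Lemma plane_intE U (f : R * R -> R[i]) :
  plane_int U f = planar_int U (cRe \o f) +i* planar_int U (cIm \o f).
Proof. by []. Qed.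

(** Nothing is asked outside [U], where a chart expression carries no meaning; what gets integrated
    is the extension [f \_ U] by zero. *)
Definition continuous_supported (U B : set (R * R)) (f : R * R -> R) : Prop :=
  (forall p, U p -> {for p, continuous f}) /\ forall p, U p -> ~ B p -> f p = 0.

Lemma compact_in_square (B : set (R * R)) : compact B ->
  exists2 M : R, 0 < M & forall p, B p -> `|p.1| <= M /\ `|p.2| <= M.
Proof.
move=> cB.
have bd (pr : R * R -> R) : continuous pr -> exists2 M : R, 0 < M & forall p, B p -> `|pr p| <= M.
  move=> cpr; have : compact (pr @` B).
    by apply: continuous_compact cB; exact: continuous_subspaceT.
  move=> /compact_bounded[M [_ hM]].
  exists (`|M| + 1); first by rewrite ltr_wpDl.
  by move=> p Bp; apply: (hM (`|M| + 1)); [rewrite ltr_pwDr // ler_norm|exists p].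
have [M1 M10 h1] : exists2 M : R, 0 < M & forall p, B p -> `|p.1| <= M.
  by apply: (bd (fun p => p.1)) => p; exact: cvg_fst.
have [M2 M20 h2] : exists2 M : R, 0 < M & forall p, B p -> `|p.2| <= M.
  by apply: (bd (fun p => p.2)) => p; exact: cvg_snd.
exists (M1 + M2); first exact: addr_gt0.
move=> p Bp; split.
  by apply: le_trans (h1 p Bp) _; rewrite lerDl ltW.
by apply: le_trans (h2 p Bp) _; rewrite lerDr ltW.
Qed.

Lemma compact_bound {T : topologicalType} (B : set T) (f : T -> R) : compact B ->
  (forall p, B p -> {for p, continuous f}) ->
  exists2 C : R, 0 <= C & forall p, B p -> `|f p| <= C.
Proof.
move=> cB cf; have : compact (f @` B).
  by apply: continuous_compact cB; apply: continuous_in_subspaceT => p /set_mem /cf.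
move=> /compact_bounded[M [_ hM]].
exists (`|M| + 1); first by rewrite addr_ge0.
by move=> p Bp; apply: (hM (`|M| + 1)); [rewrite ltr_pwDr // ler_norm|exists p].
Qed.

Section supported.
Variables (U B : set (R * R)).
Hypotheses (oU : open U) (cB : compact B) (BU : B `<=` U).

Lemma near_outside p : ~ U p -> \near p, ~ B p.
Proof.
move=> nU; apply: (@open_nbhs_nbhs _ p (~` B)); split; last by move=> /BU.
by apply: closed_openC; apply: compact_closed cB; exact: norm_hausdorff.
Qed.

Lemma patch_outside f p : continuous_supported U B f -> ~ B p -> (f \_ U) p = 0.
Proof.
by move=> [_ h] nB; rewrite patchE; case: ifPn => // /set_mem Up; exact: h.
Qed.

(** A point outside [U] has a neighbourhood that misses the compact set [B], and the extension is
    zero there. *)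
Lemma patch_continuous f : continuous_supported U B f -> continuous (f \_ U).
Proof.
move=> cf p; have [Up|nUp] := pselect (U p).
  have ne : \near p, f p = (f \_ U) p.
    have : \near p, U p by exact: open_nbhs_nbhs.
    by apply: filterS => q Uq; rewrite patchE mem_set.
  rewrite /continuous_at patchE mem_set //.
  by apply: cvg_trans (near_eq_cvg ne) _; exact: (cf.1 p Up).
have ne : \near p, (cst 0 : R * R -> R) p = (f \_ U) p.
  by apply: filterS (near_outside nUp) => q nB; rewrite patch_outside.
rewrite /continuous_at [X in _ --> X]patchE memNset //.
by apply: cvg_trans (near_eq_cvg ne) _; exact: cvg_cst.
Qed.

Lemma supported_bound f : continuous_supported U B f ->
  exists2 C : R, 0 <= C & forall p, `|(f \_ U) p| <= C.
Proof.
move=> cf; have [C C0 hC] := compact_bound cB (fun p _ => @patch_continuous _ cf p).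
exists C => // p; have [Bp|nB] := pselect (B p); first exact: hC.
by rewrite patch_outside // normr0.
Qed.

Lemma compact_measure_finite : (mu2 B < +oo)%E.
Proof.
have [M M0 hM] := compact_in_square cB.
have mI : measurable (`[- M, M]%classic : set (measurableTypeR R)) by exact: measurable_itv.
apply: (@le_lt_trans _ _ (mu2 (`[- M, M]%classic `*` `[- M, M]%classic))).
  apply: le_measure; rewrite ?inE.
  - exact: compact_plane_measurable.
  - exact: measurableX.
  - by move=> p /hM[h1 h2]; split; rewrite /= in_itv /= -ler_norml.
rewrite product_measure1E //= lebesgue_measure_itv /= lte_fin.
by case: ifP => _; rewrite ?mule0 ?ltry // -EFinD -EFinM ltry.
Qed.

Lemma supported_integrable f : continuous_supported U B f ->
  mu2.-integrable setT (EFin \o (f \_ U)).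
Proof.
move=> cf; have [C C0 hC] := supported_bound cf.
have mB : measurable (B : set (measurableTypeR R * measurableTypeR R)).
  exact: compact_plane_measurable.
have mf := continuous_plane_measurable (patch_continuous cf).
have : mu2.-integrable B (EFin \o (f \_ U)).
  apply: measurable_bounded_integrable => //; first exact: compact_measure_finite.
    exact: measurable_funS mf.
  by exists C; split; [exact: num_real|move=> D CD p _; apply: le_trans (hC p) (ltW CD)].
move=> /(integrable_mkcond _ mB); apply: eq_integrable => //.
move=> p _; rewrite patchE; case: ifPn => // /negP nB.
by rewrite /= patch_outside // => Bp; apply: nB; exact: mem_set.
Qed.

Lemma planar_intE f : planar_int U f = \int[mu2]_p (f \_ U) p.
Proof. exact: Rintegral_mkcond. Qed.

Lemma planar_intD f g : continuous_supported U B f -> continuous_supported U B g ->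
  planar_int U (fun p => f p + g p) = planar_int U f + planar_int U g.
Proof.
move=> cf cg; rewrite !planar_intE -RintegralD //; [|exact: supported_integrable..].
by apply: eq_Rintegral => p _; rewrite /= !patchE; case: ifP => // _; rewrite addr0.
Qed.

Lemma planar_intZ f (c : R) : continuous_supported U B f ->
  planar_int U (fun p => c * f p) = c * planar_int U f.
Proof.
move=> cf; rewrite !planar_intE -RintegralZl //; last exact: supported_integrable.
by apply: eq_Rintegral => p _; rewrite /= !patchE; case: ifP => // _; rewrite mulr0.
Qed.

End supported.
End plane_integral.

Section planar_stokes.
Context {R : realType}.

Local Notation mu := (@lebesgue_measure R).
Local Notation mu2 := (mu \x mu)%E.
Local Notation eX := ((1, 0) : R * R).
Local Notation eY := ((0, 1) : R * R).

Lemma integral_derivative_compact (f df : R -> R) (M : R) : 0 < M ->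
  (forall x, is_derive x (1 : R) f (df x)) -> continuous df ->
  (forall x, M < `|x| -> f x = 0) -> (forall x, M < `|x| -> df x = 0) ->
  (\int[mu]_x (df x)%:E = 0)%E.
Proof.
move=> M0 fd cdf f0 df0.
(* Vanishing is known only for |x| > M, so the endpoints are taken strictly beyond M. *)
pose N := M + 1.
have N0 : 0 < N by rewrite addr_gt0.
have MN : M < N by rewrite ltrDl.
have -> : (\int[mu]_x (df x)%:E = \int[mu]_(x in `[(- N)%R, N]) (df x)%:E)%E.
  rewrite [RHS]integral_mkcond; apply: eq_integral => x _.
  rewrite patchE; case: ifPn => // /negP nx; rewrite df0 //.
  rewrite ltNge; apply/negP => xM; apply: nx; apply/mem_set; rewrite /= in_itv /= -ler_norml.
  by apply: le_trans xM _; exact: ltW.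
have cf : continuous f.
  by move=> x; apply/differentiable_continuous/derivable1_diffP; have [] := fd x.
rewrite (@continuous_FTC2 R df f (- N) N).
- by rewrite !f0 ?sube0 // ?normrN gtr0_norm.
- by rewrite gtrN.
- exact: continuous_subspaceT.
- split.
  + by move=> x _; have [] := fd x.
  + by apply: cvg_at_right_filter; exact: cf.
  + by apply: cvg_at_left_filter; exact: cf.
- by move=> x _; rewrite derive1E; have [] := fd x.
Qed.

Section supported.
Variables (U B : set (R * R)).
Hypotheses (oU : open U) (cB : compact B) (BU : B `<=` U).

Lemma smooth_supported (g : R * R -> R) : smooth_on U g -> (forall p, U p -> ~ B p -> g p = 0) ->
  continuous_supported U B g.
Proof. by move=> sg g0; split=> // p Up; exact: smooth_on_continuous sg Up. Qed.

Lemma derive_supported (g : R * R -> R) v : smooth_on U g ->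
  (forall p, U p -> ~ B p -> g p = 0) -> forall p, U p -> ~ B p -> 'D_v g p = 0.
Proof.
move=> sg g0 p Up nB.
have oW : open (U `&` ~` B).
  apply: openI => //; apply: closed_openC; apply: compact_closed cB; exact: norm_hausdorff.
have e : {in U `&` ~` B, g =1 cst 0} by move=> q /set_mem[Uq nBq]; rewrite g0.
by rewrite (derive_eq_on v oW e (mem_set (conj Up nB))) derive_cst.
Qed.

Lemma patch_derive (g : R * R -> R) v p : smooth_on U g ->
  (forall p, U p -> ~ B p -> g p = 0) ->
  is_derive p v (g \_ U) (('D_v g \_ U) p).
Proof.
move=> sg g0; have [Up|nUp] := pselect (U p).
  have ne : \near p, g p = (g \_ U) p.
    have : \near p, U p by exact: open_nbhs_nbhs.
    by apply: filterS => q Uq; rewrite patchE mem_set.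
  rewrite patchE mem_set //; apply: (near_eq_is_derive ne).
  by split => //; exact: smooth_on_derivable sg Up.
have ne : \near p, (cst 0 : R * R -> R) p = (g \_ U) p.
  apply: filterS (near_outside cB BU nUp) => q nB.
  by rewrite (patch_outside (smooth_supported sg g0)).
rewrite [X in is_derive _ _ _ X]patchE memNset //.
by apply: (near_eq_is_derive ne); exact: is_derive_cst.
Qed.

(** Fubini with the first coordinate innermost: each inner integral is that of the derivative of a
    compactly supported function, and one bound [M] on the support serves all horizontal lines. *)
Lemma planar_stokes_eX (g : R * R -> R) : smooth_on U g ->
  (forall p, U p -> ~ B p -> g p = 0) -> planar_int U ('D_eX g) = 0.
Proof.
move=> sg g0.
have cs : continuous_supported U B ('D_eX g).
  by apply: smooth_supported; [exact: smooth_on_derive|exact: derive_supported].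
have cg := smooth_supported sg g0.
rewrite planar_intE /Rintegral.
have int := supported_integrable oU cB BU cs.
have -> : (\int[mu2]_x ('D_eX g \_ U x)%:E = 0)%E; last by [].
rewrite -[LHS](integral21_prod_meas1 int).
apply: integral0_eq => y _.
have [M M0 hM] := compact_in_square cB.
have out f x : continuous_supported U B f -> M < `|x| -> (f \_ U) (x, y) = 0.
  move=> cf xM; apply: (patch_outside cf) => /hM[h _].
  by move: xM; rewrite ltNge h.
apply: (@integral_derivative_compact (fun x => (g \_ U) (x, y)) (fun x => ('D_eX g \_ U) (x, y)) M M0).
- move=> x; have [dx ex] := patch_derive eX (x, y) sg g0.
  have [e1 e2] := derive_line (g \_ U) (0, y) eX x.
  have el : (fun s : R => (g \_ U) (s *: eX + (0, y))) = (fun s => (g \_ U) (s, y)).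
    by apply/funext => s; rewrite shift_eX addr0.
  rewrite el shift_eX addr0 in e1 e2.
  by split; [exact/e2|rewrite e1].
- move=> x; apply: (@continuous_comp _ _ _ (fun x : R => (x, y)) ('D_eX g \_ U)).
    by apply: (@cvg_pair _ _ _ _ (nbhs x) (nbhs y)); [exact: cvg_id|exact: cvg_cst].
  exact: (patch_continuous oU cB BU cs).
- by move=> x; exact: out.
- by move=> x; exact: out.
Qed.

Lemma planar_stokes_eY (g : R * R -> R) : smooth_on U g ->
  (forall p, U p -> ~ B p -> g p = 0) -> planar_int U ('D_eY g) = 0.
Proof.
move=> sg g0.
have cs : continuous_supported U B ('D_eY g).
  by apply: smooth_supported; [exact: smooth_on_derive|exact: derive_supported].
have cg := smooth_supported sg g0.
rewrite planar_intE /Rintegral.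
have int := supported_integrable oU cB BU cs.
have -> : (\int[mu2]_x ('D_eY g \_ U x)%:E = 0)%E; last by [].
rewrite -[LHS](integral12_prod_meas1 int).
apply: integral0_eq => x _.
have [M M0 hM] := compact_in_square cB.
have out f y : continuous_supported U B f -> M < `|y| -> (f \_ U) (x, y) = 0.
  move=> cf xM; apply: (patch_outside cf) => /hM[_ h].
  by move: xM; rewrite ltNge h.
apply: (@integral_derivative_compact (fun y => (g \_ U) (x, y)) (fun y => ('D_eY g \_ U) (x, y)) M M0).
- move=> y; have [dx ex] := patch_derive eY (x, y) sg g0.
  have [e1 e2] := derive_line (g \_ U) (x, 0) eY y.
  have el : (fun s : R => (g \_ U) (s *: eY + (x, 0))) = (fun s => (g \_ U) (x, s)).
    by apply/funext => s; rewrite shift_eY addr0.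
  rewrite el shift_eY addr0 in e1 e2.
  by split; [exact/e2|rewrite e1].
- move=> y; apply: (@continuous_comp _ _ _ (fun y : R => (x, y)) ('D_eY g \_ U)).
    by apply: (@cvg_pair _ _ _ _ (nbhs x) (nbhs y)); [exact: cvg_cst|exact: cvg_id].
  exact: (patch_continuous oU cB BU cs).
- by move=> y; exact: out.
- by move=> y; exact: out.
Qed.

(** If [f p] were positive, the extension would exceed [F p / 2] on a whole box around [p]. The box
    has positive measure, so the integral would be positive. *)
Lemma planar_int_eq0 (f : R * R -> R) : continuous_supported U B f ->
  (forall p, U p -> 0 <= f p) -> planar_int U f = 0 -> forall p, U p -> f p = 0.
Proof.
move=> cf f0; rewrite planar_intE => i0 p Up.
apply/eqP; rewrite eq_le f0 // andbT leNgt; apply/negP => fp.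
pose F := f \_ U.
have cF := patch_continuous oU cB BU cf.
have Fp : F p = f p by rewrite /F patchE mem_set.
have F0 q : 0 <= F q by rewrite /F patchE; case: ifPn => // /set_mem; exact: f0.
have int := supported_integrable oU cB BU cf.
have mF := continuous_plane_measurable cF.
have oW : open [set q | F p / 2 < F q].
  have -> : [set q | F p / 2 < F q] = F @^-1` [set t | F p / 2 < t] by [].
  by apply: open_comp; [move=> q _; exact: cF|exact: open_gt].
have Wp : [set q | F p / 2 < F q] p by rewrite /= ltr_pdivrMr // ltr_pMr ?Fp // ltr1n.
have [r r0 rW] := exists_box oW Wp.
pose Q : set (measurableTypeR R * measurableTypeR R) := box p r.
have mQ : measurable Q by apply: measurableX; exact: measurable_itv.
have mu2Q : (mu2 Q = (r + r)%:E * (r + r)%:E)%E.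
  rewrite product_measure1E //=; try exact: measurable_itv.
  have len (c : R) : lebesgue_measure `[c - r, c + r]%classic = (r + r)%:E.
    rewrite lebesgue_measure_itv /= lte_fin (_ : c - r < c + r); last by lra.
    by rewrite -EFinD; congr (_%:E); ring.
  by rewrite !len.
have : ((F p / 2)%:E * mu2 Q <= \int[mu2]_q (F q)%:E)%E.
  apply: (@le_trans _ _ (\int[mu2]_(q in Q) (F q)%:E)%E).
    rewrite -integral_cst //; apply: ge0_le_integral => //.
    - by move=> q _; rewrite lee_fin divr_ge0.
    - by apply/measurable_EFinP; exact: measurable_funS mF.
    - by move=> q /rW /ltW; rewrite lee_fin.
  apply: ge0_subset_integral => //.
  - exact/measurable_EFinP.
  - by move=> q _; rewrite lee_fin.
have -> : (\int[mu2]_q (F q)%:E = 0)%E.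
  have fin := integrable_fin_num (@measurableT _ _) int.
  by rewrite -(fineK fin); congr (_%:E).
rewrite mu2Q -!EFinM lee_fin leNgt mulr_gt0 // ?divr_gt0 ?Fp // mulr_gt0 // addr_gt0 //.
Qed.

End supported.
End planar_stokes.

(** * Planar integrals depending on a parameter *)

Section parametric_integral.
Context {R : realType}.

Local Notation mu2 := ((@lebesgue_measure R) \x (@lebesgue_measure R))%E.
Local Notation eX := ((1, 0) : R * R).
Local Notation eY := ((0, 1) : R * R).
Local Notation eT := ((1, 0) : R * (R * R)).

Definition time_set (eps : R) : set R := [set t | `|t| < eps].

Lemma time_set_open eps : open (time_set eps).
Proof.
have -> : time_set eps = (fun t : R => `|t|) @^-1` [set s | s < eps] by [].
by apply: open_comp; [move=> t _; exact: norm_continuous|exact: open_lt].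
Qed.

Lemma openX {T T' : topologicalType} (A : set T) (A' : set T') :
  open A -> open A' -> open (A `*` A').
Proof.
move=> oA oA'; rewrite openE => -[x y] [/= Ax A'y]; exists (A, A') => //=.
by split; exact: open_nbhs_nbhs.
Qed.

Lemma slice_time (V : normedModType R) (p : V) :
  (forall h u y, (fun t : R => (t, p)) (h *: u + y) =
     h *: (fun t : R => (t, 0 : V)) u + (fun t : R => (t, p)) y) /\
  continuous (fun t : R => (t, p)).
Proof.
split=> [h u y|t].
  by apply: injective_projections => //=; rewrite scaler0 add0r.
by apply: (@cvg_pair _ _ _ _ (nbhs t) (nbhs p)); [exact: cvg_id|exact: cvg_cst].
Qed.

Lemma slice_space (V : normedModType R) (t : R) :
  (forall h u y, (fun p : V => (t, p)) (h *: u + y) =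
     h *: (fun p : V => (0 : R, p)) u + (fun p : V => (t, p)) y) /\
  continuous (fun p : V => (t, p)).
Proof.
split=> [h u y|p].
  by apply: injective_projections => //=; rewrite scaler0 add0r.
by apply: (@cvg_pair _ _ _ _ (nbhs t) (nbhs p)); [exact: cvg_cst|exact: cvg_id].
Qed.

(** Dominated differentiation: the t-derivative is bounded on a compact interval times [B] and
    vanishes off [B], so it is dominated by a multiple of the indicator of [B]. *)
Lemma planar_int_derive (U B : set (R * R)) (eps : R) (F : R * (R * R) -> R) (a : R) :
  open U -> compact B -> B `<=` U ->
  smooth_on (time_set eps `*` U) F ->
  (forall t p, time_set eps t -> U p -> ~ B p -> F (t, p) = 0) ->
  time_set eps a ->
  is_derive a (1 : R) (fun t => planar_int U (fun p => F (t, p)))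
    (planar_int U (fun p => 'D_eT F (a, p))).
Proof.
move=> oU cB BU sF F0 ha.
have oO : open (time_set eps `*` U) by apply: openX => //; exact: time_set_open.
(* Half the distance from [a] to the ends keeps the closed interval [a - d, a + d] inside the
   parameter set, which gives the compactness behind the bound [C]. *)
pose d := (eps - `|a|) / 2.
have d0 : 0 < d by rewrite divr_gt0 // subr_gt0.
have Iin x : x \in `[a - d, a + d] -> time_set eps x.
  rewrite in_itv /= -ler_distl => xa; rewrite /time_set /=.
  have := ler_distD 0 x a; rewrite ?subr0 => _.
  have -> : x = a + (x - a) by ring.
  apply: le_lt_trans (ler_normD _ _) _.
  apply: le_lt_trans (lerD (lexx `|a|) xa) _; rewrite /d.
  by rewrite /time_set /= in ha; lra.
have Iin' x : x \in `]a - d, a + d[ -> time_set eps x.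
  by rewrite in_itv /= => /andP[x1 x2]; apply: Iin; rewrite in_itv /= !ltW.
pose f (t : R) (p : R * R) := ((fun p => F (t, p)) \_ U) p.
have cs t : time_set eps t -> continuous_supported U B (fun p => F (t, p)).
  move=> ht; apply: smooth_supported => [|p]; last exact: F0.
  have [e1 e2] := slice_space (R * R)%type t.
  by apply: (smooth_on_affine e1 e2 sF) => p Up.
have dslice t p : time_set eps t -> U p ->
    is_derive t (1 : R) (fun t => F (t, p)) ('D_eT F (t, p)).
  move=> ht Up; have [e1 e2] := slice_time p.
  have [e3 e4] := derive_affine F t (1 : R) e1.
  split; last by rewrite -e3.
  by apply/e4; apply: (smooth_on_derivable sF).
have dout t p : ~ U p -> is_derive t (1 : R) (f^~ p) 0.
  move=> nU; have -> : f^~ p = cst 0.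
    by apply/funext => t'; rewrite /f patchE memNset.
  exact: is_derive_cst.
have df t p : time_set eps t -> derivable (f^~ p) t 1 /\
    'D_1 (f^~ p) t = ((fun p => 'D_eT F (t, p)) \_ U) p.
  move=> ht; have [Up|nU] := pselect (U p); last first.
    by have [h1 h2] := dout t p nU; split=> //; rewrite h2 patchE memNset.
  have -> : f^~ p = (fun t => F (t, p)).
    by apply/funext => t'; rewrite /f patchE mem_set.
  by have [h1 h2] := dslice t p ht Up; split=> //; rewrite h2 patchE mem_set.
have [C C0 hC] : exists2 C : R, 0 <= C & forall w, (`[a - d, a + d]%classic `*` B) w ->
    `|'D_eT F w| <= C.
  apply: compact_bound; first by apply: compact_setX => //; exact: segment_compact.
  move=> [t p] [/= ht Bp]; apply: smooth_on_continuous (smooth_on_derive eT sF) _.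
  by split=> /=; [exact: Iin|exact: BU].
pose G (p : R * R) : R := C * \1_B p.
have mB : measurable (B : set (measurableTypeR R * measurableTypeR R)).
  exact: compact_plane_measurable.
have G0 p : 0 <= G p by rewrite mulr_ge0.
have intG : mu2.-integrable setT (EFin \o G).
  have : mu2.-integrable B (EFin \o (fun=> C)).
    apply: measurable_bounded_integrable => //; first exact: compact_measure_finite.
    exists C; split; [exact: num_real|move=> D CD p _].
    by rewrite ger0_norm // ltW.
  move=> /(integrable_mkcond _ mB); apply: eq_integrable => //.
  move=> p _; rewrite /G /= patchE indicE; case: ifPn => pB; rewrite ?mulr1 ?mulr0 //.
have Gub x p : `]a - d, a + d[%classic x -> setT p -> `|partial1of2 f x p| <= G p.
  move=> xI _; have ht : time_set eps x by exact: Iin'.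
  rewrite partial1of2E (df x p ht).2 patchE /G indicE.
  case: ifPn => [/set_mem Up|_]; last by rewrite normr0 mulr_ge0.
  have [Bp|nB] := pselect (B p).
    rewrite mem_set // mulr1; apply: hC; split => //=.
    by move: xI; rewrite /= !in_itv /= => /andP[x1 x2]; rewrite !ltW.
  rewrite memNset // mulr0.
  (* Off [B] the function of t is identically zero near [x], hence so is its derivative. *)
  have [h1 h2] := dslice x p ht Up; rewrite -h2.
  suff -> : 'D_1 (fun t => F (t, p)) x = 'D_1 (cst 0 : R -> R) x.
    by rewrite derive_cst normr0.
  apply: near_eq_derive.
  have : \near x, time_set eps x by apply: open_nbhs_nbhs; split => //; exact: time_set_open.
  by apply: filterS => t tt /=; exact: F0.
have intf x : `]a - d, a + d[%classic x -> mu2.-integrable setT (EFin \o f x).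
  by move=> /Iin' /cs; exact: supported_integrable.
have derf1 x p : `]a - d, a + d[%classic x -> setT p -> derivable (f^~ p) x 1.
  by move=> /Iin' hx _; have [] := df x p hx.
have Ia : `]a - d, a + d[%classic a by rewrite /= in_itv /=; apply/andP; split; lra.
have D1 := derivable_under_integral (@measurableT _ _) Ia intf derf1 G0 intG Gub.
have D2 := differentiation_under_integral (@measurableT _ _) Ia intf derf1 G0 intG Gub.
have e : (fun t => planar_int U (fun p => F (t, p))) = (fun t => \int[mu2]_p f t p).
  by apply/funext => t; rewrite planar_intE.
rewrite e; split; first exact: D1.
rewrite -derive1E D2 planar_intE; apply: eq_Rintegral => p _.
by rewrite partial1of2E (df a p ha).2.
Qed.

Lemma planar_int_eq (U : set (R * R)) f g : {in U, f =1 g} -> planar_int U f = planar_int U g.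
Proof. by move=> fg; apply: eq_Rintegral. Qed.

Lemma plane_int_eq (U : set (R * R)) (f g : R * R -> R[i]) : {in U, f =1 g} ->
  plane_int U f = plane_int U g.
Proof.
move=> fg; rewrite !plane_intE.
by congr (_ +i* _); apply: planar_int_eq => p pU /=; rewrite fg.
Qed.

Definition ccontinuous_supported (U B : set (R * R)) (f : R * R -> R[i]) : Prop :=
  continuous_supported U B (cRe \o f) /\ continuous_supported U B (cIm \o f).

Section supported.
Variables (U B : set (R * R)).
Hypotheses (oU : open U) (cB : compact B) (BU : B `<=` U).

Lemma csmooth_supported (f : R * R -> R[i]) : csmooth_on U f ->
  (forall p, U p -> ~ B p -> f p = 0) -> ccontinuous_supported U B f.
Proof.
move=> [sr si] f0; split.
  exact: (smooth_supported sr (fun p Up nB => congr1 (@complex.Re R) (f0 p Up nB))).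
exact: (smooth_supported si (fun p Up nB => congr1 (@complex.Im R) (f0 p Up nB))).
Qed.

Lemma plane_intD (f g : R * R -> R[i]) :
  ccontinuous_supported U B f -> ccontinuous_supported U B g ->
  plane_int U (fun p => f p + g p) = plane_int U f + plane_int U g.
Proof.
move=> [fr fi] [gr gi]; rewrite !plane_intE.
have er := planar_intD oU cB BU fr gr; have ei := planar_intD oU cB BU fi gi.
have -> : planar_int U (cRe \o (fun p => f p + g p)) =
    planar_int U (fun p => (cRe \o f) p + (cRe \o g) p).
  by apply: planar_int_eq => p _ /=; case: (f p) => a b; case: (g p).
have -> : planar_int U (cIm \o (fun p => f p + g p)) =
    planar_int U (fun p => (cIm \o f) p + (cIm \o g) p).
  by apply: planar_int_eq => p _ /=; case: (f p) => a b; case: (g p).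
by rewrite er ei.
Qed.

Lemma plane_intZ (c : R[i]) (f : R * R -> R[i]) : ccontinuous_supported U B f ->
  plane_int U (fun p => c * f p) = c * plane_int U f.
Proof.
move=> [fr fi]; rewrite !plane_intE.
have csZ (k : R) h : continuous_supported U B h -> continuous_supported U B (fun p => k * h p).
  move=> [ch h0]; split=> [p Up|p Up nB]; last by rewrite h0 // mulr0.
  by apply: cvgM; [exact: cvg_cst|exact: ch].
have e (k1 k2 : R) h1 h2 : continuous_supported U B h1 -> continuous_supported U B h2 ->
    planar_int U (fun p => k1 * h1 p + k2 * h2 p) = k1 * planar_int U h1 + k2 * planar_int U h2.
  move=> s1 s2; rewrite -(planar_intZ oU cB BU k1 s1) -(planar_intZ oU cB BU k2 s2).
  exact: (planar_intD oU cB BU (csZ k1 _ s1) (csZ k2 _ s2)).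
have er := e (cRe c) (- cIm c) _ _ fr fi; have ei := e (cRe c) (cIm c) _ _ fi fr.
have -> : planar_int U (cRe \o (fun p => c * f p)) =
    planar_int U (fun p => cRe c * (cRe \o f) p + - cIm c * (cIm \o f) p).
  by apply: planar_int_eq => p _ /=; case: (c) => a b; case: (f p) => x y /=; rewrite mulNr.
have -> : planar_int U (cIm \o (fun p => c * f p)) =
    planar_int U (fun p => cRe c * (cIm \o f) p + cIm c * (cRe \o f) p).
  by apply: planar_int_eq => p _ /=; case: (c) => a b; case: (f p).
rewrite er ei; case: (c) => a b /=.
by apply/eqP; rewrite eq_complex /= mulNr !eqxx.
Qed.

Lemma cderive_supported (f : R * R -> R[i]) v : csmooth_on U f ->
  (forall p, U p -> ~ B p -> f p = 0) -> ccontinuous_supported U B (cderive v f).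
Proof.
move=> sf f0; have [sr si] := sf.
have fr0 p : U p -> ~ B p -> (cRe \o f) p = 0 by move=> Up nB; rewrite /= f0.
have fi0 p : U p -> ~ B p -> (cIm \o f) p = 0 by move=> Up nB; rewrite /= f0.
apply: csmooth_supported; first exact: csmooth_on_cderive.
move=> p Up nB; rewrite /cderive (derive_supported oU cB v sr fr0 Up nB).
by rewrite (derive_supported oU cB v si fi0 Up nB).
Qed.

(** Such a [d] is a combination of the two coordinate directions with constant coefficients, so the
    integral splits into two real cases; [dir_z] and [dir_zbar] are both of this shape. *)
Lemma plane_stokes (f : R * R -> R[i]) (d : cdirection (V := (R * R)%type)) :
  d.1.2 = eX -> d.2.2 = eY -> csmooth_on U f ->
  (forall p, U p -> ~ B p -> f p = 0) -> plane_int U (pd d f) = 0.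
Proof.
move=> dX dY sf f0; have [sr si] := sf.
have fr0 p : U p -> ~ B p -> (cRe \o f) p = 0 by move=> Up nB; rewrite /= f0.
have fi0 p : U p -> ~ B p -> (cIm \o f) p = 0 by move=> Up nB; rewrite /= f0.
have csZ (k : R[i]) v : ccontinuous_supported U B (fun p => k * cderive v f p).
  apply: csmooth_supported.
    by apply: (csmooth_on_mul oU); [exact: csmooth_on_cst|exact: csmooth_on_cderive].
  move=> p Up nB; rewrite /cderive (derive_supported oU cB v sr fr0 Up nB).
  by rewrite (derive_supported oU cB v si fi0 Up nB) mulr0.
have pX : plane_int U (cderive eX f) = 0.
  rewrite plane_intE.
  by rewrite (planar_stokes_eX oU cB BU sr fr0) (planar_stokes_eX oU cB BU si fi0).
have pY : plane_int U (cderive eY f) = 0.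
  rewrite plane_intE.
  by rewrite (planar_stokes_eY oU cB BU sr fr0) (planar_stokes_eY oU cB BU si fi0).
have -> : plane_int U (pd d f) =
    plane_int U (fun p => d.1.1 * cderive eX f p + d.2.1 * cderive eY f p).
  apply: plane_int_eq => p _; rewrite -dX -dY.
  by with_strategy transparent [pd] reflexivity.
rewrite (plane_intD (csZ _ _) (csZ _ _)).
apply: (etrans (congr2 +%R (plane_intZ d.1.1 (cderive_supported eX sf f0))
  (plane_intZ d.2.1 (cderive_supported eY sf f0)))).
by rewrite pX pY !mulr0 addr0.
Qed.

Lemma plane_int_derive (eps : R) (F : R * (R * R) -> R[i]) (a : R) :
  csmooth_on (time_set eps `*` U) F ->
  (forall t p, time_set eps t -> U p -> ~ B p -> F (t, p) = 0) ->
  time_set eps a ->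
  is_cderive (fun t => plane_int U (fun p => F (t, p))) a
    (plane_int U (fun p => cderive eT F (a, p))).
Proof.
move=> [sr si] F0 ha; split.
  apply: (planar_int_derive oU cB BU sr _ ha) => t p ht Up nB.
  by rewrite /= F0.
apply: (planar_int_derive oU cB BU si _ ha) => t p ht Up nB.
by rewrite /= F0.
Qed.

End supported.
End parametric_integral.

(** * Integration on the surface *)

Section is_cderive_rules.
Context {R : realType}.

Lemma is_cderive_eq_near (f g : R -> R[i]) t v : (\near t, f t = g t) ->
  is_cderive f t v -> is_cderive g t v.
Proof.
move=> fg [dr di]; split.
  by apply: near_eq_is_derive dr; apply: filterS fg => s /= ->.
by apply: near_eq_is_derive di; apply: filterS fg => s /= ->.
Qed.

Lemma is_cderive_cst (c : R[i]) t : is_cderive (fun=> c) t 0.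
Proof. by split; exact: is_derive_cst. Qed.

Lemma is_cderiveD (f g : R -> R[i]) t v w : is_cderive f t v -> is_cderive g t w ->
  is_cderive (fun s => f s + g s) t (v + w).
Proof.
move=> [fr fi] [gr gi]; split.
  have -> : cRe \o (fun s => f s + g s) = (cRe \o f) + (cRe \o g).
    apply/funext => s; rewrite -[RHS]/(cRe (f s) + cRe (g s)) /=.
    by case: (f s) => x y; case: (g s).
  have -> : cRe (v + w) = cRe v + cRe w by case: (v) => a b; case: (w).
  exact: is_deriveD.
have -> : cIm \o (fun s => f s + g s) = (cIm \o f) + (cIm \o g).
  apply/funext => s; rewrite -[RHS]/(cIm (f s) + cIm (g s)) /=.
  by case: (f s) => x y; case: (g s).
have -> : cIm (v + w) = cIm v + cIm w by case: (v) => a b; case: (w).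
exact: is_deriveD.
Qed.

Lemma is_cderiveZ (c : R[i]) (f : R -> R[i]) t v : is_cderive f t v ->
  is_cderive (fun s => c * f s) t (c * v).
Proof.
move=> [fr fi]; split.
  have -> : cRe \o (fun s => c * f s) = cRe c *: (cRe \o f) - cIm c *: (cIm \o f).
    apply/funext => s; rewrite -[RHS]/(cRe c * cRe (f s) - cIm c * cIm (f s)) /=.
    by case: (c) => a b; case: (f s).
  have -> : cRe (c * v) = cRe c *: cRe v - cIm c *: cIm v by case: (c) => a b; case: (v).
  by apply: is_deriveB; apply: is_deriveZ.
have -> : cIm \o (fun s => c * f s) = cRe c *: (cIm \o f) + cIm c *: (cRe \o f).
  apply/funext => s; rewrite -[RHS]/(cRe c * cIm (f s) + cIm c * cRe (f s)) /=.
  by case: (c) => a b; case: (f s).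
have -> : cIm (c * v) = cRe c *: cIm v + cIm c *: cRe v by case: (c) => a b; case: (v).
by apply: is_deriveD; apply: is_deriveZ.
Qed.

Lemma is_cderive_sum (T : Type) (s : seq T) (f : T -> R -> R[i]) t (v : T -> R[i]) :
  (forall k, is_cderive (f k) t (v k)) ->
  is_cderive (fun r => \sum_(k <- s) f k r) t (\sum_(k <- s) v k).
Proof.
move=> fv; elim: s => [|k s IH].
  rewrite big_nil; have -> : (fun r => \sum_(k <- [::]) f k r) = (fun=> 0).
    by apply/funext => r; rewrite big_nil.
  exact: is_cderive_cst.
rewrite big_cons.
have -> : (fun r => \sum_(j <- k :: s) f j r) = (fun r => f k r + \sum_(j <- s) f j r).
  by apply/funext => r; rewrite big_cons.
exact: is_cderiveD.
Qed.

End is_cderive_rules.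

Section surface_integral.
Context {R : realType} {S : surface R}.
Hypothesis hS : riemann_surface S.
Hypothesis cS : compact [set: S].

Local Notation oI i := (@chart_image_open _ _ hS i).

Lemma two_formD (w w' : atlas S -> S -> R[i]) : two_form w -> two_form w' ->
  two_form (fun i x => w i x + w' i x).
Proof.
move=> [sw tw] [sw' tw']; split=> [i|i j x ix jx].
  exact: (csmooth_on_add (oI i) (sw i) (sw' i)).
by rewrite (tw i j) // (tw' i j) // mulrDl.
Qed.

Lemma two_form_scale (rho : S -> R[i]) (w : atlas S -> S -> R[i]) :
  (forall i, csmooth_on (chart_image (S := S) i) (rho \o chart_inv S i)) ->
  two_form w -> two_form (fun i x => rho x * w i x).
Proof.
move=> sr [sw tw]; split=> [i|i j x ix jx].
  exact: (csmooth_on_mul (oI i) (sr i) (sw i)).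
by rewrite (tw i j) // mulrA.
Qed.

Lemma two_formZ (c : R[i]) (w : atlas S -> S -> R[i]) : two_form w ->
  two_form (fun i x => c * w i x).
Proof. by apply: two_form_scale => i; exact: csmooth_on_cst. Qed.

Lemma two_form0 : two_form (fun (_ : atlas S) (_ : S) => 0 : R[i]).
Proof. by split=> [i|i j x _ _]; [exact: csmooth_on_cst|rewrite mul0r]. Qed.

Lemma two_form_sum (T : Type) (s : seq T) (w : T -> atlas S -> S -> R[i]) :
  (forall k, two_form (w k)) -> two_form (fun i x => \sum_(k <- s) w k i x).
Proof.
move=> tw; elim: s => [|k s IH].
  have -> : (fun i x => \sum_(k <- [::]) w k i x) = (fun _ _ => 0).
    by apply/funext => i; apply/funext => x; rewrite big_nil.
  exact: two_form0.
have -> : (fun i x => \sum_(j <- k :: s) w j i x) =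
    (fun i x => w k i x + \sum_(j <- s) w j i x).
  by apply/funext => i; apply/funext => x; rewrite big_cons.
exact: two_formD.
Qed.

Variable I : (atlas S -> S -> R[i]) -> R[i].
Hypothesis hI : is_integration (S := S) I.

Lemma integration_eq w w' : (forall i x, chart_dom S i x -> w i x = w' i x) -> I w = I w'.
Proof. by case: hI => h _ _; exact: h. Qed.

Lemma integrationD w w' : two_form w -> two_form w' ->
  I (fun i x => w i x + w' i x) = I w + I w'.
Proof.
case: hI => _ h _ tw tw'; have := h 1 w w' tw tw'; rewrite mul1r => <-.
by apply: integration_eq => i x _; rewrite mul1r.
Qed.

Lemma integration0 : I (fun _ _ => 0) = 0.
Proof.
have := integrationD two_form0 two_form0.
have -> : I (fun _ _ => 0 + 0) = I (fun _ _ => 0) by apply: integration_eq => i x _; rewrite addr0.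
by move=> h; apply: (addrI (I (fun _ _ => 0))); rewrite addr0 -h.
Qed.

Lemma integration_sum (T : Type) (s : seq T) (w : T -> atlas S -> S -> R[i]) :
  (forall k, two_form (w k)) ->
  I (fun i x => \sum_(k <- s) w k i x) = \sum_(k <- s) I (w k).
Proof.
move=> tw; elim: s => [|k s IH].
  rewrite big_nil -[RHS]integration0; apply: integration_eq => i x _.
  by rewrite big_nil.
rewrite big_cons -IH -(integrationD (tw k) (two_form_sum s tw)).
by apply: integration_eq => i x _; rewrite big_cons.
Qed.

Record smooth_partition := SmoothPartition {
  part_index : seq S;
  part_fun : S -> S -> R;
  part_chart : S -> atlas S;
  part_supp : S -> set S;
  part_compact : forall k, compact (part_supp k);
  part_dom : forall k, part_supp k `<=` chart_dom S (part_chart k);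
  part_outside : forall k y, ~ part_supp k y -> part_fun k y = 0;
  part_ge0 : forall k y, 0 <= part_fun k y;
  part_smooth : forall k j, smooth_on (chart_image (S := S) j) (part_fun k \o chart_inv S j);
  part_sum : forall y, \sum_(k <- part_index) part_fun k y = 1 }.

Lemma exists_smooth_partition : exists _ : smooth_partition, True.
Proof.
have [s [rho [ii [K [h1 h2]]]]] := partition_of_unity hS cS.
by exists (@SmoothPartition s rho ii K (fun k => let: And5 a _ _ _ _ := h1 k in a)
  (fun k => let: And5 _ a _ _ _ := h1 k in a) (fun k => let: And5 _ _ a _ _ := h1 k in a)
  (fun k => let: And5 _ _ _ a _ := h1 k in a) (fun k => let: And5 _ _ _ _ a := h1 k in a) h2).
Qed.

Section with_partition.
Variable P : smooth_partition.

Local Notation U k := (chart_image (S := S) (part_chart P k)).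
Local Notation inv k := (chart_inv S (part_chart P k)).

Definition part_image (k : S) : set (R * R) := chart S (part_chart P k) @` part_supp P k.

Lemma part_image_compact k : compact (part_image k).
Proof.
apply: continuous_compact; last exact: part_compact.
apply: continuous_in_subspaceT => x /set_mem xK.
exact: (chart_continuous hS (part_dom xK)).
Qed.

Lemma part_image_sub k : part_image k `<=` U k.
Proof. by move=> _ [x /part_dom xd <-]; exists x. Qed.

Lemma part_image_outside k p : U k p -> ~ part_image k p -> part_fun P k (inv k p) = 0.
Proof.
move=> Up np; apply: part_outside => h; apply: np; exists (inv k p) => //.
exact: (chart_invK hS).
Qed.

Lemma csmooth_part k j :
  csmooth_on (chart_image (S := S) j) ((fun x => (part_fun P k x)%:C) \o chart_inv S j).
Proof. exact: (csmooth_on_real (@part_smooth P k j)). Qed.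

Definition localize (k : S) (w : atlas S -> S -> R[i]) : atlas S -> S -> R[i] :=
  fun i x => (part_fun P k x)%:C * w i x.

Lemma localize_two_form k w : two_form w -> two_form (localize k w).
Proof. by apply: two_form_scale => j; exact: csmooth_part. Qed.

Lemma csum_part x : \sum_(k <- part_index P) (part_fun P k x)%:C = 1 :> R[i].
Proof. by rewrite -(rmorph_sum (real_complex R)) /= part_sum. Qed.

Lemma integration_part w : two_form w -> I w = \sum_(k <- part_index P) I (localize k w).
Proof.
move=> tw; rewrite -(integration_sum _ (fun k => localize_two_form k tw)).
by apply: integration_eq => i x _; rewrite /localize -mulr_suml csum_part mul1r.
Qed.

Lemma integration_chart k w : two_form w ->
  (forall j x, chart_dom S j x -> ~ part_supp P k x -> w j x = 0) ->
  I w = (- 2%:R * 'i%C) * plane_int (U k) (w (part_chart P k) \o inv k).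
Proof.
case: hI => _ _ h tw w0.
by apply: (h _ (part_supp P k)) => //; [exact: part_compact|exact: part_dom].
Qed.

Lemma integration_localize k w : two_form w ->
  I (localize k w) = (- 2%:R * 'i%C) * plane_int (U k) (localize k w (part_chart P k) \o inv k).
Proof.
move=> tw; apply: integration_chart; first exact: localize_two_form.
by move=> j x _ nK; rewrite /localize part_outside // mul0r.
Qed.

End with_partition.

(** Localised to one chart, the integral is -2i times a planar integral of a nonnegative function.
    The sum over the charts vanishes, so each planar integral does; [planar_int_eq0] then kills the
    localised coefficients, which add up to [w]. *)
Lemma integration_eq0 w : two_form w -> (forall i x, chart_dom S i x -> 0 <= w i x) ->
  I w = 0 -> forall i x, chart_dom S i x -> w i x = 0.
Proof.
move=> tw w0 Iw; have [P _] := exists_smooth_partition.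
have [sw tr] := tw.
pose U k := chart_image (S := S) (part_chart P k).
pose f k := localize P k w (part_chart P k) \o chart_inv S (part_chart P k).
have fcs k : ccontinuous_supported (U k) (part_image P k) (f k).
  apply: csmooth_supported.
    exact: (csmooth_on_mul (oI _) (csmooth_part P k _) (sw _)).
  by move=> p Up np; rewrite /f /localize /= part_image_outside // mul0r.
have f0 k p : U k p -> 0 <= f k p.
  move=> Up; rewrite /f /localize /=; apply: mulr_ge0.
    by rewrite lecR; exact: part_ge0.
  by apply: w0; exact: chart_inv_dom.
(* In the order of [R[i]], being nonnegative includes being real. *)
have fr k p : U k p -> 0 <= cRe (f k p) /\ cIm (f k p) = 0.
  by move=> /f0; case: (f k p) => a b; rewrite lecE /= => /andP[/eqP -> ->].
have pi0 k : 0 <= planar_int (U k) (cRe \o f k).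
  by apply: Rintegral_ge0 => p Up; have [] := fr k p Up.
have pE k : plane_int (U k) (f k) = (planar_int (U k) (cRe \o f k))%:C.
  rewrite plane_intE; congr (_ +i* _).
  transitivity (planar_int (U k) (fun=> 0)).
    by apply: planar_int_eq => p /set_mem /fr[].
  by rewrite /planar_int /Rintegral integral0.
have sum0 : \sum_(k <- part_index P) planar_int (U k) (cRe \o f k) = 0.
  move: Iw; rewrite (integration_part P tw).
  under eq_bigr => k _ do rewrite (integration_localize P k tw) -/(f k) -/(U k) pE.
  rewrite -mulr_sumr -(rmorph_sum (real_complex R)) /= => /eqP.
  rewrite mulf_eq0 => /orP[|/eqP []//].
  by rewrite mulf_eq0 oppr_eq0 pnatr_eq0 /= eq_complex /= oner_eq0 andbF.
have each k : k \in part_index P -> planar_int (U k) (cRe \o f k) = 0.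
  move=> ks; apply/eqP; rewrite eq_le pi0 andbT -sum0 (big_rem k) //= lerDl.
  by apply: sumr_ge0 => j _; exact: pi0.
have fz k p : k \in part_index P -> U k p -> f k p = 0.
  move=> ks Up; have [_ im0] := fr k p Up.
  have re0 : cRe (f k p) = 0.
    apply: (planar_int_eq0 (oI _) (part_image_compact (P := P) (k := k)) (part_image_sub (k := k)) (fcs k).1 _ (each k ks) Up).
    by move=> q Uq; have [] := fr k q Uq.
  by move: re0 im0; case: (f k p) => a b /= -> ->.
move=> i x ix.
rewrite -[LHS]mul1r -(csum_part P x) mulr_suml big_seq big1 // => k ks.
have [xK|nK] := pselect (part_supp P k x); last by rewrite part_outside // mul0r.
have kx := part_dom xK.
have := fz k (chart S (part_chart P k) x) ks (chart_in_image kx).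
rewrite /f /localize /= (chartK hS kx) (tr i (part_chart P k) x ix kx) mulrA => ->.
by rewrite mul0r.
Qed.

Lemma dz_supp0 (P : smooth_partition) k j x : chart_dom S j x -> ~ part_supp P k x ->
  dz j (fun y => (part_fun P k y)%:C) x = 0 /\ dzbar j (fun y => (part_fun P k y)%:C) x = 0.
Proof.
move=> jx nK.
pose W := chart_image (S := S) j `&` chart_inv S j @^-1` (~` part_supp P k).
have oW : open W.
  rewrite openE => q [qj qK]; rewrite /interior.
  have n1 : \near q, chart_image (S := S) j q.
    by apply: open_nbhs_nbhs; split => //; exact: (oI j).
  have n2 : \near q, (~` part_supp P k) (chart_inv S j q).
    apply: (chart_inv_continuous hS qj); apply: open_nbhs_nbhs; split => //.
    apply: closed_openC; apply: compact_closed; last exact: part_compact.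
    by case: hS => -[].
  exact: filterI n1 n2.
have Wx : chart S j x \in W.
  by apply: mem_set; split; [exact: chart_in_image|rewrite /= (chartK hS jx)].
have e : {in W, (fun y => (part_fun P k y)%:C) \o chart_inv S j =1 (fun=> 0)}.
  by move=> q /set_mem[_ nq]; rewrite /= part_outside.
by rewrite dzE dzbarE !(pd_eq_on _ oW e Wx) !pd_cst.
Qed.

(** [t10] and [t01] are the coefficients of a one-form theta, and [w] is that of d theta. Each
    d(rho_k theta) is supported in one chart and integrates to zero by the planar case. These forms
    add up to d theta because the d rho_k add up to d 1 = 0. *)
Lemma surface_stokes (t10 t01 w : atlas S -> S -> R[i]) :
  (forall i, csmooth_on (chart_image (S := S) i) (t10 i \o chart_inv S i)) ->
  (forall i, csmooth_on (chart_image (S := S) i) (t01 i \o chart_inv S i)) ->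
  (forall i j x, chart_dom S i x -> chart_dom S j x -> t10 i x = jac i j x * t10 j x) ->
  (forall i j x, chart_dom S i x -> chart_dom S j x -> t01 i x = (jac i j x)^*%C * t01 j x) ->
  two_form w ->
  (forall i x, chart_dom S i x -> w i x = dz i (t01 i) x - dzbar i (t10 i) x) ->
  I w = 0.
Proof.
move=> s10 s01 tr10 tr01 tw hw; have [P _] := exists_smooth_partition.
have [sw tr] := tw.
pose rho k x : R[i] := (part_fun P k x)%:C.
have srho k j : csmooth_on (chart_image (S := S) j) (rho k \o chart_inv S j) by exact: csmooth_part.
(* Leibniz rule for d(rho_k theta). The derivatives of theta enter only through [w], whose
   transformation law is given. *)
pose wk k : atlas S -> S -> R[i] := fun i x =>
  rho k x * w i x + (dz i (rho k) x * t01 i x - dzbar i (rho k) x * t10 i x).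
have two_k k : two_form (wk k).
  apply: two_formD; first exact: localize_two_form.
  split=> [i|i j x ix jx].
    have s (d : cdirection) f : csmooth_on (chart_image (S := S) i) (f \o chart_inv S i) ->
        csmooth_on (chart_image (S := S) i) (fun p => pd d (rho k \o chart_inv S i) p * (f (chart_inv S i p))).
      by move=> sf; exact: (csmooth_on_mul (oI i) (csmooth_on_pd d (oI i) (srho k i)) sf).
    have := csmooth_on_add (oI i) (s dir_z _ (s01 i)) (csmooth_on_opp (oI i) (s dir_zbar _ (s10 i))).
    apply: (csmooth_on_eq (oI i)) => p /set_mem pI.
    by rewrite /= dzE dzbarE (chart_invK hS pI).
  have [-> ->] := dz_change hS (srho k j) ix jx.
  by rewrite (tr10 i j) // (tr01 i j) //; ring.
have Ik k : I (wk k) = 0.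
  pose i := part_chart P k.
  pose U := chart_image (S := S) i.
  rewrite (@integration_chart P k _ (two_k k)); last first.
    move=> j x jx nK; have [e1 e2] := dz_supp0 jx nK.
    by rewrite /wk e1 e2 /rho part_outside // !mul0r subr0 addr0.
  pose a p := rho k (chart_inv S i p) * t01 i (chart_inv S i p).
  pose b p := rho k (chart_inv S i p) * t10 i (chart_inv S i p).
  have sa : csmooth_on U a by exact: (csmooth_on_mul (oI i) (srho k i) (s01 i)).
  have sb : csmooth_on U b by exact: (csmooth_on_mul (oI i) (srho k i) (s10 i)).
  have a0 p : U p -> ~ part_image P k p -> a p = 0.
    by move=> Up np; rewrite /a /rho part_image_outside // mul0r.
  have b0 p : U p -> ~ part_image P k p -> b p = 0.
    by move=> Up np; rewrite /b /rho part_image_outside // mul0r.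
  have e : {in U, wk k i \o chart_inv S i =1 (fun p => pd dir_z a p + pd dir_zbar (fun q => - b q) p)}.
    move=> p /set_mem Up; have ix := chart_inv_dom hS Up.
    rewrite /= (pdN _ sb Up) (pdM _ (srho k i) (s01 i) Up) (pdM _ (srho k i) (s10 i) Up).
    by rewrite /wk hw // !dzE !dzbarE (chart_invK hS Up) /=; ring.
  rewrite -/U -/i (plane_int_eq e).
  have cB := part_image_compact (P := P) (k := k).
  have BU := part_image_sub (P := P) (k := k).
  have sb' := csmooth_on_opp (oI i) sb.
  have b0' p : U p -> ~ part_image P k p -> - b p = 0 by move=> Up np; rewrite b0 // oppr0.
  have cs d f : csmooth_on U f -> (forall p, U p -> ~ part_image P k p -> f p = 0) ->
      ccontinuous_supported U (part_image P k) (pd d f).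
    move=> sf f0; apply: csmooth_supported; first exact: (csmooth_on_pd _ (oI i)).
    move=> p Up np.
    have oW : open (U `&` ~` part_image P k).
      apply: openI; first exact: (oI i).
      by apply: closed_openC; apply: compact_closed cB; exact: norm_hausdorff.
    have e0 : {in U `&` ~` part_image P k, f =1 (fun=> 0)} by move=> q /set_mem[Uq nq]; exact: f0.
    by rewrite (pd_eq_on _ oW e0 (mem_set (conj Up np))) pd_cst.
  rewrite (plane_intD (oI i) cB BU (cs _ _ sa a0) (cs _ _ sb' b0')).
  rewrite (plane_stokes (oI i) cB BU (d := dir_z) erefl erefl sa a0).
  rewrite (plane_stokes (oI i) cB BU (d := dir_zbar) erefl erefl sb' b0').
  by rewrite addr0 mulr0.
have sum_d i x : chart_dom S i x -> \sum_(k <- part_index P) dz i (rho k) x = 0 /\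
    \sum_(k <- part_index P) dzbar i (rho k) x = 0.
  move=> ix.
  have h (d : cdirection) : \sum_(k <- part_index P) pd d (rho k \o chart_inv S i) (chart S i x) = 0.
    rewrite -(pd_sum _ xpredT d (oI i) (fun k => srho k i) (chart_in_image ix)).
    have -> : (fun p => \sum_(k <- part_index P) (rho k \o chart_inv S i) p) = (fun=> 1).
      by apply/funext => p; exact: csum_part.
    exact: pd_cst.
  split.
    by rewrite -[RHS](h dir_z); apply: eq_bigr => k _; exact: dzE.
  rewrite -[RHS](h dir_zbar); apply: eq_bigr => k _; apply: dzbarE.
have -> : I w = I (fun i x => \sum_(k <- part_index P) wk k i x).
  apply: integration_eq => i x ix; have [h1 h2] := sum_d i x ix.
  have e (f : S -> R[i]) c : \sum_(k <- part_index P) f k = 0 ->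
      \sum_(k <- part_index P) f k * c = 0.
    by move=> h; rewrite -mulr_suml h mul0r.
  rewrite big_split /= sumrB (e (fun k => dz i (rho k) x) _ h1).
  rewrite (e (fun k => dzbar i (rho k) x) _ h2) subr0 addr0.
  by rewrite -mulr_suml csum_part mul1r.
rewrite (integration_sum _ two_k) big1 // => k _.
Qed.

Definition tderive (f : R -> R[i]) (t : R) : R[i] := pd (real_direction (1 : R)) f t.

Definition joint_smooth (eps : R) (W : R -> atlas S -> S -> R[i]) : Prop :=
  forall i, csmooth_on (time_set eps `*` chart_image (S := S) i)
    (fun q : R * (R * R) => W q.1 i (chart_inv S i q.2)).

Lemma time_chart_open (eps : R) i : open (time_set eps `*` chart_image (S := S) i).
Proof. by apply: openX; [exact: time_set_open|exact: (oI i)]. Qed.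

Lemma tderive_joint (W : R -> atlas S -> S -> R[i]) i t p :
  tderive (fun t => W t i (chart_inv S i p)) t =
  cderive ((1, 0) : R * (R * R)) (fun q : R * (R * R) => W q.1 i (chart_inv S i q.2)) (t, p).
Proof.
have [e1 e2] := slice_time p; rewrite -pd_real.
exact: (pd_affine (fun q : R * (R * R) => W q.1 i (chart_inv S i q.2)) _ _ e1).
Qed.

Lemma joint_smooth_tderive eps W : joint_smooth eps W ->
  joint_smooth eps (fun t i x => tderive (fun s => W s i x) t).
Proof.
move=> sW i; have := csmooth_on_cderive ((1, 0) : R * (R * R)) (sW i).
congr (csmooth_on _ _); apply/funext => -[t p] /=.
by rewrite tderive_joint.
Qed.

Lemma joint_smooth_at eps W t i : joint_smooth eps W -> time_set eps t ->
  csmooth_on (chart_image (S := S) i) (W t i \o chart_inv S i).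
Proof.
move=> sW ht; have [e1 e2] := slice_space (R * R)%type t.
by apply: (csmooth_on_affine e1 e2 (sW i)) => p Up.
Qed.

Lemma tderive_two_form eps W t : joint_smooth eps W ->
  (forall t, time_set eps t -> two_form (W t)) -> time_set eps t ->
  two_form (fun i x => tderive (fun s => W s i x) t).
Proof.
move=> sW tW ht; split=> [i|i j x ix jx].
  exact: (joint_smooth_at i (joint_smooth_tderive sW) ht).
have oT := @time_set_open R eps.
have e : {in time_set eps, (fun s => W s i x) =1
    (fun s => (jac i j x * (jac i j x)^*%C) * W s j x)}.
  by move=> s /set_mem hs; have [_ h] := tW s hs; rewrite (h i j) // mulrC.
have sm : csmooth_on (time_set eps) (fun s => W s j x).
  have [e1 e2] := slice_time (chart S j x).
  have := csmooth_on_affine e1 e2 (sW j) (fun s (hs : time_set eps s) => conj hs (chart_in_image jx)).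
  by congr (csmooth_on _ _); apply/funext => s; rewrite /= (chartK hS jx).
rewrite /tderive (pd_eq_on _ oT e (mem_set ht)) (pdZ _ _ sm ht).
by rewrite mulrC.
Qed.

(** [I] comes with no continuity of its own. On each of the finitely many localised pieces it is a
    planar integral, where [plane_int_derive] applies. *)
Lemma integration_derive eps W a : joint_smooth eps W ->
  (forall t, time_set eps t -> two_form (W t)) -> time_set eps a ->
  is_cderive (fun t => I (W t)) a (I (fun i x => tderive (fun s => W s i x) a)).
Proof.
move=> sW tW ha; have [P _] := exists_smooth_partition.
pose U k := chart_image (S := S) (part_chart P k).
pose F k (q : R * (R * R)) :=
  localize P k (W q.1) (part_chart P k) (chart_inv S (part_chart P k) q.2).
have sF k : csmooth_on (time_set eps `*` U k) (F k).
  apply: (csmooth_on_mul (@time_chart_open _ _)) (sW _).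
  have e1 h (u y : R * (R * R)) : (h *: u + y).2 = h *: u.2 + y.2 by [].
  have e2 : continuous (fun q : R * (R * R) => q.2) by move=> q; exact: cvg_snd.
  by apply: (csmooth_on_affine e1 e2 (csmooth_part P k (part_chart P k))) => q [].
have F0 k t p : time_set eps t -> U k p -> ~ part_image P k p -> F k (t, p) = 0.
  by move=> _ Up np; rewrite /F /localize /= part_image_outside // mul0r.
have dk k := is_cderiveZ (- 2%:R * 'i%C) (plane_int_derive (oI _) (part_image_compact (P := P) (k := k))
  (part_image_sub (k := k)) (sF k) (F0 k) ha).
have := is_cderive_sum (part_index P) dk.
have tW' := tderive_two_form sW tW ha.
have -> : \sum_(k <- part_index P) - 2%:R * 'i%C *
    plane_int (U k) (fun p => cderive ((1, 0) : R * (R * R)) (F k) (a, p)) =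
  I (fun i x => tderive (fun s => W s i x) a).
  rewrite (integration_part P tW'); apply: eq_bigr => k _.
  rewrite (integration_localize P k tW'); congr (_ * _).
  apply: plane_int_eq => p /set_mem Up.
  have [e1 e2] := slice_time p.
  rewrite -pd_real -[LHS](pd_affine (F k) (real_direction (1 : R)) a e1) /localize /=.
  rewrite -/(tderive _ _) /F /localize /=.
  have sm : csmooth_on (time_set eps) (fun s => W s (part_chart P k) (chart_inv S (part_chart P k) p)).
    exact: (csmooth_on_affine e1 e2 (sW (part_chart P k)) (fun s (hs : time_set eps s) => conj hs Up)).
  exact: (@pdZ _ _ _ (fun s => W s (part_chart P k) (chart_inv S (part_chart P k) p))
    ((part_fun P k (chart_inv S (part_chart P k) p))%:C) (real_direction (1 : R)) a sm ha).
apply: is_cderive_eq_near.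
have : \near a, time_set eps a by apply: open_nbhs_nbhs; split => //; exact: time_set_open.
apply: filterS => t ht; rewrite (integration_part P (tW t ht)).
by apply: eq_bigr => k _; rewrite (integration_localize P k (tW t ht)).
Qed.

End surface_integral.

(** * The Bochner argument *)

Section matrix_algebra.
Context {R : realType}.

Lemma mxadjM {m k l} (A : 'M[R[i]]_(m, k)) (B : 'M[R[i]]_(k, l)) :
  mxadj (A *m B) = mxadj B *m mxadj A.
Proof. by rewrite /mxadj map_mxM trmx_mul. Qed.

Lemma mxadjD {m k} (A B : 'M[R[i]]_(m, k)) : mxadj (A + B) = mxadj A + mxadj B.
Proof. by rewrite /mxadj map_mxD linearD. Qed.

Lemma mxadjN {m k} (A : 'M[R[i]]_(m, k)) : mxadj (- A) = - mxadj A.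
Proof. by rewrite /mxadj map_mxN linearN. Qed.

Lemma mxadjK {m k} (A : 'M[R[i]]_(m, k)) : mxadj (mxadj A) = A.
Proof. by apply/matrixP => a b; rewrite !mxE conjcK. Qed.

Lemma mxadj_bracket {n} (A B : 'M[R[i]]_n) : mxadj (mxbracket A B) = mxbracket (mxadj B) (mxadj A).
Proof. by rewrite /mxbracket mxadjD mxadjN !mxadjM. Qed.

Lemma mxadjZ {m k} (c : R[i]) (A : 'M[R[i]]_(m, k)) : mxadj (c *: A) = c^*%C *: mxadj A.
Proof. by apply/matrixP => a b; rewrite !mxE rmorphM. Qed.

Lemma mx_addE {m k} (A B : 'M[R[i]]_(m, k)) a b : (A + B) a b = A a b + B a b.
Proof. by rewrite mxE. Qed.

Lemma mx_oppE {m k} (A : 'M[R[i]]_(m, k)) a b : (- A) a b = - A a b.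
Proof. by rewrite mxE. Qed.

Lemma mx_scaleE {m k} (c : R[i]) (A : 'M[R[i]]_(m, k)) a b : (c *: A) a b = c * A a b.
Proof. by rewrite mxE. Qed.

Lemma mx_zeroE {m k} a b : (0 : 'M[R[i]]_(m, k)) a b = 0.
Proof. by rewrite mxE. Qed.

End matrix_algebra.

Ltac mx_expand := rewrite /mxbracket ?(mulmxDl, mulmxDr, mulNmx, mulmxN, opprD, opprK, mulmxA).
(* Products and entries are abstracted, since [rewrite] and [ring] would compare
   them up to conversion. *)
Ltac mx_abel :=
  repeat match goal with
  | |- context [@mulmx ?T ?m ?k ?l ?M ?N] =>
      let t := fresh "t" in set t := (@mulmx T m k l M N); clearbody t
  end;
  apply/matrixP => ? ?; rewrite ?(mx_addE, mx_oppE, mx_scaleE, mx_zeroE);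
  repeat match goal with
  | |- context [@fun_of_matrix ?T ?m ?k ?M ?a ?b] =>
      let t := fresh "t" in set t := (@fun_of_matrix T m k M a b); clearbody t
  end; ring.

(** * Positive hermitian forms and the norm of an endomorphism *)

Section positive_trace.
Context {R : realType} {n : nat}.
Local Notation C := R[i].

Lemma mxadjE {m k} (A : 'M[C]_(m, k)) : mxadj A = map_mx Num.conj (A^T).
Proof. by rewrite /mxadj map_trmx. Qed.

(** A hermitian matrix is normal, hence unitarily diagonalisable. The eigenvalue [d 0 k] is the
    value of the form on the unit eigenvector [mxadj P *m delta_mx k 0], so it is positive. *)
Lemma posdef_spectral (H : 'M[C]_n) : mxadj H = H ->
  (forall v : 'cV[C]_n, v != 0 -> 0 < (mxadj v *m H *m v) 0 0) ->
  exists (P : 'M[C]_n) (d : 'rV[C]_n),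
    [/\ P *m mxadj P = 1%:M, H = mxadj P *m diag_mx d *m P & forall k, 0 < d 0 k].
Proof.
move=> hH pos.
have nH : H \is normalmx by apply/normalmxP; rewrite -mxadjE hH.
have := orthomx_spectralP nH.
set P := spectralmx H; set d := spectral_diag H.
have uP : P \is unitarymx by exact: spectral_unitarymx.
have PP : P *m mxadj P = 1%:M by rewrite mxadjE; exact/unitarymxP.
rewrite (invmx_unitary uP) -mxadjE => eH.
exists P, d; split=> // k.
have v0 : mxadj P *m delta_mx k 0 != 0 :> 'cV[C]_n.
  apply/eqP => h; have : P *m (mxadj P *m delta_mx k (0 : 'I_1)) = 0 by rewrite h mulmx0.
  rewrite mulmxA PP mul1mx => /matrixP/(_ k 0); rewrite !mxE !eqxx /= => /eqP.
  by rewrite oner_eq0.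
have := pos _ v0; rewrite eH mxadjM mxadjK.
set e := delta_mx k 0.
have -> : mxadj e *m P *m (mxadj P *m diag_mx d *m P) *m (mxadj P *m e)
  = mxadj e *m (P *m mxadj P) *m diag_mx d *m (P *m mxadj P) *m e.
  by rewrite !mulmxA.
rewrite PP !mulmx1.
have -> : mxadj e = delta_mx 0 k.
  by apply/matrixP => a b; rewrite !mxE andbC; exact: rmorph_nat.
by rewrite -rowE -colE !mxE eqxx mulr1n.
Qed.

(** The trace is the squared norm of [u] for the metric [H]. In an eigenbasis of [H], where [u] has
    matrix [V], it is the sum of (d_b / d_a) |V_ba|^2. *)
Lemma posdef_trace (H u : 'M[C]_n) : mxadj H = H ->
  (forall v : 'cV[C]_n, v != 0 -> 0 < (mxadj v *m H *m v) 0 0) ->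
  H \in unitmx /\
  0 <= \tr (invmx H *m mxadj u *m H *m u) /\
  (\tr (invmx H *m mxadj u *m H *m u) = 0 -> u = 0).
Proof.
move=> hH pos; have [P [d [PP eH d0]]] := posdef_spectral hH pos.
have P'P : mxadj P *m P = 1%:M by exact: mulmx1C.
pose d' : 'rV[C]_n := \row_k (d 0 k)^-1.
pose K := mxadj P *m diag_mx d' *m P.
have dd : diag_mx d *m diag_mx d' = 1%:M.
  rewrite mulmx_diag; apply/matrixP => a b; rewrite !mxE.
  by case: eqP => [->|_]; rewrite ?mulr1n ?mulr0n // divff // gt_eqF.
have HK : H *m K = 1%:M.
  rewrite eH /K.
  have -> : mxadj P *m diag_mx d *m P *m (mxadj P *m diag_mx d' *m P) =
    mxadj P *m (diag_mx d *m (P *m mxadj P) *m diag_mx d') *m P by rewrite !mulmxA.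
  by rewrite PP mulmx1 dd mulmx1.
have uH : H \in unitmx by have [] := mulmx1_unit HK.
have iH : invmx H = K by rewrite -[LHS]mulmx1 -HK mulmxA mulVmx // mul1mx.
pose V := P *m u *m mxadj P.
have tE : \tr (invmx H *m mxadj u *m H *m u) = \sum_a \sum_b (d 0 a)^-1 * d 0 b * `|V b a| ^+ 2.
  rewrite iH /K eH.
  have -> : mxadj P *m diag_mx d' *m P *m mxadj u *m (mxadj P *m diag_mx d *m P) *m u =
    mxadj P *m (diag_mx d' *m (P *m mxadj u *m mxadj P) *m diag_mx d *m (P *m u)).
    by rewrite !mulmxA.
  rewrite mxtrace_mulC.
  have -> : diag_mx d' *m (P *m mxadj u *m mxadj P) *m diag_mx d *m (P *m u) *m mxadj P =
     diag_mx d' *m mxadj V *m (diag_mx d *m V).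
    by rewrite /V !mxadjM mxadjK !mulmxA.
  rewrite /mxtrace; apply: eq_bigr => a _; rewrite mxE; apply: eq_bigr => b _.
  rewrite mul_diag_mx mul_diag_mx !mxE normCK.
  by rewrite mulrACA; congr (_ * _); rewrite mulrC.
split=> //; rewrite tE; split.
  apply: sumr_ge0 => a _; apply: sumr_ge0 => b _.
  by rewrite mulr_ge0 ?exprn_ge0 // mulr_ge0 // ?invr_ge0 ltW.
move=> s0.
have t0 a b : 0 <= (d 0 a)^-1 * d 0 b * `|V b a| ^+ 2.
  by rewrite mulr_ge0 ?exprn_ge0 // mulr_ge0 // ?invr_ge0 ltW.
have V0 : V = 0.
  apply/matrixP => b a; rewrite [RHS]mxE.
  have h1 c : true -> 0 <= \sum_e (d 0 c)^-1 * d 0 e * `|V e c| ^+ 2.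
    by move=> _; apply: sumr_ge0 => e _.
  have h2 : \sum_e (d 0 a)^-1 * d 0 e * `|V e a| ^+ 2 = 0 by apply: (psumr_eq0P h1 s0).
  have : (d 0 a)^-1 * d 0 b * `|V b a| ^+ 2 = 0.
    by apply: (psumr_eq0P (fun e (_ : true) => t0 a e) h2).
  move=> /eqP.
  have c0 : (d 0 a)^-1 * d 0 b != 0.
    by apply: mulf_neq0; [apply: invr_neq0|]; exact: lt0r_neq0.
  by rewrite mulf_eq0 (negbTE c0) expf_eq0 /= normr_eq0 => /eqP.
have -> : u = mxadj P *m V *m P.
  have -> : mxadj P *m V *m P = (mxadj P *m P) *m u *m (mxadj P *m P) by rewrite /V !mulmxA.
  by rewrite P'P mulmx1 mul1mx.
by rewrite V0 mulmx0 mul0mx.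
Qed.

End positive_trace.

Section bochner_algebra.
Context {R : realType} {n : nat}.
Implicit Types (A X C P Q E u H K : 'M[R[i]]_n).

(** [dA] and [dX] stand for z-derivatives, [bC] for a zbar-derivative, and - [A, X] for the
    zbar-derivative of a holomorphic [X]. With this reading, the two covariant derivatives of [X]
    commute up to the bracket with the curvature. *)
Lemma commutator_curvature A X C dA bC dX :
  - (mxbracket dA X + mxbracket A dX) + (mxbracket bC X + mxbracket C (- mxbracket A X))
    + mxbracket A (dX + mxbracket C X) = - mxbracket (dA - bC + mxbracket C A) X.
Proof. by mx_expand; mx_abel. Qed.

Lemma bracketNl A X : mxbracket (- A) X = - mxbracket A X.
Proof. by mx_expand; mx_abel. Qed.

Lemma bracketBr A X Q : mxbracket A (X - Q) = mxbracket A X - mxbracket A Q.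
Proof. by mx_expand; mx_abel. Qed.

Lemma mxtraceN A : \tr (- A) = - \tr A.
Proof. exact: raddfN. Qed.

Lemma trace_signs A X P Q :
  \tr (- A *m X) + \tr (P *m Q) = - (\tr (A *m X) + \tr (- P *m Q)).
Proof. by rewrite !mulNmx !mxtraceN opprD opprK. Qed.

Lemma bracketC A X : mxbracket A X = - mxbracket X A.
Proof. by rewrite /mxbracket opprB. Qed.

(** To be read with P = Phi, Q = Phi^*, X = xi and S = xi^*. By Jacobi, [[P, Q], X] = [P, [Q, X]] +
    [[P, X], Q], and both sides become [P, [Q, X]] + [P, Q]. *)
Lemma bracket_jacobi_grading P Q X S : mxbracket P X = P -> mxbracket Q S = - Q ->
  mxbracket (mxbracket P Q) X = mxbracket P (mxbracket Q (X - S)).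
Proof.
move=> hP hQ.
have -> : mxbracket Q (X - S) = mxbracket Q X - mxbracket Q S by mx_expand; mx_abel.
have -> : mxbracket (mxbracket P Q) X = mxbracket P (mxbracket Q X) + mxbracket (mxbracket P X) Q.
  by mx_expand; mx_abel.
by rewrite hP hQ; mx_expand; mx_abel.
Qed.

(** The trace kills [A, E u], so the derivative of tr(E u) may be computed with covariant
    derivatives. *)
Lemma trace_bracket_derivation A E u bE bu :
  \tr (bE *m u + E *m bu) = \tr ((bE + mxbracket A E) *m u) + \tr (E *m (bu + mxbracket A u)).
Proof.
rewrite /mxbracket !(mulmxDl, mulmxDr, mulmxN, mulNmx) !mulmxA !raddfD !raddfN /=.
rewrite (mxtrace_mulC (E *m u) A) mulmxA.
ring.
Qed.

Lemma trace_bracket_swap E P X : \tr (E *m mxbracket P X) = \tr (mxbracket E P *m X).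
Proof.
rewrite /mxbracket !(mulmxDl, mulmxDr, mulmxN, mulNmx) !mulmxA !raddfD !raddfN /=.
by rewrite (mxtrace_mulC (E *m X) P) mulmxA.
Qed.

Section adjoint.
Variables (H : 'M[R[i]]_n).
Hypotheses (hH : mxadj H = H) (uH : H \in unitmx).

Definition st A := invmx H *m mxadj A *m H.

Lemma mxadj_inv : mxadj (invmx H) = invmx H.
Proof.
have h : mxadj (invmx H) *m H = 1%:M.
  rewrite -[X in _ *m X]hH -mxadjM mulmxV //; apply/matrixP => a b.
  by rewrite !mxE eq_sym; exact: rmorph_nat.
by rewrite -[LHS]mulmx1 -(mulmxV uH) mulmxA h mul1mx.
Qed.

Lemma st_sub A X : st (A - X) = st A - st X.
Proof. by rewrite /st mxadjD mxadjN !(mulmxDl, mulmxDr, mulmxN, mulNmx). Qed.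

Lemma st_bracket A X : st (mxbracket A X) = mxbracket (st X) (st A).
Proof.
have stM B Y : st (B *m Y) = st Y *m st B.
  by rewrite /st mxadjM !mulmxA mulmxK.
by rewrite {1}/mxbracket st_sub !stM.
Qed.

Lemma stK A : st (st A) = A.
Proof.
rewrite /st !mxadjM hH mxadjK mxadj_inv !mulmxA mulVmx // mul1mx -mulmxA mulVmx //.
by rewrite mulmx1.
Qed.

(** Compatibility of the Chern connection with the metric: dbar of the adjoint of X is the adjoint
    of d^h X. [Hz] and [dX] stand for z-derivatives, [bS] for the zbar-derivative of [st X], and the
    hypothesis is the zbar-derivative of [H *m st X = mxadj X *m H]. *)
Lemma st_holomorphic A X dX Hz bS :
  mxadj Hz *m st X + H *m bS = mxadj dX *m H + mxadj X *m mxadj Hz ->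
  bS + mxbracket A (st X) = st (dX + mxbracket (invmx H *m (Hz - mxadj A *m H)) X).
Proof.
move=> hbS.
set C := invmx H *m _.
have HS : H *m st X = mxadj X *m H by rewrite /st !mulmxA mulmxV // mul1mx.
have C'H : mxadj C *m H = mxadj Hz - H *m A.
  rewrite /C mxadjM mxadj_inv mxadjD mxadjN mxadjM mxadjK hH -mulmxA mulVmx //.
  by rewrite mulmx1.
rewrite -[LHS]mul1mx -(mulVmx uH) -mulmxA /st -[RHS]mulmxA; congr (_ *m _).
have e1 : H *m bS = mxadj dX *m H + mxadj X *m mxadj Hz - mxadj Hz *m st X.
  by rewrite -hbS addrAC subrr add0r.
rewrite mulmxDr e1 mxadjD mxadj_bracket /mxbracket !(mulmxDl, mulmxDr, mulmxN, mulNmx).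
have -> : mxadj C *m mxadj X *m H = (mxadj C *m H) *m st X by rewrite -mulmxA -HS mulmxA.
have -> : mxadj X *m mxadj C *m H = mxadj X *m (mxadj C *m H) by rewrite mulmxA.
rewrite C'H !(mulmxDl, mulmxDr, mulmxN, mulNmx) (mulmxA H) (mulmxA H (st X)) HS !mulmxA.
mx_abel.
Qed.

End adjoint.
End bochner_algebra.

Section planar_bochner.
Context {R : realType} {n : nat}.
Variables (U : set (R * R)) (H A X P : R * R -> 'M[R[i]]_n).
Hypotheses (oU : open U) (sH : mxsmooth_on U H) (sA : mxsmooth_on U A)
  (sX : mxsmooth_on U X) (sP : mxsmooth_on U P).
Hypothesis hH : forall p, U p -> mxadj (H p) = H p.
Hypothesis uH : forall p, U p -> H p \in unitmx.

Local Notation dz := (mxpd dir_z).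
Local Notation db := (mxpd dir_zbar).

(** In one chart, [C] is the Chern connection of [H] and [u] is d^h X, while [E] and [Z] are the eta
    and Z of the Bochner argument. *)
Let C p := invmx (H p) *m (dz H p - mxadj (A p) *m H p).
Let stf (F : R * R -> 'M[R[i]]_n) p := st (H p) (F p).
Let u p := dz X p + mxbracket (C p) (X p).
Let E p := X p - stf X p.
Let Z p := mxbracket (stf P p) (E p).

Hypothesis hol : forall p, U p -> db X p + mxbracket (A p) (X p) = 0.
Hypothesis PX : forall p, U p -> mxbracket (P p) (X p) = P p.
Hypothesis curv : forall p, U p ->
  dz A p - db C p + mxbracket (C p) (A p) + mxbracket (P p) (stf P p) = 0.

Lemma smooth_invH : mxsmooth_on U (fun p => invmx (H p)).
Proof. exact: (mxsmooth_on_inv oU sH uH). Qed.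

Lemma smooth_stf F : mxsmooth_on U F -> mxsmooth_on U (stf F).
Proof.
move=> sF; apply: (mxsmooth_on_mul oU) sH.
exact: (mxsmooth_on_mul oU smooth_invH (mxsmooth_on_adj oU sF)).
Qed.

Lemma smooth_C : mxsmooth_on U C.
Proof.
apply: (mxsmooth_on_mul oU smooth_invH).
apply: (mxsmooth_on_add oU (mxsmooth_on_pd dir_z oU sH)).
exact: (mxsmooth_on_opp oU (mxsmooth_on_mul oU (mxsmooth_on_adj oU sA) sH)).
Qed.

Lemma smooth_u : mxsmooth_on U u.
Proof.
exact: (mxsmooth_on_add oU (mxsmooth_on_pd dir_z oU sX) (mxsmooth_on_bracket oU smooth_C sX)).
Qed.

Lemma smooth_E : mxsmooth_on U E.
Proof. exact: (mxsmooth_on_add oU sX (mxsmooth_on_opp oU (smooth_stf sX))). Qed.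

(** As X is holomorphic, dbar d^h X = - [F, X] with F the curvature. Hitchin's equation replaces F
    by - [Phi, Phi^*], and [bracket_jacobi_grading] turns the result into [Phi, Z]. *)
Lemma bochner_u p : U p ->
  db u p + mxbracket (A p) (u p) = mxbracket (P p) (Z p).
Proof.
move=> Up.
have sdX := mxsmooth_on_pd dir_z oU sX.
have sCX := mxsmooth_on_bracket oU smooth_C sX.
have e1 : db u p = db (dz X) p + (mxbracket (db C p) (X p) + mxbracket (C p) (db X p)).
  by rewrite /u (mxpdD _ sdX sCX Up) (mxpd_bracket _ oU smooth_C sX Up).
have loc : {in U, db X =1 (fun q => - mxbracket (A q) (X q))}.
  by move=> q /set_mem Uq; apply/eqP; rewrite -addr_eq0 hol.
have e2 : db (dz X) p = - (mxbracket (dz A p) (X p) + mxbracket (A p) (dz X p)).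
  rewrite (mxpd_comm _ _ oU sX Up) (mxpd_eq_on _ oU loc (mem_set Up)).
  by rewrite (mxpdN _ (mxsmooth_on_bracket oU sA sX) Up) (mxpd_bracket _ oU sA sX Up).
rewrite e1 e2 (loc p (mem_set Up)) /u commutator_curvature.
have -> : dz A p - db C p + mxbracket (C p) (A p) = - mxbracket (P p) (stf P p).
  by apply/eqP; rewrite -addr_eq0 curv.
rewrite bracketNl opprK; apply: bracket_jacobi_grading; first exact: PX.
have := st_bracket (uH Up) (P p) (X p); rewrite (PX Up) => e3.
by rewrite bracketC; congr (- _); exact: esym e3.
Qed.

Lemma bochner_stX p : U p ->
  db (stf X) p + mxbracket (A p) (stf X p) = st (H p) (u p).
Proof.
move=> Up; apply: (st_holomorphic (hH Up) (uH Up)).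
have sst := smooth_stf sX.
have e1 : {in U, (fun q => H q *m stf X q) =1 (fun q => mxadj (X q) *m H q)}.
  by move=> q /set_mem Uq; rewrite /stf /st !mulmxA mulmxV ?mul1mx // uH.
have := etrans (esym (mxpdM dir_zbar oU sH sst Up)) (etrans
  (mxpd_eq_on dir_zbar oU e1 (mem_set Up)) (mxpdM dir_zbar oU (mxsmooth_on_adj oU sX) sH Up)).
rewrite (mxpd_adj _ sX Up) conj_dir_zbar.
have e2 : {in U, H =1 (fun q => mxadj (H q))} by move=> q /set_mem Uq; rewrite hH.
have -> : db H p = mxadj (dz H p).
  by rewrite (mxpd_eq_on _ oU e2 (mem_set Up)) (mxpd_adj _ sH Up) conj_dir_zbar.
by [].
Qed.

Lemma st_E p : U p -> st (H p) (E p) = - E p.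
Proof.
by move=> Up; rewrite /E st_sub /stf (stK (hH Up) (uH Up)) opprB.
Qed.

(** The product rule gives two terms. By holomorphy of X and [bochner_stX], dbar eta is minus the
    adjoint of u. The bracket in dbar u = [Phi, Z] moves across the trace onto eta, and [eta, Phi]
    is minus the adjoint of Z because eta is skew-adjoint. *)
Lemma bochner_identity p : U p ->
  pd dir_zbar (fun q => \tr (E q *m u q)) p =
  - (\tr (st (H p) (u p) *m u p) + \tr (st (H p) (Z p) *m Z p)).
Proof.
move=> Up.
have sE := smooth_E; have su := smooth_u.
apply: (etrans (pd_trace _ oU (mxsmooth_on_mul oU sE su) Up)).
apply: (etrans (congr1 mxtrace (mxpdM _ oU sE su Up))).
apply: (etrans (trace_bracket_derivation (A p) _ _ _ _)).
pose a := \tr ((db E p + mxbracket (A p) (E p)) *m u p).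
apply: (etrans (congr1 (fun M => a + \tr (E p *m M)) (bochner_u Up))).
apply: (etrans (congr1 (fun z => a + z) (trace_bracket_swap (E p) (P p) (Z p)))); rewrite /a.
have -> : db E p + mxbracket (A p) (E p) = - st (H p) (u p).
  rewrite -(bochner_stX Up) {1}/E (mxpdB _ oU sX (smooth_stf sX) Up).
  have -> : db X p = - mxbracket (A p) (X p) by apply/eqP; rewrite -addr_eq0 hol.
  by rewrite /E; mx_expand; mx_abel.
have -> : st (H p) (Z p) = - mxbracket (E p) (P p).
  rewrite /Z (st_bracket (uH Up)) st_E // /stf (stK (hH Up) (uH Up)).
  exact: bracketNl.
exact: trace_signs.
Qed.

Lemma bochner_vanishing p : U p -> Z p = 0 -> mxbracket (stf P p) (X p) = - stf P p.
Proof.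
move=> Up Z0.
have e3 := st_bracket (uH Up) (P p) (X p); rewrite (PX Up) in e3.
have eZ : Z p = mxbracket (stf P p) (X p) - mxbracket (stf P p) (stf X p) by exact: bracketBr.
have -> : mxbracket (stf P p) (X p) = mxbracket (stf P p) (stf X p).
  by apply/eqP; rewrite -subr_eq0 -eZ Z0.
by rewrite bracketC; congr (- _); exact: esym e3.
Qed.

End planar_bochner.

Section conjugation_algebra.
Context {R : realType} {n : nat}.
Implicit Types (G A B D v dv b : 'M[R[i]]_n).

Lemma conj_mul G G' A B : G' *m G = 1%:M ->
  (G *m A *m G') *m (G *m B *m G') = G *m (A *m B) *m G'.
Proof.
move=> h; rewrite !mulmxA -(mulmxA (G *m A) G' G) h mulmx1.
by [].
Qed.

Lemma conj_bracket G G' A B : G' *m G = 1%:M ->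
  mxbracket (G *m A *m G') (G *m B *m G') = G *m mxbracket A B *m G'.
Proof. by move=> h; rewrite /mxbracket !(conj_mul _ _ h) mulmxBr mulmxBl. Qed.

Lemma bracketZl (c : R[i]) A B : mxbracket (c *: A) B = c *: mxbracket A B.
Proof. by rewrite /mxbracket -scalemxAl -scalemxAr scalerBr. Qed.

Lemma bracketDl A B D : mxbracket (A + B) D = mxbracket A D + mxbracket B D.
Proof. by mx_expand; mx_abel. Qed.

Lemma conj_trace G G' A : G' *m G = 1%:M -> \tr (G *m A *m G') = \tr A.
Proof. by move=> h; rewrite mxtrace_mulC mulmxA h mul1mx. Qed.

(** [D] and [D'] are the derivatives of a transition matrix [G] and of its inverse, tied by
    differentiating [G *m G' = 1%:M]. The terms they produce cancel against the inhomogeneous term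
    of the connection. *)
Lemma covariant_derivative_conj (J : R[i]) G G' D D' v dv b :
  G' *m G = 1%:M -> D *m G' + G *m D' = 0 ->
  (D *m v + G *m (J *: dv)) *m G' + (G *m v) *m D'
    + mxbracket (J *: (G *m b *m G') - 1 *: (D *m G')) (G *m v *m G') =
  J *: (G *m (dv + mxbracket b v) *m G').
Proof.
move=> hG hD.
have eD : D' = - (G' *m (D *m G')).
  rewrite -[LHS]mul1mx -hG -mulmxA -[G *m D']addr0 -(subrr (D *m G')).
  by rewrite addrA [G *m D' + _]addrC hD add0r mulmxN.
rewrite scale1r bracketDl bracketZl (conj_bracket _ _ hG) eD.
have e1 : mxbracket (- (D *m G')) (G *m v *m G') =
    - (D *m v *m G') + G *m v *m (G' *m (D *m G')).
  rewrite /mxbracket mulNmx mulmxN opprK !mulmxA.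
  by rewrite -(mulmxA D G' G) hG mulmx1.
rewrite e1 mulmxN mulmxDl -scalemxAr -scalemxAl (mulmxDr G dv (mxbracket b v)).
rewrite (mulmxDl (G *m dv)) scalerDr.
move: (D *m v *m G') (G *m v *m (G' *m (D *m G'))) => p q.
move: (J *: (G *m dv *m G')) (J *: (G *m mxbracket b v *m G')) => r s.
by mx_abel.
Qed.

End conjugation_algebra.

(** * Bundle-valued forms and the global Bochner argument *)

Section bundle_forms.
Context {R : realType} {S : surface R} {n : nat} {g : cocycle S n}.
Hypothesis hS : riemann_surface S.
Hypothesis hg : SU_cocycle g.

Local Notation oI i := (@chart_image_open _ _ hS i).

Lemma cocycle_inv i j x : chart_dom S i x -> chart_dom S j x -> g i j x *m g j i x = 1%:M.
Proof. by case: hg => _ g1 g2 _ ix jx; rewrite (g2 i j i) // g1. Qed.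

Lemma cocycle_adj i j x : chart_dom S i x -> chart_dom S j x -> mxadj (g i j x) = g j i x.
Proof.
move=> ix jx; case: hg => _ _ _ g4; have [h _] := g4 i j x ix jx.
by rewrite -[LHS]mulmx1 -(cocycle_inv ix jx) mulmxA h mul1mx.
Qed.

Lemma two_form_trace (a b : endo S n) : form10 g a -> form01 g b ->
  two_form (fun i x => \tr (a i x *m b i x)).
Proof.
move=> [sa ta] [sb tb]; split=> [i|i j x ix jx].
  exact: (csmooth_on_trace (oI i) (mxsmooth_on_mul (oI i) (sa i) (sb i))).
have h := cocycle_inv jx ix.
rewrite (ta i j) // (tb i j) // -scalemxAl -scalemxAr (conj_mul _ _ h) !linearZ /=.
by rewrite (conj_trace _ h); ring.
Qed.

Lemma bracket_form10 (a u : endo S n) : form10 g a -> endomorphism g u ->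
  form10 g (endo_bracket a u).
Proof.
move=> [sa ta] [su tu]; split=> [i|i j x ix jx].
  exact: (mxsmooth_on_bracket (oI i) (sa i) (su i)).
rewrite /endo_bracket (ta i j) // (tu i j) // bracketZl (conj_bracket _ _ (cocycle_inv jx ix)).
by [].
Qed.

Lemma bracket_form01 (a u : endo S n) : form01 g a -> endomorphism g u ->
  form01 g (endo_bracket a u).
Proof.
move=> [sa ta] [su tu]; split=> [i|i j x ix jx].
  exact: (mxsmooth_on_bracket (oI i) (sa i) (su i)).
rewrite /endo_bracket (ta i j) // (tu i j) // bracketZl (conj_bracket _ _ (cocycle_inv jx ix)).
by [].
Qed.

Lemma endomorphismB (u v : endo S n) : endomorphism g u -> endomorphism g v ->
  endomorphism g (fun i x => u i x - v i x).
Proof.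
move=> [su tu] [sv tv]; split=> [i|i j x ix jx].
  exact: (mxsmooth_on_add (oI i) (su i) (mxsmooth_on_opp (oI i) (sv i))).
by rewrite (tu i j) // (tv i j) // mulmxBr mulmxBl.
Qed.

Lemma lam_end_form10 (b u : endo S n) : lam_operator g 1 b -> endomorphism g u ->
  form10 g (lam_end 1 b u).
Proof.
move=> [sb tb] [su tu]; split=> [i|i j x ix jx].
  have sd := mxsmooth_on_pd dir_z (oI i) (su i).
  have := mxsmooth_on_add (oI i) sd (mxsmooth_on_bracket (oI i) (sb i) (su i)).
  apply: (mxsmooth_on_eq (oI i)) => p /set_mem pI.
  by rewrite /lam_end /= scale1r mxdzE (chart_invK hS pI).
have oO := @overlap_open _ _ hS i j.
have Ox : chart S i x \in overlap i j by apply: mem_set; exists x.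
have Ox' := set_mem Ox.
have [sg _ _ _] := hg.
have sgij : mxsmooth_on (overlap i j) (g i j \o chart_inv S i) by exact: sg.
have sgji : mxsmooth_on (overlap i j) (g j i \o chart_inv S i).
  apply: (mxsmooth_on_eq oO) (mxsmooth_on_adj oO sgij) => p /set_mem /(overlap_inv hS)[pi pj _].
  by rewrite /= cocycle_adj.
have suj : mxsmooth_on (overlap i j) (u j \o chart_inv S i).
  exact: (@mxsmooth_on_overlap _ _ hS i j _ _ (u j) (su j)).
have loc : {in overlap i j, u i \o chart_inv S i =1
    (fun p => (g i j \o chart_inv S i) p *m (u j \o chart_inv S i) p *m (g j i \o chart_inv S i) p)}.
  by move=> p /set_mem /(overlap_inv hS)[pi pj _]; rewrite /= (tu i j).
have e1 : mxdz i (u i) x = (mxdz i (g i j) x *m u j x + g i j x *m (jac i j x *: mxdz j (u j) x))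
    *m g j i x + (g i j x *m u j x) *m mxdz i (g j i) x.
  have [<- _] := mxdz_change hS (su j) ix jx.
  rewrite !mxdzE (mxpd_eq_on _ oO loc Ox).
  rewrite (mxpdM _ oO (mxsmooth_on_mul oO sgij suj) sgji Ox') (mxpdM _ oO sgij suj Ox').
  by rewrite /= (chartK hS ix).
have e2 : mxdz i (g i j) x *m g j i x + g i j x *m mxdz i (g j i) x = 0.
  have loc1 : {in overlap i j, (fun p => (g i j \o chart_inv S i) p *m (g j i \o chart_inv S i) p)
      =1 (fun=> 1%:M)}.
    by move=> p /set_mem /(overlap_inv hS)[pi pj _]; rewrite /= cocycle_inv.
  have := mxpd_eq_on dir_z oO loc1 Ox.
  rewrite mxpd_cst (mxpdM _ oO sgij sgji Ox') /= (chartK hS ix) -!mxdzE.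
  by [].
rewrite /lam_end !scale1r e1 (tu i j) // (tb i j) //.
exact: (covariant_derivative_conj _ _ _ _ (cocycle_inv jx ix) e2).
Qed.

Section metric.
Variable h : endo S n.
Hypothesis hh : hermitian_metric g h.

Lemma metric_unit i x : chart_dom S i x -> h i x \in unitmx.
Proof. by case: hh => _ _ h3 ix; have [e pos] := h3 i x ix; have [] := posdef_trace 0 e pos. Qed.

Lemma adj_h_smooth (u : endo S n) : chart_smooth u -> chart_smooth (adj_h h u).
Proof.
case: hh => sh _ _ su i.
have si : mxsmooth_on (chart_image (S := S) i) (fun p => invmx ((h i \o chart_inv S i) p)).
  apply: (mxsmooth_on_inv (oI i) (sh i)) => p pI; apply: metric_unit.
  exact: chart_inv_dom.
exact: (mxsmooth_on_mul (oI i) (mxsmooth_on_mul (oI i) si (mxsmooth_on_adj (oI i) (su i))) (sh i)).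
Qed.

(** The transition matrices are unitary, so their adjoints are their inverses and the metric itself
    transforms by conjugation. The conjugated scalar is what exchanges the types (1,0) and (0,1). *)
Lemma adj_h_transform (c : R[i]) (u : endo S n) i j x : chart_dom S i x -> chart_dom S j x ->
  u i x = c *: (g i j x *m u j x *m g j i x) ->
  adj_h h u i x = c^*%C *: (g i j x *m adj_h h u j x *m g j i x).
Proof.
move=> ix jx e; rewrite /adj_h e mxadjZ -scalemxAr -scalemxAl; congr (_ *: _).
have uj := metric_unit jx; have ui := metric_unit ix.
have G1 := cocycle_inv ix jx; have G2 := cocycle_inv jx ix.
have ej : h j x = g j i x *m h i x *m g i j x.
  by case: hh => _ h2 _; rewrite (h2 i j x ix jx) cocycle_adj.
have eij : invmx (h j x) = g j i x *m invmx (h i x) *m g i j x.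
  have e1 : (g j i x *m invmx (h i x) *m g i j x) *m h j x = 1%:M.
    by rewrite ej (conj_mul _ _ G1) mulVmx // mulmx1.
  by rewrite -[LHS]mul1mx -e1 mulmxK.
rewrite eij ej !mxadjM (cocycle_adj ix jx) (cocycle_adj jx ix) !mulmxA G1 mul1mx.
by rewrite -!mulmxA G1 mulmx1.
Qed.

Lemma adj_h_form10 u : form10 g u -> form01 g (adj_h h u).
Proof.
move=> [su tu]; split=> [|i j x ix jx]; first exact: adj_h_smooth.
by apply: adj_h_transform => //; exact: tu.
Qed.

Lemma adj_h_form01 u : form01 g u -> form10 g (adj_h h u).
Proof.
move=> [su tu]; split=> [|i j x ix jx]; first exact: adj_h_smooth.
by rewrite -[jac i j x]conjcK; apply: adj_h_transform => //; exact: tu.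
Qed.

Lemma adj_h_endomorphism u : endomorphism g u -> endomorphism g (adj_h h u).
Proof.
move=> [su tu]; split=> [|i j x ix jx]; first exact: adj_h_smooth.
rewrite (@adj_h_transform 1 u i j x ix jx); last by rewrite scale1r; exact: tu.
by rewrite -[X in X^*%C]/(1%:R) rmorph_nat scale1r.
Qed.

Hypothesis cS : compact [set: S].
Variable I : (atlas S -> S -> R[i]) -> R[i].
Hypothesis hI : is_integration (S := S) I.

Variables (alpha Phi b X : endo S n).
Hypothesis salpha : chart_smooth alpha.
Hypothesis fPhi : form10 g Phi.
Hypothesis Hitchin : forall i x, chart_dom S i x ->
  curvature 1 alpha (chern h alpha) i x + mxbracket (Phi i x) (adj_h h Phi i x) = 0.
Hypothesis eX : endomorphism g X.
Hypothesis holX : forall i x, chart_dom S i x -> dbar_end alpha X i x = 0.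
Hypothesis PhiX : forall i x, chart_dom S i x -> mxbracket (Phi i x) (X i x) = Phi i x.
Hypothesis lb : lam_operator g 1 b.
Hypothesis bX : forall i x, chart_dom S i x ->
  mxbracket (b i x) (X i x) = mxbracket (chern h alpha i x) (X i x).

(** The connection [b] is only tied to the Chern connection through its bracket with [X]. Its
    transformation law makes [u] a global form, while the pointwise identities are those of the
    Chern connection. *)
Theorem harmonic_grading_parallel i x : chart_dom S i x ->
  lam_end 1 b X i x = 0 /\ mxbracket (adj_h h Phi i x) (X i x) = - adj_h h Phi i x.
Proof.
pose u := lam_end 1 b X.
pose E : endo S n := fun i x => X i x - adj_h h X i x.
pose Z := endo_bracket (adj_h h Phi) E.
have fu : form10 g u by exact: lam_end_form10.
have eE : endomorphism g E by exact: (endomorphismB eX (adj_h_endomorphism eX)).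
have fZ : form01 g Z by exact: (bracket_form01 (adj_h_form10 fPhi) eE).
(* The density |u|^2 + |Z|^2, with each product ordered as a (1,0)-factor followed by a (0,1)-factor
   to fit [two_form_trace]; [wE] restores the order in which positivity is stated. *)
pose w : atlas S -> S -> R[i] := fun i x =>
  \tr (u i x *m adj_h h u i x) + \tr (adj_h h Z i x *m Z i x).
have wE j y : w j y = \tr (adj_h h u j y *m u j y) + \tr (adj_h h Z j y *m Z j y).
  by apply: (congr1 (fun z => z + _)); exact: mxtrace_mulC.
have tw : two_form w.
  exact: (two_formD hS (two_form_trace fu (adj_h_form10 fu))
    (two_form_trace (adj_h_form01 fZ) fZ)).
pose t10 : atlas S -> S -> R[i] := fun i x => \tr (E i x *m u i x).
have [sE tE] := eE; have [su tu] := fu.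
have local j y : chart_dom S j y ->
    dzbar j (t10 j) y = - w j y /\ (Z j y = 0 ->
      mxbracket (adj_h h Phi j y) (X j y) = - adj_h h Phi j y).
  move=> jy.
  pose U := chart_image (S := S) j.
  have Up := chart_in_image jy : U (chart S j y).
  have [sh _ h3] := hh; have [sPhi _] := fPhi; have [sX _] := eX.
  pose H := h j \o chart_inv S j; pose A := alpha j \o chart_inv S j.
  pose X' := X j \o chart_inv S j; pose P := Phi j \o chart_inv S j.
  have hH p : U p -> mxadj (H p) = H p.
    by move=> /(chart_inv_dom hS) d; have [] := h3 j _ d.
  have uH p : U p -> H p \in unitmx.
    by move=> /(chart_inv_dom hS) d; exact: metric_unit.
  have dE (F : S -> 'M[R[i]]_n) p : U p ->
      mxdz j F (chart_inv S j p) = mxpd dir_z (F \o chart_inv S j) p /\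
      mxdzbar j F (chart_inv S j p) = mxpd dir_zbar (F \o chart_inv S j) p.
    by move=> /(chart_invK hS) e; rewrite mxdzE mxdzbarE e.
  have hol p : U p -> mxpd dir_zbar X' p + mxbracket (A p) (X' p) = 0.
    move=> pU; have := holX (chart_inv_dom hS pU).
    by rewrite /dbar_end (dE (X j) p pU).2.
  have PX p : U p -> mxbracket (P p) (X' p) = P p.
    by move=> /(chart_inv_dom hS) d; exact: PhiX.
  have eC : {in U, chern h alpha j \o chart_inv S j =1
      (fun p => invmx (H p) *m (mxpd dir_z H p - mxadj (A p) *m H p))}.
    by move=> p /set_mem pU; rewrite /= /chern (dE (h j) p pU).1.
  have curv p : U p -> mxpd dir_z A p
      - mxpd dir_zbar (fun p => invmx (H p) *m (mxpd dir_z H p - mxadj (A p) *m H p)) p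
      + mxbracket (invmx (H p) *m (mxpd dir_z H p - mxadj (A p) *m H p)) (A p)
      + mxbracket (P p) (st (H p) (P p)) = 0.
    move=> pU; have := Hitchin (chart_inv_dom hS pU).
    rewrite /curvature scale1r (dE (alpha j) p pU).1 (dE (chern h alpha j) p pU).2.
    rewrite (mxpd_eq_on _ (oI j) eC (mem_set pU)).
    by have := eC p (mem_set pU); rewrite /= => ->.
  have uE q : U q -> u j (chart_inv S j q) = mxpd dir_z X' q +
      mxbracket (invmx (H q) *m (mxpd dir_z H q - mxadj (A q) *m H q)) (X' q).
    move=> qU; have d := chart_inv_dom hS qU.
    rewrite /u /lam_end scale1r (dE (X j) q qU).1 (bX d).
    by have := eC q (mem_set qU); rewrite /= => ->.
  split; last first.
    have := bochner_vanishing uH PX Up.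
    by rewrite /P /H /X' /= (chartK hS jy); exact.
  rewrite dzbarE.
  have loc : {in U, t10 j \o chart_inv S j =1 (fun q => \tr ((X' q - st (H q) (X' q)) *m
      (mxpd dir_z X' q +
      mxbracket (invmx (H q) *m (mxpd dir_z H q - mxadj (A q) *m H q)) (X' q))))}.
    by move=> q /set_mem qU; rewrite /= /t10 uE.
  rewrite (pd_eq_on _ (oI j) loc (mem_set Up)).
  have sH : mxsmooth_on U H by exact: sh.
  have sA : mxsmooth_on U A by exact: salpha.
  have sX' : mxsmooth_on U X' by exact: sX.
  have bi := bochner_identity (oI j) sH sA sX' hH uH hol PX curv Up.
  have uy := uE _ Up; rewrite (chartK hS jy) in uy.
  have Hc : H (chart S j y) = h j y by rewrite /H /= (chartK hS jy).
  have Pc : P (chart S j y) = Phi j y by rewrite /P /= (chartK hS jy).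
  have Xc : X' (chart S j y) = X j y by rewrite /X' /= (chartK hS jy).
  apply: (etrans bi); rewrite -uy Hc Pc Xc.
  exact: (congr1 -%R (esym (wE j y))).
have pos (M : endo S n) j y : chart_dom S j y ->
    0 <= \tr (adj_h h M j y *m M j y) /\ (\tr (adj_h h M j y *m M j y) = 0 -> M j y = 0).
  move=> jy; have [_ _ h3] := hh; have [e ps] := h3 j y jy.
  by have [_ [p1 p2]] := posdef_trace (M j y) e ps.
have w0 : forall j y, chart_dom S j y -> w j y = 0.
  apply: (integration_eq0 hS cS hI tw) => [j y jy|].
    rewrite wE; exact: (addr_ge0 (pos u j y jy).1 (pos Z j y jy).1).
  (* [w] is the differential of the (1,0)-form tr(eta u): the coefficient of such a differential is
     minus the zbar-derivative. *)
  apply: (surface_stokes hS cS hI (t10 := t10) (t01 := fun _ _ => 0)) => //.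
  - by move=> j; exact: (csmooth_on_trace (oI j) (mxsmooth_on_mul (oI j) (sE j) (su j))).
  - by move=> j; exact: csmooth_on_cst.
  - move=> j k y jy ky; rewrite /t10 (tE j k) // (tu j k) // -scalemxAr linearZ /=.
    by rewrite (conj_mul _ _ (cocycle_inv ky jy)) (conj_trace _ (cocycle_inv ky jy)).
  - by move=> j k y _ _; rewrite mulr0.
  - move=> j y jy; rewrite (local j y jy).1 opprK dzE.
    have -> : (fun=> 0) \o chart_inv S j = (fun=> 0 : R[i]) by [].
    by rewrite pd_cst add0r.
move=> ix; have [u0 u0'] := pos u i x ix; have [z0 z0'] := pos Z i x ix.
have := w0 i x ix; rewrite wE => /eqP.
rewrite paddr_eq0 // => /andP[/eqP /u0' hu /eqP /z0' hz].
by split=> //; exact: (local i x ix).2.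
Qed.

End metric.
End bundle_forms.

(** * Families of lambda-connections *)

Section parameter_families.
Context {R : realType} {S : surface R} {n : nat} {T : normedModType R}.
Hypothesis hS : riemann_surface S.
Variable O : set T.
Hypothesis oO : open O.

Local Notation oI i := (@chart_image_open _ _ hS i).

Definition joint (F : T -> endo S n) (i : atlas S) (w : T * (R * R)) : 'M[R[i]]_n :=
  F w.1 i (chart_inv S i w.2).

Definition smooth_family (F : T -> endo S n) : Prop :=
  forall i, mxsmooth_on (O `*` chart_image (S := S) i) (joint F i).

Definition param_pd (d : cdirection (V := T)) (F : T -> endo S n) : T -> endo S n :=
  fun t i x => mxpd d (fun s => F s i x) t.

Let param_dir (d : cdirection (V := T)) : cdirection (V := (T * (R * R))%type) :=
  map_direction (fun t => (t, 0)) d.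
Let space_dir (d : cdirection (V := (R * R)%type)) : cdirection (V := (T * (R * R))%type) :=
  map_direction (fun p => (0, p)) d.

Lemma param_slice (p : R * R) :
  (forall h u y, (fun t : T => (t, p)) (h *: u + y) =
     h *: (fun t : T => (t, 0 : R * R)) u + (fun t : T => (t, p)) y) /\
  continuous (fun t : T => (t, p)).
Proof.
split=> [h u y|t].
  by apply: injective_projections; rewrite /= ?scaler0 ?add0r.
by apply: (@cvg_pair _ _ _ _ (nbhs t) (nbhs p)); [exact: cvg_id|exact: cvg_cst].
Qed.

Lemma space_slice (t : T) :
  (forall h u y, (fun p : R * R => (t, p)) (h *: u + y) =
     h *: (fun p : R * R => (0 : T, p)) u + (fun p : R * R => (t, p)) y) /\
  continuous (fun p : R * R => (t, p)).
Proof.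
split=> [h u y|p].
  by apply: injective_projections; rewrite /= ?scaler0 ?add0r.
by apply: (@cvg_pair _ _ _ _ (nbhs t) (nbhs p)); [exact: cvg_cst|exact: cvg_id].
Qed.

Lemma family_open i : open (O `*` chart_image (S := S) i).
Proof. by apply: openX; [exact: oO|exact: (oI i)]. Qed.

Lemma joint_param_pd d F i : joint (param_pd d F) i = mxpd (param_dir d) (joint F i).
Proof.
apply/funext => -[t p]; have [e1 e2] := param_slice p.
exact: (mxpd_affine (joint F i) d t e1).
Qed.

Lemma smooth_family_pd d F : smooth_family F -> smooth_family (param_pd d F).
Proof.
by move=> sF i; rewrite joint_param_pd; exact: (mxsmooth_on_pd _ (@family_open i) (sF i)).
Qed.

Lemma space_pd_joint d F i t p : mxpd d (F t i \o chart_inv S i) p = mxpd (space_dir d) (joint F i) (t, p).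
Proof. by have [e1 e2] := space_slice t; exact: (mxpd_affine (joint F i) d p e1). Qed.

Lemma smooth_family_at F t : smooth_family F -> O t -> chart_smooth (F t).
Proof.
move=> sF Ot i; have [e1 e2] := space_slice t.
by apply: (mxsmooth_on_affine e1 e2 (sF i)) => p pI; split.
Qed.

Lemma smooth_family_point F i x : smooth_family F -> chart_dom S i x ->
  mxsmooth_on O (fun t => F t i x).
Proof.
move=> sF ix; have [e1 e2] := param_slice (chart S i x).
have := mxsmooth_on_affine e1 e2 (sF i) (fun t (Ot : O t) => conj Ot (chart_in_image ix)).
by congr (mxsmooth_on _ _); apply/funext => t; rewrite /joint /= (chartK hS ix).
Qed.

(** Parameter derivatives and chart derivatives are both partial derivatives of one function on the
    product, so they commute by the symmetry of mixed derivatives. *)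
Lemma param_pd_space_pd (d : cdirection (V := T)) (e : cdirection (V := (R * R)%type)) F i t p :
  smooth_family F -> O t -> chart_image (S := S) i p ->
  mxpd d (fun s => mxpd e (F s i \o chart_inv S i) p) t =
  mxpd e (param_pd d F t i \o chart_inv S i) p.
Proof.
move=> sF Ot pI; rewrite space_pd_joint joint_param_pd.
have -> : (fun s => mxpd e (F s i \o chart_inv S i) p) =
    mxpd (space_dir e) (joint F i) \o (fun s => (s, p)).
  by apply/funext => s; rewrite space_pd_joint.
have [e1 e2] := param_slice p; rewrite (mxpd_affine _ d t e1).
have Otp : (O `*` chart_image (S := S) i) (t, p) by [].
exact: (mxpd_comm _ _ (@family_open i) (sF i) Otp).
Qed.

Lemma param_pd_dz d F i x t : smooth_family F -> O t -> chart_dom S i x ->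
  mxpd d (fun s => mxdz i (F s i) x) t = mxdz i (param_pd d F t i) x.
Proof.
move=> sF Ot ix; rewrite mxdzE -(param_pd_space_pd d _ sF Ot (chart_in_image ix)).
by congr (mxpd d _ t); apply/funext => s; rewrite mxdzE.
Qed.

Lemma param_pd_dzbar d F i x t : smooth_family F -> O t -> chart_dom S i x ->
  mxpd d (fun s => mxdzbar i (F s i) x) t = mxdzbar i (param_pd d F t i) x.
Proof.
move=> sF Ot ix; rewrite mxdzbarE -(param_pd_space_pd d _ sF Ot (chart_in_image ix)).
by congr (mxpd d _ t); apply/funext => s; rewrite mxdzbarE.
Qed.

Lemma smooth_space_pd e F i p : smooth_family F -> chart_image (S := S) i p ->
  mxsmooth_on O (fun s => mxpd e (F s i \o chart_inv S i) p).
Proof.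
move=> sF pI; have [e1 e2] := param_slice p.
have -> : (fun s => mxpd e (F s i \o chart_inv S i) p) =
    mxpd (space_dir e) (joint F i) \o (fun s => (s, p)).
  by apply/funext => s; rewrite space_pd_joint.
exact: (mxsmooth_on_affine e1 e2 (mxsmooth_on_pd (space_dir e) (@family_open i) (sF i))
  (fun t (Ot : O t) => conj Ot pI)).
Qed.

Lemma smooth_family_dz F i x : smooth_family F -> chart_dom S i x ->
  mxsmooth_on O (fun s => mxdz i (F s i) x).
Proof.
move=> sF ix.
have -> : (fun s => mxdz i (F s i) x) =
    (fun s => mxpd dir_z (F s i \o chart_inv S i) (chart S i x)).
  by apply/funext => s; rewrite mxdzE.
exact: (smooth_space_pd dir_z sF (chart_in_image ix)).
Qed.

Lemma smooth_family_dzbar F i x : smooth_family F -> chart_dom S i x ->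
  mxsmooth_on O (fun s => mxdzbar i (F s i) x).
Proof.
move=> sF ix.
have -> : (fun s => mxdzbar i (F s i) x) =
    (fun s => mxpd dir_zbar (F s i \o chart_inv S i) (chart S i x)).
  by apply/funext => s; rewrite mxdzbarE.
exact: (smooth_space_pd dir_zbar sF (chart_in_image ix)).
Qed.

Lemma mxpd_affine_gauge d (c : R[i]) (G G' K : 'M[R[i]]_n) (k : T -> R[i])
    (F : T -> 'M[R[i]]_n) t : mxsmooth_on O F -> csmooth_on O k -> O t ->
  mxpd d (fun s => c *: (G *m F s *m G') - k s *: K) t =
  c *: (G *m mxpd d F t *m G') - pd d k t *: K.
Proof.
move=> sF sk Ot.
have sG : mxsmooth_on O (fun s => G *m F s) by exact: (mxsmooth_on_mul oO (mxsmooth_on_cst _ G) sF).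
have sGG : mxsmooth_on O (fun s => G *m F s *m G').
  exact: (mxsmooth_on_mul oO sG (mxsmooth_on_cst _ G')).
have sc : csmooth_on O (fun=> c) by exact: csmooth_on_cst.
have s1 := mxsmooth_on_scale oO sc sGG.
have s2 := mxsmooth_on_scale oO sk (mxsmooth_on_cst O K).
rewrite (mxpdB _ oO s1 s2 Ot) (mxpdZ _ sc sGG Ot) (mxpdZ _ sk (mxsmooth_on_cst O K) Ot).
rewrite pd_cst scale0r add0r mxpd_cst scaler0 addr0; congr (_ *: _ - _).
rewrite (mxpdM _ oO sG (mxsmooth_on_cst O G') Ot) (mxpdM _ oO (mxsmooth_on_cst O G) sF Ot).
by rewrite !mxpd_cst mul0mx mulmx0 add0r addr0.
Qed.

Lemma mxpd_bracket_add d (F F' G G' : T -> 'M[R[i]]_n) t :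
  mxsmooth_on O F -> mxsmooth_on O F' -> mxsmooth_on O G -> mxsmooth_on O G' -> O t ->
  mxpd d (fun s => mxbracket (F s) (F' s) + mxbracket (G s) (G' s)) t =
  mxbracket (mxpd d F t) (F' t) + mxbracket (F t) (mxpd d F' t)
  + (mxbracket (mxpd d G t) (G' t) + mxbracket (G t) (mxpd d G' t)).
Proof.
move=> sF sF' sG sG' Ot.
rewrite (mxpdD _ (mxsmooth_on_bracket oO sF sF') (mxsmooth_on_bracket oO sG sG') Ot).
by rewrite (mxpd_bracket _ oO sF sF' Ot) (mxpd_bracket _ oO sG sG' Ot).
Qed.

(** The shape F + k G - K + N is kept by differentiation once the derivative of [k] is constant,
    which allows the repeated use below. *)
Lemma derive_vanishing_sum d (k : T -> R[i]) (F G K N : T -> 'M[R[i]]_n) t :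
  csmooth_on O k -> mxsmooth_on O F -> mxsmooth_on O G -> mxsmooth_on O K -> mxsmooth_on O N ->
  (forall s, O s -> F s + k s *: G s - K s + N s = 0) -> O t ->
  mxpd d F t + (pd d k t *: G t + k t *: mxpd d G t) - mxpd d K t + mxpd d N t = 0.
Proof.
move=> sk sF sG sK sN h Ot.
have skG := mxsmooth_on_scale oO sk sG.
have sFG := mxsmooth_on_add oO sF skG.
have sFGK := mxsmooth_on_add oO sFG (mxsmooth_on_opp oO sK).
have e0 : {in O, (fun s => F s + k s *: G s - K s + N s) =1 (fun=> 0)}.
  by move=> s /set_mem; exact: h.
have := mxpd_eq_on d oO e0 (mem_set Ot); rewrite mxpd_cst => <-.
by rewrite (mxpdD _ sFGK sN Ot) (mxpdB _ oO sFG sK Ot) (mxpdD _ sF skG Ot) (mxpdZ _ sk sG Ot).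
Qed.

(* The lambda-coefficient of the curvature equation, differentiated twice along e. *)
Lemma curvature_second_variation (d e : cdirection (V := T)) (k : T -> R[i])
    (A B ZA ZB : T -> 'M[R[i]]_n) t :
  csmooth_on O k -> mxsmooth_on O A -> mxsmooth_on O B ->
  mxsmooth_on O ZA -> mxsmooth_on O ZB ->
  (forall s, O s -> k s *: ZA s - ZB s + mxbracket (B s) (A s) = 0) ->
  (forall s, O s -> pd d k s = 1) -> (forall s, O s -> pd e k s = 0) ->
  O t -> k t = 0 ->
  mxpd e (mxpd e ZA) t - mxpd e (mxpd e (mxpd d ZB)) t
  + ((mxbracket (mxpd e (mxpd e (mxpd d B)) t) (A t)
      + mxbracket (mxpd e (mxpd d B) t) (mxpd e A t)
      + (mxbracket (mxpd e (mxpd d B) t) (mxpd e A t)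
         + mxbracket (mxpd d B t) (mxpd e (mxpd e A) t)))
  + (mxbracket (mxpd e (mxpd e B) t) (mxpd d A t)
     + mxbracket (mxpd e B t) (mxpd e (mxpd d A) t)
     + (mxbracket (mxpd e B t) (mxpd e (mxpd d A) t)
        + mxbracket (B t) (mxpd e (mxpd e (mxpd d A)) t)))) = 0.
Proof.
move=> sk sA sB sZA sZB hG dk ek Ot kt.
have D f (F : T -> 'M[R[i]]_n) : mxsmooth_on O F -> mxsmooth_on O (mxpd f F).
  exact: mxsmooth_on_pd.
have br (F G : T -> 'M[R[i]]_n) : mxsmooth_on O F -> mxsmooth_on O G ->
    mxsmooth_on O (fun s => mxbracket (F s) (G s)) by exact: mxsmooth_on_bracket.
have add (F G : T -> 'M[R[i]]_n) : mxsmooth_on O F -> mxsmooth_on O G ->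
    mxsmooth_on O (fun s => F s + G s) by exact: mxsmooth_on_add.
have sZ1 := D d _ sZA; have sZB1 := D d _ sZB; have sB1 := D d _ sB; have sA1 := D d _ sA.
have sZ2 := D e _ sZ1; have sZB2 := D e _ sZB1; have sB2 := D e _ sB1; have sA2 := D e _ sA1.
have sZe := D e _ sZA; have sBe := D e _ sB; have sAe := D e _ sA.
have hG' s : O s -> 0 + k s *: ZA s - ZB s + mxbracket (B s) (A s) = 0.
  by move=> Os; rewrite add0r hG.
(* Along [d] the factor [k] has derivative 1, which frees a copy of [ZA] from its factor. *)
have step1 s : O s -> ZA s + k s *: mxpd d ZA s - mxpd d ZB s
    + (mxbracket (mxpd d B s) (A s) + mxbracket (B s) (mxpd d A s)) = 0.
  move=> Os.
  have := derive_vanishing_sum d sk (mxsmooth_on_cst O 0) sZA sZB (br _ _ sB sA) hG' Os.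
  by rewrite mxpd_cst add0r dk // scale1r (mxpd_bracket _ oO sB sA Os).
have sN1 := add _ _ (br _ _ sB1 sA) (br _ _ sB sA1).
have step2 s : O s -> mxpd e ZA s + k s *: mxpd e (mxpd d ZA) s - mxpd e (mxpd d ZB) s
    + ((mxbracket (mxpd e (mxpd d B) s) (A s) + mxbracket (mxpd d B s) (mxpd e A s))
       + (mxbracket (mxpd e B s) (mxpd d A s) + mxbracket (B s) (mxpd e (mxpd d A) s))) = 0.
  move=> Os; have := derive_vanishing_sum e sk sZA sZ1 sZB1 sN1 step1 Os.
  rewrite ek // scale0r add0r => h; apply: (etrans _ h); congr (_ + _).
  exact: esym (mxpd_bracket_add e sB1 sA sB sA1 Os).
have sN2 := add _ _ (add _ _ (br _ _ sB2 sA) (br _ _ sB1 sAe)) (add _ _ (br _ _ sBe sA1) (br _ _ sB sA2)).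
have := derive_vanishing_sum e sk sZe sZ2 sZB2 sN2 step2 Ot.
(* Since [k] vanishes at [t] and is constant along [e], only the second derivative of [ZA] along [e]
   survives among the terms in [ZA]. *)
rewrite ek // kt !scale0r !addr0 => h; apply: (etrans _ h); congr (_ + _); apply: esym.
apply: (etrans (mxpdD e (add _ _ (br _ _ sB2 sA) (br _ _ sB1 sAe))
  (add _ _ (br _ _ sBe sA1) (br _ _ sB sA2)) Ot)).
by congr (_ + _); [exact: (mxpd_bracket_add e sB2 sA sB1 sAe Ot)|
  exact: (mxpd_bracket_add e sBe sA1 sB sA2 Ot)].
Qed.

End parameter_families.

(** * The grading element and its weights *)

Section grading.
Context {R : realType} {n l : nat}.
Variables (p : 'I_l -> 'M[R[i]]_n) (m : R[i]).
Hypothesis p_sum : \sum_k p k = 1%:M.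
Hypothesis p_orth : forall a b, a != b -> p a *m p b = 0.
Hypothesis p_idem : forall a, p a *m p a = p a.

Definition weight (k : 'I_l) : R[i] := (l - k.+1)%N%:R - m.
Definition grading_elt : 'M[R[i]]_n := \sum_k weight k *: p k.

Lemma grading_eltl a : grading_elt *m p a = weight a *: p a.
Proof.
rewrite mulmx_suml (bigD1 a) //= -scalemxAl p_idem big1 ?addr0 // => b ba.
by rewrite -scalemxAl p_orth // scaler0.
Qed.

Lemma grading_eltr a : p a *m grading_elt = weight a *: p a.
Proof.
rewrite mulmx_sumr (bigD1 a) //= -scalemxAr p_idem big1 ?addr0 // => b ba.
by rewrite -scalemxAr p_orth 1?eq_sym // scaler0.
Qed.

(** Multiplying a block by the grading element gives the weight of its source on the right and that
    of its target on the left. *)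
Lemma bracket_block a b (M : 'M[R[i]]_n) :
  mxbracket (p b *m M *m p a) grading_elt = (weight a - weight b) *: (p b *m M *m p a).
Proof.
rewrite /mxbracket -[p b *m M *m p a *m _]mulmxA grading_eltr !mulmxA grading_eltl.
rewrite -!scalemxAl -scalemxAr; exact: esym (scalerBl _ _ _).
Qed.

Lemma bracket_suml (I : Type) (r : seq I) (P : pred I) (F : I -> 'M[R[i]]_n) (X : 'M[R[i]]_n) :
  mxbracket (\sum_(i <- r | P i) F i) X = \sum_(i <- r | P i) mxbracket (F i) X.
Proof. by rewrite /mxbracket mulmx_suml mulmx_sumr -sumrB. Qed.

Lemma weight_diff (a b : 'I_l) (j : nat) : (a : nat) = (b + j)%N -> weight a - weight b = - j%:R.
Proof.
move=> e; rewrite /weight.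
(* The subtractions are truncated; the bound [a < l] makes them exact. *)
have -> : (l - b.+1)%N = (l - a.+1 + j)%N by have := ltn_ord a; lia.
by rewrite natrD; ring.
Qed.

Lemma bracket_grade (j : nat) (M : 'M[R[i]]_n) :
  mxbracket (\sum_(a < l) \sum_(b < l | (a : nat) == (b + j)%N) p b *m M *m p a) grading_elt =
  - j%:R *: (\sum_(a < l) \sum_(b < l | (a : nat) == (b + j)%N) p b *m M *m p a).
Proof.
rewrite bracket_suml scaler_sumr; apply: eq_bigr => a _.
rewrite bracket_suml scaler_sumr; apply: eq_bigr => b /eqP ab.
by rewrite bracket_block (weight_diff ab).
Qed.

(** Only blocks from one summand to the next survive in [M], and the weight drops by exactly 1 along
    each of them. *)
Lemma bracket_raising (M : 'M[R[i]]_n) :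
  (forall a b : 'I_l, (b : nat) <> a.+1 -> p b *m M *m p a = 0) ->
  mxbracket M grading_elt = M.
Proof.
move=> hM.
have eM : M = \sum_(a < l) \sum_(b < l) p b *m M *m p a.
  rewrite -{1}[M]mulmx1 -p_sum mulmx_sumr; apply: eq_bigr => a _.
  by rewrite -{1}[M]mul1mx -p_sum !mulmx_suml.
rewrite {1}eM bracket_suml [RHS]eM; apply: eq_bigr => a _.
rewrite bracket_suml; apply: eq_bigr => b _; rewrite bracket_block.
have [ba|nba] := eqVneq (b : nat) a.+1; last by rewrite hM ?scaler0 //; exact/eqP.
have -> : weight a - weight b = 1.
  have e : weight b - weight a = - 1%:R by apply: weight_diff; rewrite ba addn1.
  by rewrite -opprB e opprK.
by rewrite scale1r.
Qed.

End grading.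

(** * Coefficients of pointwise convergent power series *)

Section power_series.
Context {R : realType}.

Lemma geometric_tail (x : R) (N : nat) : 0 <= x -> x <= 2^-1 ->
  \sum_(k < N) x ^+ (k.+2) <= 2 * x ^+ 2.
Proof.
move=> x0 x1; suff : \sum_(k < N) x ^+ (k.+2) + x ^+ N.+2 <= 2 * x ^+ 2.
  by apply: le_trans; rewrite lerDl exprn_ge0.
(* Doubling the extra power makes the bound inductive: for x <= 1/2, x^(N + 2) + 2 x^(N + 3) <= 2
   x^(N + 2). *)
suff : \sum_(k < N) x ^+ (k.+2) + 2 * x ^+ N.+2 <= 2 * x ^+ 2.
  by have := exprn_ge0 N.+2 x0; set y := x ^+ N.+2; set z := \sum_(k < N) _; move=> y0 h; lra.
elim: N => [|N IH]; first by rewrite big_ord0 add0r.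
rewrite big_ord_recr /=; apply: le_trans IH.
rewrite -addrA lerD2l (exprS x N.+2).
by have := exprn_ge0 N.+2 x0; set y := x ^+ N.+2; move=> y0; nra.
Qed.

(** Only pointwise convergence is given. At [s = r / 2] it bounds all terms s^k c_k, so for |h| <= s
    / 2 the remainder after the linear term is dominated by a geometric series and is quadratic in
    h. *)
Lemma real_power_series_derive (c : nat -> R) (f : R -> R) (r : R) : 0 < r ->
  (forall h, `|h| < r -> (fun N : nat => \sum_(k < N) h ^+ k * c k) @ \oo --> f h) ->
  is_derive (0 : R) (1 : R) f (c 1%N).
Proof.
move=> r0 hf.
pose s := r / 2.
have s0 : 0 < s by rewrite divr_gt0.
have sr : `|s| < r by rewrite gtr0_norm // /s; lra.
have f0 : f 0 = c 0%N.
  have h0 : `|(0 : R)| < r by rewrite normr0.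
  have l0 := hf 0 h0; apply: (cvg_unique _ l0) => //.
  apply: cvg_near_cst; exists 1%N => // -[//|N] _ /=.
  rewrite big_ord_recl big1 ?addr0 ?expr0 ?mul1r // => k _.
  by rewrite /= expr0n /= mul0r.
(* Each term is the difference of two consecutive partial sums, and the partial sums are bounded
   because they converge. *)
have [M M0 hM] : exists2 M : R, 0 <= M & forall k, `|s ^+ k * c k| <= M.
  have ls : cvgn (fun N : nat => \sum_(k < N) s ^+ k * c k).
    by apply/cvg_ex; exists (f s); exact: hf.
  have := cvg_seq_bounded ls => -[M [_ /(_ (`|M| + 1))]] hM.
  have {}hM N : `|\sum_(k < N) s ^+ k * c k| <= `|M| + 1.
    by apply: hM => //; rewrite ltr_pwDr // ler_norm.
  exists ((`|M| + 1) + (`|M| + 1)); first by rewrite !addr_ge0.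
  move=> k; have -> : s ^+ k * c k = \sum_(j < k.+1) s ^+ j * c j - \sum_(j < k) s ^+ j * c j.
    by rewrite big_ord_recr /= addrAC subrr add0r.
  by apply: le_trans (ler_normB _ _) _; apply: lerD.
have bound h : `|h| <= s / 2 -> `|f h - c 0%N - h * c 1%N| <= 2 * M / s ^+ 2 * `|h| ^+ 2.
  move=> hs; have hr : `|h| < r by rewrite (le_lt_trans hs) // /s; lra.
  have lh := hf h hr.
  have l2 : (fun N : nat => `|\sum_(k < N) h ^+ k * c k - c 0%N - h * c 1%N|) @ \oo
      --> `|f h - c 0%N - h * c 1%N|.
    by apply: cvg_norm; apply: cvgB; [apply: cvgB => //|]; exact: cvg_cst.
  apply: (cvgr_to_le l2).
  exists 2%N => // -[//|[//|N]] _ /=.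
  rewrite big_ord_recl big_ord_recl /= expr0 mul1r expr1.
  have -> : c 0%N + (h * c 1%N + \sum_(k < N) h ^+ (fintype.bump 0 (fintype.bump 0 k)) * c (fintype.bump 0 (fintype.bump 0 k)))
      - c 0%N - h * c 1%N = \sum_(k < N) h ^+ k.+2 * c k.+2.
    by rewrite [c 0%N + _]addrC addrK [h * c 1%N + _]addrC addrK.
  set x := `|h| / s.
  have x0 : 0 <= x by rewrite divr_ge0 // ltW.
  have x1 : x <= 2^-1 by rewrite ler_pdivrMr // mulrC.
  apply: le_trans (ler_norm_sum _ _ _) _.
  apply: (@le_trans _ _ (\sum_(k < N) M * x ^+ k.+2)).
    apply: ler_sum => k _.
    have -> : h ^+ k.+2 * c k.+2 = (h / s) ^+ k.+2 * (s ^+ k.+2 * c k.+2).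
      by rewrite mulrA -exprMn divfK ?gt_eqF.
    rewrite normrM normrX normrM normfV (gtr0_norm s0) mulrC.
    by apply: ler_pM => //; rewrite ?exprn_ge0.
  rewrite -mulr_sumr; apply: le_trans (ler_wpM2l M0 (geometric_tail N x0 x1)) _.
  by rewrite /x exprMn exprVn le_eqVlt; apply/orP; left; apply/eqP; ring.
pose C := 2 * M / s ^+ 2.
have C0 : 0 <= C by rewrite divr_ge0 ?mulr_ge0 ?exprn_ge0 // ltW.
suff l : h^-1 *: ((f \o shift 0) (h *: (1 : R)) - f 0) @[h --> 0^'] --> c 1%N.
  by split; [apply/cvg_ex; exists (c 1%N)|exact: cvg_lim l].
apply/cvgrPdist_le => e e0.
have C1 : 0 < C + 1 by rewrite ltr_wpDl.
near=> h.
have h0 : h != 0 by near: h; exact: nbhs_dnbhs_neq.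
have h1 : `|h| < e / (C + 1).
  by near: h; exact: (nbhs_dnbhs (near0_norm_lt (divr_gt0 e0 C1))).
have h2 : `|h| < s / 2.
  by near: h; apply: (nbhs_dnbhs (near0_norm_lt _)); exact: divr_gt0.
have nh0 : 0 < `|h| by rewrite normr_gt0.
rewrite /= addr0 /GRing.scale /= mulr1 f0 distrC.
have -> : h^-1 * (f h - c 0%N) - c 1%N = h^-1 * (f h - c 0%N - h * c 1%N).
  by rewrite [RHS]mulrBr mulrA mulVf // mul1r.
rewrite normrM normfV mulrC ler_pdivrMr //.
apply: le_trans (bound h (ltW h2)) _; rewrite -/C expr2 mulrA.
apply: ler_wpM2r => //; apply: (@le_trans _ _ ((C + 1) * `|h|)).
  by apply: ler_wpM2r => //; rewrite lerDl.
by rewrite mulrC -ler_pdivlMr // ltW.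
Unshelve. all: by end_near.
Qed.

Lemma power_series_derive (a : nat -> R[i]) (f : R -> R[i]) (r : R) : 0 < r ->
  (forall h, `|h| < r -> cseries_to (fun k => h%:C ^+ k * a k) (f h)) ->
  cderive (1 : R) f 0 = a 1%N.
Proof.
move=> r0 hf.
have e (h : R) k (z : R[i]) : cRe (h%:C ^+ k * z) = h ^+ k * cRe z /\
    cIm (h%:C ^+ k * z) = h ^+ k * cIm z.
  rewrite -(rmorphXn (real_complex R)) /=; case: z => x y /=.
  by rewrite !mul0r subr0 addr0.
have sr (N : nat) (F : 'I_N -> R[i]) : cRe (\sum_k F k) = \sum_k cRe (F k).
  by apply: (big_morph (@complex.Re R)) => // -[x1 y1] [x2 y2].
have si (N : nat) (F : 'I_N -> R[i]) : cIm (\sum_k F k) = \sum_k cIm (F k).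
  by apply: (big_morph (@complex.Im R)) => // -[x1 y1] [x2 y2].
have dr : is_derive (0 : R) (1 : R) (cRe \o f) (cRe (a 1%N)).
  apply: (@real_power_series_derive (fun k => cRe (a k)) _ r r0) => h hr.
  have [h1 _] := hf h hr; apply: cvg_trans h1; apply: near_eq_cvg.
  by near=> N; rewrite sr; apply: eq_bigr => k _; rewrite (e h k (a k)).1.
have di : is_derive (0 : R) (1 : R) (cIm \o f) (cIm (a 1%N)).
  apply: (@real_power_series_derive (fun k => cIm (a k)) _ r r0) => h hr.
  have [_ h1] := hf h hr; apply: cvg_trans h1; apply: near_eq_cvg.
  by near=> N; rewrite si; apply: eq_bigr => k _; rewrite (e h k (a k)).2.
rewrite /cderive; have [_ ->] := dr; have [_ ->] := di.
by case: (a 1%N).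
Unshelve. all: by end_near.
Qed.

Lemma power_series_at0 (a : nat -> R[i]) (v : R[i]) :
  cseries_to (fun k => 0 ^+ k * a k) v -> v = a 0%N.
Proof.
have e N : \sum_(k < N.+1) (0 : R[i]) ^+ k * a k = a 0%N.
  rewrite big_ord_recl big1 ?addr0 ?expr0 ?mul1r // => k _.
  by rewrite /= expr0n /= mul0r.
move=> [hr hi].
have er : cRe v = cRe (a 0%N).
  by apply: (cvg_unique _ hr) => //; apply: cvg_near_cst; exists 1%N => // -[//|N] _ /=; rewrite e.
have ei : cIm v = cIm (a 0%N).
  by apply: (cvg_unique _ hi) => //; apply: cvg_near_cst; exists 1%N => // -[//|N] _ /=; rewrite e.
by case: v er ei {hr hi} => x y /= -> ->; case: (a 0%N).
Qed.

End power_series.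

(** * The flatness equation paired with the grading element *)

Section trace_algebra.
Context {R : realType} {n : nat}.
Implicit Types (X P Q : 'M[R[i]]_n).

Lemma trace_bracketl X P Q : \tr (X *m mxbracket P Q) = - \tr (mxbracket P X *m Q).
Proof. by rewrite trace_bracket_swap bracketC mulNmx mxtraceN. Qed.

Lemma trace_bracketr X P Q : \tr (X *m mxbracket P Q) = \tr (mxbracket Q X *m P).
Proof. by rewrite bracketC mulmxN mxtraceN trace_bracketl opprK. Qed.

Lemma trace_pairing X a b c1 c2 c3 c4 c5 c6 c7 c8 :
  a - b + ((c1 + c2 + (c3 + c4)) + (c5 + c6 + (c7 + c8))) = 0 ->
  \tr (X *m a) - \tr (X *m b) + ((\tr (X *m c1) + \tr (X *m c2) + (\tr (X *m c3) + \tr (X *m c4)))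
    + (\tr (X *m c5) + \tr (X *m c6) + (\tr (X *m c7) + \tr (X *m c8)))) = 0.
Proof.
move=> /(congr1 (fun M => \tr (X *m M))).
by rewrite mulmx0 mxtrace0 !mulmxDr mulmxN !mxtraceD mxtraceN.
Qed.

(** [al] and [Phi] are the constant coefficients of the dbar- and D-parts, [Psi] and [b0] their
    linear ones. For [al], [Phi], [Psi], [b0] in this order, the first t-derivatives are [s0], [f0],
    [s1], [f1] and the second ones [a2], [Phi2], [Psi2], [b2]; [za] and [zb] stand for dz a2 and
    dzbar b2. After pairing with [X], cyclicity and the weights of [Phi] and [Psi] turn the brackets
    with [Psi2] and [Phi2] into the traces to be removed, while the brackets with [a2] and [b2]
    complete the derivatives of tr(X a2) and tr(X b2). *)
Lemma second_variation_algebra X al b0 a2 b2 Phi Psi Phi2 Psi2 f0 f1 s0 s1 za zb :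
  mxbracket Phi X = Phi -> mxbracket Psi X = - Psi ->
  za - zb
  + ((mxbracket b2 al + mxbracket f1 s0 + (mxbracket f1 s0 + mxbracket b0 a2))
  + (mxbracket Phi2 Psi + mxbracket f0 s1 + (mxbracket f0 s1 + mxbracket Phi Psi2))) = 0 ->
  \tr (Phi2 *m Psi) + \tr (f0 *m s1) + (\tr (f0 *m s1) + \tr (Phi *m Psi2)) =
  ((\tr (X *m za) - \tr (mxbracket b0 X *m a2)) - (\tr (X *m zb) - \tr (mxbracket al X *m b2)))
  + (- \tr (mxbracket f1 X *m s0) + \tr (f1 *m mxbracket s0 X)
     - \tr (mxbracket f0 X *m s1) + \tr (f0 *m mxbracket s1 X) + 2%:R * \tr (f0 *m s1)).
Proof.
move=> hPhi hPsi h.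
have e1 : \tr (X *m mxbracket Phi2 Psi) = - \tr (Phi2 *m Psi).
  by rewrite trace_bracketr hPsi mulNmx mxtraceN mxtrace_mulC.
have e2 : \tr (X *m mxbracket Phi Psi2) = - \tr (Phi *m Psi2).
  by rewrite trace_bracketl hPhi.
have e3 P Q : \tr (P *m mxbracket Q X) = \tr (X *m mxbracket P Q).
  by rewrite mxtrace_mulC -trace_bracketr.
have := trace_pairing X h; rewrite e1 e2.
rewrite (e3 f1 s0) (e3 f0 s1) -(trace_bracketl X f1 s0) -(trace_bracketl X f0 s1).
rewrite -(trace_bracketl X b0 a2) -(trace_bracketr X b2 al).
move: (\tr (X *m za)) (\tr (X *m zb)) (\tr (X *m mxbracket b2 al)) (\tr (X *m mxbracket b0 a2))
  (\tr (X *m mxbracket f1 s0)) (\tr (X *m mxbracket f0 s1)) (\tr (Phi2 *m Psi))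
  (\tr (Phi *m Psi2)) (\tr (f0 *m s1)) => u1 u2 u3 u4 u5 u6 u7 u8 u9 hu.
apply/eqP; rewrite -subr_eq0 -oppr_eq0 -[X in _ == X]hu; apply/eqP; ring.
Qed.

End trace_algebra.

Section gauge_families.
Context {R : realType} {S : surface R} {n : nat} {g : cocycle S n} {T : normedModType R}.
Hypothesis hS : riemann_surface S.
Hypothesis hg : SU_cocycle g.
Variable O : set T.
Hypothesis oO : open O.

(** The inhomogeneous term sees the parameter only through the scalar [k]. If [k] is constant, the
    derivative is a form; for D-parts [k] is lambda, and [pd d k] decides between a form and a
    connection. *)
Lemma param_pd_gauge d (F : T -> endo S n) (k : T -> R[i]) (J : atlas S -> atlas S -> S -> R[i])
    (K : cocycle S n) :
  smooth_family O F -> csmooth_on O k ->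
  (forall s, O s -> forall i j x, chart_dom S i x -> chart_dom S j x ->
     F s i x = J i j x *: (g i j x *m F s j x *m g j i x) - k s *: K i j x) ->
  forall s, O s -> forall i j x, chart_dom S i x -> chart_dom S j x ->
    param_pd d F s i x =
    J i j x *: (g i j x *m param_pd d F s j x *m g j i x) - pd d k s *: K i j x.
Proof.
move=> sF sk hF s Os i j x ix jx.
have e : {in O, (fun s => F s i x) =1
    (fun s => J i j x *: (g i j x *m F s j x *m g j i x) - k s *: K i j x)}.
  by move=> s' /set_mem Os'; exact: hF.
apply: (etrans (mxpd_eq_on d oO e (mem_set Os))).
exact: (mxpd_affine_gauge oO d (J i j x) (g i j x) (g j i x) (K i j x)
  (smooth_family_point hS sF jx) sk Os).
Qed.

Lemma param_pd_form01 d F : smooth_family O F -> (forall s, O s -> form01 g (F s)) ->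
  forall s, O s -> form01 g (param_pd d F s).
Proof.
move=> sF hF s Os; split.
  exact: (smooth_family_at (smooth_family_pd hS oO d sF) Os).
have h s' (Os' : O s') i j x (ix : chart_dom S i x) (jx : chart_dom S j x) :
    F s' i x = (jac i j x)^*%C *: (g i j x *m F s' j x *m g j i x) - 0 *: (0 : 'M[R[i]]_n).
  by have [_ e] := hF s' Os'; rewrite scaler0 subr0; exact: e.
move=> i j x ix jx.
have := @param_pd_gauge d F (fun=> 0) (fun i j x => (jac i j x)^*%C) (fun _ _ _ => 0) sF
  (csmooth_on_cst O 0) h s Os i j x ix jx.
by rewrite scaler0 subr0.
Qed.

Lemma param_pd_form10 d F : smooth_family O F -> (forall s, O s -> form10 g (F s)) ->
  forall s, O s -> form10 g (param_pd d F s).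
Proof.
move=> sF hF s Os; split.
  exact: (smooth_family_at (smooth_family_pd hS oO d sF) Os).
have h s' (Os' : O s') i j x (ix : chart_dom S i x) (jx : chart_dom S j x) :
    F s' i x = jac i j x *: (g i j x *m F s' j x *m g j i x) - 0 *: (0 : 'M[R[i]]_n).
  by have [_ e] := hF s' Os'; rewrite scaler0 subr0; exact: e.
move=> i j x ix jx.
have := @param_pd_gauge d F (fun=> 0) (fun i j x => jac i j x) (fun _ _ _ => 0) sF
  (csmooth_on_cst O 0) h s Os i j x ix jx.
by rewrite scaler0 subr0.
Qed.

Lemma param_pd_dbar d A : smooth_family O A -> (forall s, O s -> dbar_operator g (A s)) ->
  forall s, O s -> form01 g (param_pd d A s).
Proof.
move=> sA hA s Os; split.
  exact: (smooth_family_at (smooth_family_pd hS oO d sA) Os).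
have h s' (Os' : O s') i j x (ix : chart_dom S i x) (jx : chart_dom S j x) :
    A s' i x = (jac i j x)^*%C *: (g i j x *m A s' j x *m g j i x)
      - 1 *: (mxdzbar i (g i j) x *m g j i x).
  by have [_ e] := hA s' Os'; rewrite scale1r; exact: e.
move=> i j x ix jx.
have := @param_pd_gauge d A (fun=> 1) (fun i j x => (jac i j x)^*%C)
  (fun i j x => mxdzbar i (g i j) x *m g j i x) sA (csmooth_on_cst O 1) h s Os i j x ix jx.
by rewrite pd_cst scale0r subr0.
Qed.

Lemma param_pd_lam d B (k : T -> R[i]) : smooth_family O B -> csmooth_on O k ->
  (forall s, O s -> lam_operator g (k s) (B s)) ->
  forall s, O s -> lam_operator g (pd d k s) (param_pd d B s).
Proof.
move=> sB sk hB s Os; split.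
  exact: (smooth_family_at (smooth_family_pd hS oO d sB) Os).
move=> i j x ix jx.
apply: (@param_pd_gauge d B k (fun i j x => jac i j x)
  (fun i j x => mxdz i (g i j) x *m g j i x) sB sk _ s Os i j x ix jx).
by move=> s' Os'; have [_ e] := hB s' Os'; exact: e.
Qed.

Lemma lam0_form10 (b : endo S n) : lam_operator g 0 b -> form10 g b.
Proof. by case=> sb hb; split=> // i j x ix jx; rewrite (hb i j) // scale0r subr0. Qed.

Lemma form01_trace (X a : endo S n) i j x : endomorphism g X -> form01 g a ->
  chart_dom S i x -> chart_dom S j x ->
  \tr (X i x *m a i x) = (jac i j x)^*%C * \tr (X j x *m a j x).
Proof.
move=> [_ tX] [_ ta] ix jx; rewrite (tX i j) // (ta i j) // -scalemxAr mxtraceZ.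
by rewrite conj_mul ?conj_trace // (cocycle_inv hg).
Qed.

Lemma form10_trace (X a : endo S n) i j x : endomorphism g X -> form10 g a ->
  chart_dom S i x -> chart_dom S j x ->
  \tr (X i x *m a i x) = jac i j x * \tr (X j x *m a j x).
Proof.
move=> [_ tX] [_ ta] ix jx; rewrite (tX i j) // (ta i j) // -scalemxAr mxtraceZ.
by rewrite conj_mul ?conj_trace // (cocycle_inv hg).
Qed.

Lemma trace_smooth (X a : endo S n) i : chart_smooth X -> chart_smooth a ->
  csmooth_on (chart_image (S := S) i) ((fun x => \tr (X i x *m a i x)) \o chart_inv S i).
Proof.
move=> sX sa; have oI := @chart_image_open _ _ hS i.
exact: (csmooth_on_trace oI (mxsmooth_on_mul oI (sX i) (sa i))).
Qed.

(** [c] is meant to be the bracket of a connection coefficient with a parallel [X], so that the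
    derivative of [X] is eliminated in favour of an algebraic term. *)
Lemma dz_trace (X a : endo S n) (c : 'M[R[i]]_n) i x : chart_smooth X -> chart_smooth a ->
  chart_dom S i x -> mxdz i (X i) x = - c ->
  dz i (fun y => \tr (X i y *m a i y)) x = \tr (X i x *m mxdz i (a i) x) - \tr (c *m a i x).
Proof.
move=> sX sa ix eX; have oI := @chart_image_open _ _ hS i.
have pI := chart_in_image ix.
rewrite dzE; apply: (etrans (pd_trace _ oI (mxsmooth_on_mul oI (sX i) (sa i)) pI)).
rewrite (mxpdM _ oI (sX i) (sa i) pI) /= (chartK hS ix) -!mxdzE eX.
by rewrite mxtraceD mulNmx mxtraceN addrC.
Qed.

Lemma dzbar_trace (X a : endo S n) (c : 'M[R[i]]_n) i x : chart_smooth X -> chart_smooth a ->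
  chart_dom S i x -> mxdzbar i (X i) x = - c ->
  dzbar i (fun y => \tr (X i y *m a i y)) x = \tr (X i x *m mxdzbar i (a i) x) - \tr (c *m a i x).
Proof.
move=> sX sa ix eX; have oI := @chart_image_open _ _ hS i.
have pI := chart_in_image ix.
rewrite dzbarE; apply: (etrans (pd_trace _ oI (mxsmooth_on_mul oI (sX i) (sa i)) pI)).
rewrite (mxpdM _ oI (sX i) (sa i) pI) /= (chartK hS ix) -!mxdzbarE eX.
by rewrite mxtraceD mulNmx mxtraceN addrC.
Qed.

End gauge_families.

Section second_variation_integral.
Context {R : realType} {S : surface R} {n : nat} {g : cocycle S n} {T : normedModType R}.
Hypothesis hS : riemann_surface S.
Hypothesis hg : SU_cocycle g.
Hypothesis cS : compact [set: S].
Variable I : (atlas S -> S -> R[i]) -> R[i].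
Hypothesis hI : is_integration (S := S) I.
Variables (O : set T) (k : T -> R[i]) (A B : T -> endo S n) (X : endo S n) (s0 : T).
Variables (dQ dT : cdirection (V := T)).
Hypothesis oO : open O.
Hypotheses (sA : smooth_family O A) (sB : smooth_family O B) (sk : csmooth_on O k).
Hypothesis conn : forall s, O s -> lambda_connection g (LConn (k s) (A s) (B s)).
Hypothesis kQ : forall s, O s -> pd dQ k s = 1.
Hypothesis kT : forall s, O s -> pd dT k s = 0.
Hypotheses (Os0 : O s0) (ks0 : k s0 = 0).
Hypothesis eX : endomorphism g X.

Lemma dT_form10 s : O s -> form10 g (param_pd dT B s).
Proof.
move=> Os; apply: lam0_form10; rewrite -(kT Os).
by apply: (param_pd_lam hS oO _ sB sk) Os => s' /conn[].
Qed.

Lemma dQ_lam s : O s -> lam_operator g 1 (param_pd dQ B s).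
Proof.
move=> Os; rewrite -(kQ Os).
by apply: (param_pd_lam hS oO _ sB sk) Os => s' /conn[].
Qed.

Lemma dTdQ_form10 s : O s -> form10 g (param_pd dT (param_pd dQ B) s).
Proof.
move=> Os; apply: lam0_form10.
have e : pd dT (fun=> (1 : R[i])) s = 0 by exact: pd_cst.
rewrite -e; exact: (param_pd_lam hS oO dT (smooth_family_pd hS oO dQ sB)
  (csmooth_on_cst O 1) dQ_lam Os).
Qed.

Lemma A_form01 d s : O s -> form01 g (param_pd d A s).
Proof. by move=> Os; apply: (param_pd_dbar hS oO _ sA) Os => s' /conn[]. Qed.

(** The asserted integrand with the (1,0)-factor always first; the minus signs come from dzbar /\ dz
    = - dz /\ dzbar. *)
Definition variation_density : atlas S -> S -> R[i] := fun i x =>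
  let f0 := param_pd dT B s0 i x in let f1 := param_pd dT (param_pd dQ B) s0 i x in
  let p0 := param_pd dT A s0 i x in let p1 := param_pd dT (param_pd dQ A) s0 i x in
  - \tr (mxbracket f1 (X i x) *m p0) + \tr (f1 *m mxbracket p0 (X i x))
  - \tr (mxbracket f0 (X i x) *m p1) + \tr (f0 *m mxbracket p1 (X i x)) + 2%:R * \tr (f0 *m p1).

(** The second [dT]-derivative of the trace of [B] times the [dQ]-derivative of [A], with its mixed
    term written twice. *)
Definition energy_density2 : atlas S -> S -> R[i] := fun i x =>
  \tr (param_pd dT (param_pd dT B) s0 i x *m param_pd dQ A s0 i x)
  + \tr (param_pd dT B s0 i x *m param_pd dT (param_pd dQ A) s0 i x)
  + (\tr (param_pd dT B s0 i x *m param_pd dT (param_pd dQ A) s0 i x)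
     + \tr (B s0 i x *m param_pd dT (param_pd dT (param_pd dQ A)) s0 i x)).

Lemma variation_density_two_form : two_form variation_density.
Proof.
have f0 := dT_form10 Os0; have f1 := dTdQ_form10 Os0.
have p0 := A_form01 dT Os0.
have p1 : form01 g (param_pd dT (param_pd dQ A) s0).
  exact: (param_pd_form01 hS oO dT (smooth_family_pd hS oO dQ sA) (A_form01 dQ) Os0).
have t1 := two_form_trace hS hg (bracket_form10 hS hg f1 eX) p0.
have t2 := two_form_trace hS hg f1 (bracket_form01 hS hg p0 eX).
have t3 := two_form_trace hS hg (bracket_form10 hS hg f0 eX) p1.
have t4 := two_form_trace hS hg f0 (bracket_form01 hS hg p1 eX).
have t5 := two_form_trace hS hg f0 p1.
have := two_formD hS (two_formD hS (two_formD hS (two_formD hS (two_formZ hS (-1) t1) t2)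
  (two_formZ hS (-1) t3)) t4) (two_formZ hS 2%:R t5).
congr two_form; apply/funext => i; apply/funext => x.
by rewrite !mulN1r.
Qed.

Lemma B_form10 : form10 g (B s0).
Proof. by apply: lam0_form10; rewrite -ks0; have [_ ] := conn Os0. Qed.

Lemma energy_density2_two_form : two_form energy_density2.
Proof.
have f0 := dT_form10 Os0.
have f2 := param_pd_form10 hS oO dT (smooth_family_pd hS oO dT sB) dT_form10 Os0.
have sQA := smooth_family_pd hS oO dQ sA.
have p := A_form01 dQ Os0.
have p1 := param_pd_form01 hS oO dT sQA (A_form01 dQ).
have p2 := param_pd_form01 hS oO dT (smooth_family_pd hS oO dT sQA) p1 Os0.
have t0 := two_form_trace hS hg f0 (p1 s0 Os0).
exact: (two_formD hS (two_formD hS (two_form_trace hS hg f2 p) t0)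
  (two_formD hS t0 (two_form_trace hS hg B_form10 p2))).
Qed.

Hypothesis PhiX : forall i x, chart_dom S i x -> mxbracket (B s0 i x) (X i x) = B s0 i x.
Hypothesis PsiX : forall i x, chart_dom S i x ->
  mxbracket (param_pd dQ A s0 i x) (X i x) = - param_pd dQ A s0 i x.
Hypothesis holX : forall i x, chart_dom S i x -> dbar_end (A s0) X i x = 0.
Hypothesis parX : forall i x, chart_dom S i x -> lam_end 1 (param_pd dQ B s0) X i x = 0.

Lemma energy_density2_exact i x : chart_dom S i x ->
  energy_density2 i x =
  (dz i (fun y => \tr (X i y *m param_pd dT (param_pd dT A) s0 i y)) x
   - dzbar i (fun y => \tr (X i y *m param_pd dT (param_pd dT (param_pd dQ B)) s0 i y)) x)
  + variation_density i x.
Proof.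
move=> ix; have [sX _] := eX.
have sTA := smooth_family_pd hS oO dT sA; have sTTA := smooth_family_pd hS oO dT sTA.
have sQB := smooth_family_pd hS oO dQ sB; have sTQB := smooth_family_pd hS oO dT sQB.
have sTTQB := smooth_family_pd hS oO dT sTQB.
have eXb : mxdzbar i (X i) x = - mxbracket (A s0 i x) (X i x).
  by apply/eqP; rewrite -addr_eq0; apply/eqP; exact: holX.
have eXd : mxdz i (X i) x = - mxbracket (param_pd dQ B s0 i x) (X i x).
  by apply/eqP; rewrite -addr_eq0 -[mxdz _ _ _]scale1r; apply/eqP; exact: parX.
rewrite (dz_trace hS sX (smooth_family_at sTTA Os0) ix eXd).
rewrite (dzbar_trace hS sX (smooth_family_at sTTQB Os0) ix eXb).
(* What remains is the differentiated curvature equation, once the parameter derivatives of [ZA] and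
   [ZB] have been moved inside dz and dzbar. *)
apply: second_variation_algebra (PhiX ix) (PsiX ix) _.
pose ZA s := mxdz i (A s i) x; pose ZB s := mxdzbar i (B s i) x.
have cv s : O s -> k s *: ZA s - ZB s + mxbracket (B s i x) (A s i x) = 0.
  by move=> Os; have [_ _ _ _ c0] := conn Os; exact: c0 ix.
have main := curvature_second_variation oO sk (smooth_family_point hS sA ix)
  (smooth_family_point hS sB ix) (smooth_family_dz hS oO sA ix) (smooth_family_dzbar hS oO sB ix)
  cv kQ kT Os0 ks0.
have eZA : mxpd dT (mxpd dT ZA) s0 = mxdz i (param_pd dT (param_pd dT A) s0 i) x.
  rewrite -(param_pd_dz hS oO dT sTA Os0 ix).
  have e : {in O, mxpd dT ZA =1 (fun s => mxdz i (param_pd dT A s i) x)}.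
    by move=> s /set_mem Os; exact: (param_pd_dz hS oO dT sA Os ix).
  exact: (mxpd_eq_on dT oO e (mem_set Os0)).
have eZB : mxpd dT (mxpd dT (mxpd dQ ZB)) s0 =
    mxdzbar i (param_pd dT (param_pd dT (param_pd dQ B)) s0 i) x.
  rewrite -(param_pd_dzbar hS oO dT sTQB Os0 ix).
  have e1 : {in O, mxpd dQ ZB =1 (fun s => mxdzbar i (param_pd dQ B s i) x)}.
    by move=> s /set_mem Os; exact: (param_pd_dzbar hS oO dQ sB Os ix).
  have e2 : {in O, mxpd dT (mxpd dQ ZB) =1 (fun s => mxdzbar i (param_pd dT (param_pd dQ B) s i) x)}.
    move=> s Os; rewrite (mxpd_eq_on dT oO e1 Os).
    exact: (param_pd_dzbar hS oO dT sQB (set_mem Os) ix).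
  exact: (mxpd_eq_on dT oO e2 (mem_set Os0)).
by rewrite -eZA -eZB; exact: main.
Qed.

Lemma energy_density2_integral : I energy_density2 = I variation_density.
Proof.
have tE := energy_density2_two_form; have tV := variation_density_two_form.
pose t01 : atlas S -> S -> R[i] := fun i x => \tr (X i x *m param_pd dT (param_pd dT A) s0 i x).
pose t10 : atlas S -> S -> R[i] :=
  fun i x => \tr (X i x *m param_pd dT (param_pd dT (param_pd dQ B)) s0 i x).
have fA : form01 g (param_pd dT (param_pd dT A) s0).
  exact: (param_pd_form01 hS oO dT (smooth_family_pd hS oO dT sA) (A_form01 dT) Os0).
have sQB := smooth_family_pd hS oO dQ sB.
have fB : form10 g (param_pd dT (param_pd dT (param_pd dQ B)) s0).
  exact: (param_pd_form10 hS oO dT (smooth_family_pd hS oO dT sQB) dTdQ_form10 Os0).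
pose w : atlas S -> S -> R[i] := fun i x => energy_density2 i x + -1 * variation_density i x.
have tw : two_form w by exact: (two_formD hS tE (two_formZ hS (-1) tV)).
have Iw : I w = 0.
  apply: (surface_stokes hS cS hI (t10 := t10) (t01 := t01)) => //.
  - by move=> i; apply: (trace_smooth hS i) => //; [case: eX|case: fB].
  - by move=> i; apply: (trace_smooth hS i) => //; [case: eX|case: fA].
  - by move=> i j x ix jx; exact: (form10_trace hg eX fB ix jx).
  - by move=> i j x ix jx; exact: (form01_trace hg eX fA ix jx).
  - by move=> i x ix; rewrite /w energy_density2_exact // mulN1r addrK.
have <- : I (fun i x => w i x + variation_density i x) = I energy_density2.
  by apply: (integration_eq hI) => i x ix; rewrite /w mulN1r subrK.
by rewrite (integrationD hI tw tV) Iw add0r.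
Qed.

End second_variation_integral.

(** * The second variation of the energy *)

Section parameter_space.
Context {R : realType}.
Local Notation T := (R * (R * R))%type.

Definition dir_t : cdirection (V := T) := real_direction ((1, 0) : T).
(** The real axis suffices: lifts are holomorphic in lambda, so the derivative along it is the
    complex one. *)
Definition dir_lam : cdirection (V := T) := real_direction ((0, (1, 0)) : T).

Lemma disc_open (r : R) : open (disc r).
Proof.
have o := @openT (R * R)%type.
have s1 := smooth_on_mul o (@smooth_on_fst _ setT) (@smooth_on_fst _ setT).
have s2 := smooth_on_mul o (@smooth_on_snd _ setT) (@smooth_on_snd _ setT).
have c := smooth_on_continuous (smooth_on_add o s1 s2).
have -> : disc r = (fun q : R * R => q.1 * q.1 + q.2 * q.2) @^-1` [set y | y < r ^+ 2].
  by apply/funext => q; rewrite /disc /= -!expr2.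
by apply: open_comp; [move=> q _; exact: c|exact: open_lt].
Qed.

Lemma domain_open (eps r : R) : open (time_set eps `*` disc r).
Proof. by apply: openX; [exact: time_set_open|exact: disc_open]. Qed.

Lemma disc0 (r : R) : 0 < r -> disc r (0, 0).
Proof. by move=> r0; rewrite /disc /= expr0n addr0 exprn_gt0. Qed.

Lemma disc_real (r h : R) : time_set r h -> disc r (h, 0).
Proof.
move=> hr; rewrite /disc /= expr0n addr0 -[h ^+ 2]real_normK ?num_real //.
by rewrite ltrXn2r // (le_lt_trans _ hr).
Qed.

Lemma csmooth_lam (U : set T) : csmooth_on U (fun s => to_complex s.2).
Proof.
have e1 h (u y : T) : (h *: u + y).2 = h *: u.2 + y.2 by [].
have e2 : continuous (fun s : T => s.2) by move=> s; exact: cvg_snd.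
have s : csmooth_on [set: R * R] (@to_complex R).
  by split; [exact: smooth_on_fst|exact: smooth_on_snd].
exact: (csmooth_on_affine e1 e2 s).
Qed.

Lemma cderive_lam (v s : T) : cderive v (fun s : T => to_complex s.2) s = to_complex v.2.
Proof.
have d1 := (@derive_affine _ T R (fun s : T => s.2.1) (fun s : T => s.2.1) id s v (fun _ _ _ => erefl)).1.
have d2 := (@derive_affine _ T R (fun s : T => s.2.2) (fun s : T => s.2.2) id s v (fun _ _ _ => erefl)).1.
rewrite /cderive /to_complex; congr (_ +i* _).
  by apply: (etrans d1); rewrite derive_id.
by apply: (etrans d2); rewrite derive_id.
Qed.

Lemma pd_lam_lam s : pd dir_lam (fun s : T => to_complex s.2) s = 1.
Proof. by rewrite pd_real cderive_lam. Qed.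

Lemma pd_t_lam s : pd dir_t (fun s : T => to_complex s.2) s = 0.
Proof. by rewrite pd_real cderive_lam. Qed.

Lemma mxpd_t_slice {n} (F : T -> 'M[R[i]]_n) (t : R) (q : R * R) :
  mxpd (real_direction (1 : R)) (fun t => F (t, q)) t = mxpd dir_t F (t, q).
Proof. by have [e1 _] := slice_time q; exact: (mxpd_affine F (real_direction (1 : R)) t e1). Qed.

Lemma mxpd_lam_slice {n} (F : T -> 'M[R[i]]_n) (t h : R) :
  mxpd (real_direction (1 : R)) (fun h => F (t, (h, 0))) h = mxpd dir_lam F (t, (h, 0)).
Proof.
have e1 c (u y : R) : (t, (c *: u + y, 0)) = c *: ((0, (u, 0)) : T) + (t, (y, 0)).
  by rewrite -[RHS]/(c * 0 + t, (c * u + y, c * 0 + 0)) !mulr0 !add0r.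
exact: (mxpd_affine F (real_direction (1 : R)) h e1).
Qed.

End parameter_space.

Section trace_density.
Context {R : realType} {S : surface R} {n : nat}.
Hypothesis hS : riemann_surface S.
Variables (eps r : R).
Hypothesis r0 : 0 < r.
Local Notation T := (R * (R * R))%type.
Local Notation O := (time_set eps `*` disc r).

Let oO : open O := @domain_open R eps r.

Definition trace_density (F G : T -> endo S n) (t : R) : atlas S -> S -> R[i] :=
  fun i x => \tr (F (t, (0, 0)) i x *m G (t, (0, 0)) i x).

Let O0 t : time_set eps t -> O (t, (0, 0)).
Proof. by move=> ht; split => //=; exact: disc0. Qed.

Lemma trace_density_joint (F G : T -> endo S n) : smooth_family O F -> smooth_family O G ->
  joint_smooth (S := S) eps (trace_density F G).
Proof.
move=> sF sG i.
pose e (q : R * (R * R)) : T * (R * R) := ((q.1, (0, 0)), q.2).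
have e1 c u y : e (c *: u + y) = c *: e u + e y.
  rewrite -[RHS]/((c * u.1 + y.1, (c * 0 + 0, c * 0 + 0)), c *: u.2 + y.2).
  by rewrite mulr0 addr0.
have e2 : continuous e.
  move=> q.
  have c1 : (fun q : R * (R * R) => q.1) y @[y --> q] --> q.1 by exact: cvg_fst.
  have c2 : (fun q : R * (R * R) => q.2) y @[y --> q] --> q.2 by exact: cvg_snd.
  have c0 : (fun _ : R * (R * R) => (0, 0) : R * R) y @[y --> q] --> ((0, 0) : R * R).
    exact: cvg_cst.
  exact: (cvg_pair (cvg_pair c1 c0) c2).
have h q : (time_set eps `*` chart_image (S := S) i) q -> (O `*` chart_image (S := S) i) (e q).
  by case=> q1 q2; split => //; exact: O0.
have oT := @time_chart_open _ _ hS eps i.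
exact: (csmooth_on_trace oT (mxsmooth_on_mul oT (mxsmooth_on_affine e1 e2 (sF i) h)
  (mxsmooth_on_affine e1 e2 (sG i) h))).
Qed.

Lemma trace_density_tderive (F G : T -> endo S n) t i x :
  smooth_family O F -> smooth_family O G -> time_set eps t -> chart_dom S i x ->
  tderive (fun s => trace_density F G s i x) t =
  trace_density (param_pd dir_t F) G t i x + trace_density F (param_pd dir_t G) t i x.
Proof.
move=> sF sG ht ix.
have [e1 _] := @slice_time R (R * R)%type (0, 0).
have fF := smooth_family_point hS sF ix; have fG := smooth_family_point hS sG ix.
apply: (etrans (pd_affine (fun s => \tr (F s i x *m G s i x)) (real_direction (1 : R)) t e1)).
apply: (etrans (pd_trace dir_t oO (mxsmooth_on_mul oO fF fG) (O0 ht))).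
by rewrite (mxpdM dir_t oO fF fG (O0 ht)) mxtraceD.
Qed.

Lemma trace_density_tderive2 (F G : T -> endo S n) t i x :
  smooth_family O F -> smooth_family O G -> time_set eps t -> chart_dom S i x ->
  tderive (fun s => tderive (fun s' => trace_density F G s' i x) s) t =
  trace_density (param_pd dir_t (param_pd dir_t F)) G t i x
  + trace_density (param_pd dir_t F) (param_pd dir_t G) t i x
  + (trace_density (param_pd dir_t F) (param_pd dir_t G) t i x
     + trace_density F (param_pd dir_t (param_pd dir_t G)) t i x).
Proof.
move=> sF sG ht ix.
have sF1 := smooth_family_pd hS oO dir_t sF; have sG1 := smooth_family_pd hS oO dir_t sG.
have e : {in time_set eps, (fun s => tderive (fun s' => trace_density F G s' i x) s) =1
    (fun s => trace_density (param_pd dir_t F) G s i x + trace_density F (param_pd dir_t G) s i x)}.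
  by move=> s /set_mem hs; exact: trace_density_tderive.
have oT := @time_set_open R eps.
have sm (P Q : T -> endo S n) : smooth_family O P -> smooth_family O Q ->
    csmooth_on (time_set eps) (fun s => trace_density P Q s i x).
  move=> sP sQ; have [e1 e2] := slice_time (chart S i x).
  have := csmooth_on_affine e1 e2 (trace_density_joint sP sQ i)
    (fun s (hs : time_set eps s) => conj hs (chart_in_image ix)).
  by congr (csmooth_on _ _); apply/funext => s; rewrite /= (chartK hS ix).
rewrite -(trace_density_tderive sF1 sG ht ix) -(trace_density_tderive sF sG1 ht ix).
apply: (etrans (pd_eq_on (real_direction (1 : R)) oT e (mem_set ht))).
exact: (pdD (real_direction (1 : R)) (sm _ _ sF1 sG) (sm _ _ sF sG1) ht).
Qed.

End trace_density.

Section lifts.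
Context {R : realType} {S : surface R} {n : nat} {g : cocycle S n}.
Hypothesis hS : riemann_surface S.
Local Notation T := (R * (R * R))%type.

Definition lift_dbar (lt : R -> R[i] -> lconn_on S n) (s : T) : endo S n :=
  dbar (lt s.1 (to_complex s.2)).
Definition lift_D (lt : R -> R[i] -> lconn_on S n) (s : T) : endo S n :=
  Dop (lt s.1 (to_complex s.2)).

Lemma reassociate_smooth (eps r : R) i (F : T -> endo S n) :
  mxsmooth_on ([set t : R | `|t| < eps] `*` (disc r `*` chart_image (S := S) i))
    (fun w : R * ((R * R) * (R * R)) => F (w.1, w.2.1) i (chart_inv S i w.2.2)) ->
  mxsmooth_on ((time_set eps `*` disc r) `*` chart_image (S := S) i) (joint F i).
Proof.
move=> sF.
pose e (w : T * (R * R)) : R * ((R * R) * (R * R)) := (w.1.1, (w.1.2, w.2)).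
have e1 c u y : e (c *: u + y) = c *: e u + e y by [].
have e2 : continuous e.
  move=> w.
  have c : (fun w : T * (R * R) => w.1) y @[y --> w] --> w.1 by exact: cvg_fst.
  have c1 : (fun s : T => s.1) y @[y --> w.1] --> w.1.1 by exact: cvg_fst.
  have c2 : (fun s : T => s.2) y @[y --> w.1] --> w.1.2 by exact: cvg_snd.
  apply: (@cvg_pair _ _ _ _ (nbhs w.1.1) (nbhs (w.1.2, w.2))); first exact: (cvg_comp _ _ c c1).
  apply: (@cvg_pair _ _ _ _ (nbhs w.1.2) (nbhs w.2)); last exact: cvg_snd.
  exact: (cvg_comp _ _ c c2).
have h w : ((time_set eps `*` disc r) `*` chart_image (S := S) i) w ->
    ([set t : R | `|t| < eps] `*` (disc r `*` chart_image (S := S) i)) (e w).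
  by case=> -[].
have := mxsmooth_on_affine e1 e2 sF h.
by congr (mxsmooth_on _ _); apply/funext => -[[t q] p].
Qed.

(** By the Cauchy-Riemann equation at lambda = 0, the y-derivative is i times the x-derivative, so
    the Wirtinger derivative equals the derivative along the real axis. *)
Lemma lift_PsiE (lt : R -> R[i] -> lconn_on S n) t i x :
  (forall a b, wirtinger_bar (fun q => dbar (lt t (to_complex q)) i x a b) (0, 0) = 0) ->
  lift_Psi (lt t) i x = param_pd dir_lam (lift_dbar lt) (t, (0, 0)) i x.
Proof.
move=> hol; apply/matrixP => a b; rewrite mxE.
pose f (q : R * R) := dbar (lt t (to_complex q)) i x a b.
have eY : 'i%C * cderive ((0, 1) : R * R) f (0, 0) = - cderive ((1, 0) : R * R) f (0, 0).
  have /eqP := hol a b; rewrite /wirtinger_bar -/f mulf_eq0 invr_eq0 pnatr_eq0 orbF.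
  by rewrite addrC addr_eq0 => /eqP.
have -> : wirtinger f (0, 0) = cderive ((1, 0) : R * R) f (0, 0).
  by rewrite /wirtinger eY opprK -mulr2n -[_ *+ 2]mulr_natr mulfK // pnatr_eq0.
rewrite -pd_real.
have [e1 _] := slice_space (R * R)%type t.
pose F (s : T) := lift_dbar lt s i x a b.
have := pd_affine F (real_direction ((1, 0) : R * R)) (0, 0) e1.
by rewrite /param_pd mxE.
Qed.

End lifts.

Section lambda_polynomials.
Context {R : realType} {n : nat}.
Local Notation T := (R * (R * R))%type.
Local Notation dR := (real_direction (1 : R)).

Let line (c u y : R) :
  (0, (c *: u + y, 0)) = c *: ((0, (u, 0)) : T) + (0, (y, 0)).
Proof. by rewrite -[RHS]/(c * 0 + 0, (c * u + y, c * 0 + 0)) !mulr0 !addr0. Qed.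

Lemma csmooth_real_line (U : set R) : csmooth_on U (fun h : R => h%:C).
Proof.
have c : continuous (fun h : R => (0, (h, 0)) : T).
  move=> h; apply: (@cvg_pair _ _ _ _ (nbhs 0) (nbhs (h, 0))); first exact: cvg_cst.
  by apply: (@cvg_pair _ _ _ _ (nbhs h) (nbhs 0)); [exact: cvg_id|exact: cvg_cst].
exact: (@csmooth_on_affine _ _ _ (fun h : R => (0, (h, 0)) : T) (fun h : R => (0, (h, 0)) : T)
  setT (fun s : T => to_complex s.2) U line c (@csmooth_lam _ setT)).
Qed.

Lemma pd_real_line (h : R) : pd dR (fun h : R => h%:C) h = 1.
Proof.
rewrite -(@pd_lam_lam R (0, (h, 0))).
exact: (@pd_affine _ _ _ (fun h : R => (0, (h, 0)) : T) (fun h : R => (0, (h, 0)) : T)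
  (fun s : T => to_complex s.2) dR h line).
Qed.

Lemma csmooth_power (U : set R) k : open U -> csmooth_on U (fun h : R => h%:C ^+ k).
Proof.
move=> oU; elim: k => [|k IH]; first exact: csmooth_on_cst.
have := csmooth_on_mul oU (@csmooth_real_line U) IH.
by congr (csmooth_on _ _); apply/funext => h; rewrite exprS.
Qed.

Lemma pd_power k : pd dR (fun h : R => h%:C ^+ k) 0 = (k == 1)%:R.
Proof.
case: k => [|[|k]]; first exact: pd_cst.
  by rewrite -[RHS](pd_real_line 0).
have -> : (fun h : R => h%:C ^+ k.+2) = (fun h : R => h%:C * h%:C ^+ k.+1).
  by apply/funext => h; rewrite exprS.
have o := @openT R.
apply: (etrans (@pdM _ _ setT _ _ dR 0 (@csmooth_real_line setT) (@csmooth_power setT k.+1 o) I)).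
by rewrite exprS -[0%:C]/(0 : R[i]) !mul0r mulr0 addr0.
Qed.

(** The exponents [e j] will be j for the dbar-part of the lift and j + 1 for its D-part; at 0 only
    the exponent 1 contributes. *)
Lemma mxpd_polynomial (M0 M1 : 'M[R[i]]_n) (s : seq nat) (e : nat -> nat) (C : nat -> 'M[R[i]]_n) :
  mxpd dR (fun h : R => M0 + h%:C *: M1 + \sum_(j <- s) h%:C ^+ e j *: C j) 0 =
  M1 + \sum_(j <- s) (e j == 1%N)%:R *: C j.
Proof.
have o := @openT R.
have s0 := @mxsmooth_on_cst R R n n setT M0.
have s1 := mxsmooth_on_scale o (@csmooth_real_line setT) (@mxsmooth_on_cst R R n n setT M1).
have sj j := mxsmooth_on_scale o (@csmooth_power setT (e j) o) (@mxsmooth_on_cst R R n n setT (C j)).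
have ss := mxsmooth_on_sum s xpredT o sj.
rewrite (mxpdD dR (mxsmooth_on_add o s0 s1) ss I) (mxpdD dR s0 s1 I) mxpd_cst add0r.
rewrite (mxpdZ dR (@csmooth_real_line setT) (@mxsmooth_on_cst R R n n setT M1) I).
rewrite mxpd_cst scaler0 addr0 pd_real_line scale1r; congr (_ + _).
rewrite (mxpd_sum dR s xpredT o sj I); apply: eq_bigr => j _.
rewrite (mxpdZ dR (@csmooth_power setT (e j) o) (@mxsmooth_on_cst R R n n setT (C j)) I).
by rewrite mxpd_cst scaler0 addr0 pd_power.
Qed.

End lambda_polynomials.

Section grading_section.
Context {R : realType} {S : surface R} {n l : nat} {g : cocycle S n}.
Hypothesis hS : riemann_surface S.
Variables (alpha Phi : endo S n) (p : 'I_l -> endo S n) (rk : 'I_l -> nat).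
Hypothesis hp : higgs_splitting g alpha Phi p rk.

Local Notation m := (@xi_mean R n l rk).
Local Notation w := (weight m).

Let pE k : endomorphism g (p k).
Proof. by case: hp => h _ _ _; have [[]] := h k. Qed.

Let p_sum i x : chart_dom S i x -> \sum_k p k i x = 1%:M.
Proof. by move=> ix; case: hp => _ /(_ i x ix)[]. Qed.

Let p_orth i x : chart_dom S i x -> forall a b, a != b -> p a i x *m p b i x = 0.
Proof. by move=> ix; case: hp => _ /(_ i x ix)[]. Qed.

Let p_idem i x : chart_dom S i x -> forall a, p a i x *m p a i x = p a i x.
Proof. by move=> ix a; case: hp => h _ _ _; have [[_ /(_ i x ix)[]]] := h a. Qed.

Lemma xi_endomorphism : endomorphism g (xi p rk).
Proof.
split=> [i|i j x ix jx].
  have oI := @chart_image_open _ _ hS i.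
  apply: (mxsmooth_on_sum _ xpredT oI) => k; have [sp _] := pE k.
  exact: (mxsmooth_on_scale oI (csmooth_on_cst _ (w k)) (sp i)).
rewrite /xi mulmx_sumr mulmx_suml; apply: eq_bigr => k _.
by have [_ tp] := pE k; rewrite (tp i j) // -scalemxAr -scalemxAl.
Qed.

Lemma xi_holomorphic i x : chart_dom S i x -> dbar_end alpha (xi p rk) i x = 0.
Proof.
move=> ix; have oI := @chart_image_open _ _ hS i.
have ss k : mxsmooth_on (chart_image (S := S) i) (fun q => w k *: p k i (chart_inv S i q)).
  have [sp _] := pE k.
  exact: (mxsmooth_on_scale oI (csmooth_on_cst _ (w k)) (sp i)).
have e1 : mxdzbar i (xi p rk i) x = \sum_k w k *: mxdzbar i (p k i) x.
  rewrite mxdzbarE; apply: (etrans (mxpd_sum dir_zbar _ xpredT oI ss (chart_in_image ix))).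
  apply: eq_bigr => k _; have [sp _] := pE k.
  rewrite (mxpdZ dir_zbar (csmooth_on_cst _ (w k)) (sp i) (chart_in_image ix)).
  by rewrite pd_cst scale0r add0r mxdzbarE.
rewrite /dbar_end e1 -[mxbracket _ _]opprK -bracketC /xi bracket_suml -sumrN -big_split /=.
apply: big1 => k _; case: hp => _ _ /(_ k i x ix) + _.
rewrite /dbar_end bracketZl -scalerN -bracketC -scalerDr => ->.
exact: scaler0.
Qed.

Lemma Phi_xi i x : chart_dom S i x -> mxbracket (Phi i x) (xi p rk i x) = Phi i x.
Proof.
move=> ix; apply: (bracket_raising m (p_sum ix) (p_orth ix) (p_idem ix)) => a b ab.
by case: hp => _ _ _; apply.
Qed.

Lemma grade_xi (u : endo S n) j i x : chart_dom S i x ->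
  mxbracket (grade p j u i x) (xi p rk i x) = - j%:R *: grade p j u i x.
Proof. by move=> ix; exact: (bracket_grade m (p_orth ix) (p_idem ix)). Qed.

End grading_section.

Section initial_values.
Context {R : realType} {S : surface R} {n l : nat}.
Variables (p : 'I_l -> endo S n) (alpha Phi h beta phi : endo S n).
Variables (psi varphi : nat -> endo S n) (eps r : R) (lt : R -> R[i] -> lconn_on S n).
Hypothesis r0 : 0 < r.
Hypothesis lt0 : forall q i x, disc r q -> chart_dom S i x ->
  dbar (lt 0 (to_complex q)) i x = dbar (lift_of_pair p alpha Phi h beta phi (to_complex q)) i x /\
  Dop (lt 0 (to_complex q)) i x = Dop (lift_of_pair p alpha Phi h beta phi (to_complex q)) i x.

Lemma lift_dbar_at0 i x : chart_dom S i x -> lift_dbar lt (0, (0, 0)) i x = alpha i x.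
Proof.
move=> ix; rewrite /lift_dbar (lt0 (disc0 r0) ix).1 /= -[to_complex _]/(0 : R[i]).
rewrite scale0r addr0 big_nat_cond big1 ?addr0 // => j /andP[/andP[j2 _] _].
by rewrite expr0n -[j == 0%N]negbK -lt0n (leq_trans _ j2) // scale0r.
Qed.

Lemma lift_D_at0 i x : chart_dom S i x -> lift_D lt (0, (0, 0)) i x = Phi i x.
Proof.
move=> ix; rewrite /lift_D (lt0 (disc0 r0) ix).2 /= -[to_complex _]/(0 : R[i]).
by rewrite scale0r addr0 big1 ?addr0 // => j _; rewrite expr0n scale0r.
Qed.

Lemma lift_dbar_lam_at0 i x : chart_dom S i x ->
  param_pd dir_lam (lift_dbar lt) (0, (0, 0)) i x = adj_h h Phi i x + grade p 1 beta i x.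
Proof.
move=> ix; rewrite /param_pd -mxpd_lam_slice.
have e : {in time_set r, (fun t => lift_dbar lt (0, (t, 0)) i x) =1 (fun t : R =>
    alpha i x + t%:C *: (adj_h h Phi i x + grade p 1 beta i x)
    + \sum_(2 <= j < l) t%:C ^+ j *: grade p j beta i x)}.
  by move=> t /set_mem ht; rewrite /lift_dbar (lt0 (disc_real ht) ix).1.
have o := @time_set_open R r.
have t0 : time_set r 0 by rewrite /time_set /= normr0.
rewrite (mxpd_eq_on _ o e (mem_set t0)) mxpd_polynomial.
rewrite big_nat_cond big1 ?addr0 // => j /andP[/andP[j2 _] _].
by rewrite gtn_eqF // scale0r.
Qed.

Lemma lift_D_lam_at0 i x : chart_dom S i x ->
  param_pd dir_lam (lift_D lt) (0, (0, 0)) i x = chern h alpha i x + grade p 0 phi i x.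
Proof.
move=> ix; rewrite /param_pd -mxpd_lam_slice.
have e : {in time_set r, (fun t => lift_D lt (0, (t, 0)) i x) =1 (fun t : R =>
    Phi i x + t%:C *: chern h alpha i x
    + \sum_(0 <= j < l) t%:C ^+ j.+1 *: grade p j phi i x)}.
  by move=> t /set_mem ht; rewrite /lift_D (lt0 (disc_real ht) ix).2.
have o := @time_set_open R r.
have t0 : time_set r 0 by rewrite /time_set /= normr0.
rewrite (mxpd_eq_on _ o e (mem_set t0)) mxpd_polynomial; congr (_ + _).
(* For [l = 0] there is no term of index 0 to split off, but then the index type of [grade] is empty
   and its value is zero. *)
case: (posnP l) => [l0|l0].
  rewrite big_geq ?l0 // /grade big1 // => a; exfalso.
  by have := leq_ltn_trans (leq0n a) (ltn_ord a); rewrite l0.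
rewrite big_ltn // scale1r big_nat_cond big1 ?addr0 // => j /andP[/andP[j1 _] _].
by rewrite eqSS gtn_eqF // scale0r.
Qed.

(** For each lambda in the disc, the t-derivative at 0 is the sum of the series. At lambda = 0 this
    leaves the constant coefficient, and differentiating along the real axis extracts the linear one
    by [power_series_derive]. *)
Lemma series_values (F : R -> R[i] -> atlas S -> S -> 'M[R[i]]_n) (c : nat -> endo S n) i x :
  (forall q a b, disc r q -> exists v,
     is_cderive (fun t => F t (to_complex q) i x a b) 0 v /\
     cseries_to (fun k => to_complex q ^+ k * c k i x a b) v) ->
  let G (s : R * (R * R)) : endo S n := F s.1 (to_complex s.2) in
  param_pd dir_t G (0, (0, 0)) i x = c 0%N i x /\
  param_pd dir_lam (param_pd dir_t G) (0, (0, 0)) i x = c 1%N i x.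
Proof.
move=> hF G.
have val q : disc r q -> forall a b,
    cseries_to (fun k => to_complex q ^+ k * c k i x a b) (param_pd dir_t G (0, q) i x a b).
  move=> hq a b; have [v [[dr di] hv]] := hF q a b hq.
  suff -> : param_pd dir_t G (0, q) i x a b = v by [].
  rewrite /param_pd -mxpd_t_slice mxE pd_real /cderive.
  have [_ ->] := dr; have [_ ->] := di.
  by case: (v).
split; apply/matrixP => a b.
  exact: (@power_series_at0 _ (fun k => c k i x a b) _ (val _ (disc0 r0) a b)).
rewrite {1}/param_pd -mxpd_lam_slice mxE pd_real.
exact: (@power_series_derive _ (fun k => c k i x a b)
  (fun t => param_pd dir_t G (0, (t, 0)) i x a b) r r0 (fun t ht => val _ (disc_real ht) a b)).
Qed.

End initial_values.

Section energy_variation.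
Context {R : realType} {S : surface R} {n : nat} {g : cocycle S n}.
Hypothesis hS : riemann_surface S.
Hypothesis hg : SU_cocycle g.
Hypothesis cS : compact [set: S].

Lemma surface_int_cases :
  is_integration (surface_int S) \/ surface_int S = (fun=> 0).
Proof.
by rewrite /surface_int; case: pselect => [ex|nex]; [left; exact: (projT2 (cid ex))|right].
Qed.

Variables (E : dh_map S n -> R[i]) (s : dh_map S n) (l0 : R[i] -> lconn_on S n).
Variables (psi varphi : nat -> endo S n) (eps r : R).
Variables (st : R -> dh_map S n) (lt : R -> R[i] -> lconn_on S n).
Hypothesis hE : is_energy g E.
Hypothesis hv : Defs.variation g s l0 psi varphi eps r st lt.

Local Notation O := (time_set eps `*` disc r).
Local Notation A := (lift_dbar lt).
Local Notation B := (lift_D lt).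
Local Notation c := ((2%:R * pi%:C * 'i%C)^-1).
Local Notation o := ((0, (0, 0)) : R * (R * R)).

Let e0 : 0 < eps. Proof. by case: hv => -[]. Qed.
Let r0 : 0 < r. Proof. by case: hv => -[]. Qed.
Let oO : open O := @domain_open R eps r.

Lemma time0 : time_set eps 0.
Proof. by rewrite /time_set /= normr0. Qed.

Lemma domain0 t : time_set eps t -> O (t, (0, 0)).
Proof. by move=> ht; split => //=; exact: disc0. Qed.

Lemma dbar_family : smooth_family O A.
Proof. by case: hv => _ _ h _ _ i; have [h1 _] := h i; exact: reassociate_smooth h1. Qed.

Lemma D_family : smooth_family O B.
Proof. by case: hv => _ _ h _ _ i; have [_ h1] := h i; exact: reassociate_smooth h1. Qed.

Lemma lift_connection q : O q -> lambda_connection g (LConn (to_complex q.2) (A q) (B q)).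
Proof.
move=> [/= ht hq]; case: hv => _ /(_ _ ht)[_ [[h _ _] _]] _ _ _.
have [e [cc _]] := h _ hq; move: cc.
by rewrite /lambda_connection /= e.
Qed.

Lemma energy_along t : time_set eps t ->
  E (st t) = c * surface_int S (trace_density B (param_pd dir_lam A) t).
Proof.
move=> ht; case: hv => _ /(_ _ ht)[hs hl] _ _ _.
rewrite (hE hs r0 hl) /lift_energy; congr (_ * _).
have [[_ _ hol] _] := hl.
case: surface_int_cases => [hI|->//].
apply: (integration_eq hI) => i x ix.
rewrite /trace_density /wedge10_01 (@lift_PsiE R S n lt t i x) // => a b.
by have [] := hol (0, 0) i x a b (disc0 r0) ix.
Qed.

(** Differentiation under the integral is used twice, since the t-derivative of the density is again
    a jointly smooth family of two-forms. *)
Lemma energy_second_derivative :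
  second_derivative_at0 (fun t => E (st t))
    (c * surface_int S (energy_density2 A B o dir_lam dir_t)).
Proof.
have [hI|eI] := surface_int_cases; last first.
  exists (fun=> 0); split; last by rewrite eI mulr0; exact: is_cderive_cst.
  have oT := @time_set_open R eps.
  apply: (filterS _ (open_nbhs_nbhs (conj oT time0))) => t ht.
  apply: (@is_cderive_eq_near _ (fun=> 0)); last exact: is_cderive_cst.
  apply: (filterS _ (open_nbhs_nbhs (conj oT ht))) => u hu.
  by rewrite energy_along // eI mulr0.
have sA := dbar_family; have sB := D_family.
have sP := smooth_family_pd hS oO dir_lam sA.
pose W := trace_density B (param_pd dir_lam A).
have jW : joint_smooth (S := S) eps W := trace_density_joint hS r0 sB sP.
have tW t : time_set eps t -> two_form (W t).
  move=> ht; have Ot := domain0 ht.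
  have fB : form10 g (B (t, (0, 0))).
    by apply: lam0_form10; have [_ hl _ _ _] := lift_connection Ot; exact: hl.
  have fA : form01 g (param_pd dir_lam A (t, (0, 0))).
    by apply: (param_pd_dbar hS oO _ sA) Ot => q /lift_connection[].
  exact: (two_form_trace hS hg fB fA).
pose W1 t : atlas S -> S -> R[i] := fun i x => tderive (fun u => W u i x) t.
have jW1 : joint_smooth (S := S) eps W1 := joint_smooth_tderive jW.
have tW1 t : time_set eps t -> two_form (W1 t) by exact: (tderive_two_form hS jW tW).
have oT := @time_set_open R eps.
exists (fun t => c * surface_int S (W1 t)); split.
  apply: (filterS _ (open_nbhs_nbhs (conj oT time0))) => t ht.
  apply: (@is_cderive_eq_near _ (fun t => c * surface_int S (W t))).
    by apply: (filterS _ (open_nbhs_nbhs (conj oT ht))) => u hu; rewrite energy_along.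
  exact: (is_cderiveZ c (integration_derive hS cS hI jW tW ht)).
have := is_cderiveZ c (integration_derive hS cS hI jW1 tW1 time0).
congr (is_cderive _ _ (_ * _)); apply: (integration_eq hI) => i x ix.
exact: (trace_density_tderive2 hS r0 sB sP time0 ix).
Qed.

Lemma density_trace (f0 f1 p0 p1 X : 'M[R[i]]_n) :
  - \tr (mxbracket f1 X *m p0) + \tr (f1 *m mxbracket p0 X)
  - \tr (mxbracket f0 X *m p1) + \tr (f0 *m mxbracket p1 X) + 2%:R * \tr (f0 *m p1) =
  \tr (- (p0 *m mxbracket f1 X) + f1 *m mxbracket p0 X - p1 *m mxbracket f0 X
       + f0 *m mxbracket p1 X + 2%:R *: (f0 *m p1)).
Proof.
move: (mxbracket f1 X) (mxbracket p0 X) (mxbracket f0 X) (mxbracket p1 X) => a1 a2 a3 a4.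
by rewrite !mxtraceD !mxtraceN mxtraceZ (mxtrace_mulC a1) (mxtrace_mulC a3).
Qed.

(** The data of a variation provide the t-derivative first and its lambda-coefficients afterwards,
    whereas the energy starts from the lambda-derivative; the symmetry of mixed derivatives
    reconciles the two orders. *)
Lemma initial_derivatives i x : chart_dom S i x ->
  [/\ param_pd dir_t A o i x = psi 0%N i x,
      param_pd dir_t (param_pd dir_lam A) o i x = psi 1%N i x,
      param_pd dir_t B o i x = varphi 0%N i x &
      param_pd dir_t (param_pd dir_lam B) o i x = varphi 1%N i x].
Proof.
move=> ix; have Oo := domain0 time0.
have comm (F : R * (R * R) -> endo S n) : smooth_family O F -> param_pd dir_t (param_pd dir_lam F) o i x =
    param_pd dir_lam (param_pd dir_t F) o i x.
  by move=> sF; exact: (mxpd_comm dir_t dir_lam oO (smooth_family_point hS sF ix) Oo).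
case: hv => _ _ _ _ h.
have [a1 a2] := @series_values R S n r r0 (fun t z => dbar (lt t z)) psi i x
  (fun q a b hq => (h q i x a b hq ix).1).
have [b1 b2] := @series_values R S n r r0 (fun t z => Dop (lt t z)) varphi i x
  (fun q a b hq => (h q i x a b hq ix).2).
split; [exact: a1| |exact: b1|].
  by rewrite (comm _ dbar_family); exact: a2.
by rewrite (comm _ D_family); exact: b2.
Qed.

End energy_variation.

Theorem proposition5p13 (R : realType) (S : surface R) (n : nat) (g : cocycle S n)
    (alpha Phi : endo S n) (l : nat) (p : 'I_l -> endo S n) (rk : 'I_l -> nat)
    (h beta phi : endo S n) (s : dh_map S n) (E : dh_map S n -> R[i])
    (psi varphi : nat -> endo S n) :
  compact_riemann_surface S -> genus_at_least S 2 ->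
  (0 < n)%N -> SU_cocycle g ->
  stable g (LConn 0 alpha Phi) -> Cstar_fixed_higgs g alpha Phi ->
  higgs_splitting g alpha Phi p rk ->
  harmonic_metric g alpha Phi h ->
  Bplus g p alpha Phi h beta phi ->
  section_of_pair g alpha Phi h beta phi s ->
  lift_on g s [set: R * R] (lift_of_pair p alpha Phi h beta phi) ->
  is_energy g E ->
  (forall k, form01 g (psi k) /\ trace_free (psi k)) ->
  (forall k, form10 g (varphi k) /\ trace_free (varphi k)) ->
  second_variation g E s (lift_of_pair p alpha Phi h beta phi) psi varphi
    ((2%:R * pi%:C * 'i%C)^-1 *
     surface_int S (fun i x =>
       \tr (wedge01_10 (psi 0%N) (endo_bracket (varphi 1%N) (xi p rk)) i x
          + wedge10_01 (varphi 1%N) (endo_bracket (psi 0%N) (xi p rk)) i x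
          + wedge01_10 (psi 1%N) (endo_bracket (varphi 0%N) (xi p rk)) i x
          + wedge10_01 (varphi 0%N) (endo_bracket (psi 1%N) (xi p rk)) i x
          + 2%:R *: wedge10_01 (varphi 0%N) (psi 1%N) i x))).
Proof.
move=> [hS cS _] _ _ hg [[hA hPhi _ _ _] _] _ hp [hh hit] _ _ _ hE _ _ eps r st lt hv.
have := energy_second_derivative hS hg cS hE hv.
congr (second_derivative_at0 _ (_ * _)).
have [hI|->//] := @surface_int_cases R S.
have r0 : 0 < r by case: hv => -[].
have lt0 := let: And5 _ _ _ e _ := hv in e.
pose X := xi p rk; pose A := lift_dbar lt; pose B := lift_D lt.
pose o : R * (R * R) := (0, (0, 0)).
have oO := @domain_open R eps r.
have Oo : (time_set eps `*` disc r) o := domain0 hv (time0 hv).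
have eX : endomorphism g X := xi_endomorphism hS hp.
(* The linear coefficient of the D-part is a (1,0)-connection because lambda has derivative 1 along
   [dir_lam]. *)
have lb : lam_operator g 1 (param_pd dir_lam B o).
  exact: (dQ_lam hS oO (D_family hv) (@csmooth_lam R _) (lift_connection hv)
    (fun q _ => pd_lam_lam q) Oo).
(* This coefficient is the Chern connection plus the degree 0 component of [phi], which commutes
   with xi. *)
have bX i x : chart_dom S i x ->
    mxbracket (param_pd dir_lam B o i x) (X i x) = mxbracket (chern h alpha i x) (X i x).
  move=> ix; rewrite (lift_D_lam_at0 r0 lt0 ix) bracketDl (grade_xi hp _ _ ix).
  by rewrite oppr0 scale0r addr0.
have [salpha _] := hA.
have par := harmonic_grading_parallel hS hg hh cS hI salpha (lam0_form10 hPhi) hit eX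
  (xi_holomorphic hS hp) (Phi_xi hp) lb bX.
have PhiX i x : chart_dom S i x -> mxbracket (B o i x) (X i x) = B o i x.
  by move=> ix; rewrite [B o i x](lift_D_at0 r0 lt0 ix); exact: (Phi_xi hp ix).
(* Bracketing with xi multiplies both summands of Psi by -1: the component of [beta] by its degree
   1, Phi^* by the Bochner argument. *)
have PsiX i x : chart_dom S i x ->
    mxbracket (param_pd dir_lam A o i x) (X i x) = - param_pd dir_lam A o i x.
  move=> ix; rewrite (lift_dbar_lam_at0 r0 lt0 ix) bracketDl (grade_xi hp _ _ ix).
  by rewrite (par i x ix).2 scaleN1r opprD.
have holX i x : chart_dom S i x -> dbar_end (A o) X i x = 0.
  by move=> ix; rewrite /dbar_end [A o i x](lift_dbar_at0 r0 lt0 ix); exact: (xi_holomorphic hS hp ix).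
have parX i x : chart_dom S i x -> lam_end 1 (param_pd dir_lam B o) X i x = 0.
  by move=> ix; have [] := par i x ix.
rewrite (energy_density2_integral hS hg cS hI oO (dbar_family hv) (D_family hv)
  (@csmooth_lam R _) (lift_connection hv) (fun q _ => pd_lam_lam q) (fun q _ => pd_t_lam q)
  Oo erefl eX PhiX PsiX holX parX).
apply: (integration_eq hI) => i x ix.
have [a0 a1 b0 b1] := initial_derivatives hS hv ix.
rewrite /variation_density a0 a1 b0 b1.
exact: density_trace.
Qed.
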